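(* Consider the model in the context with $\mathcal L(Z_1)$ and $\mathcal L(Z_2)$ each chosen from the four families C, E, G, L (with arbitrary scale parameters $\sigma_1$ for $Z_1$ and $\sigma_2$ for $Z_2$, and arbitrary $\beta>2$ for L), and any observed $y$. Write U, G, N for ''uniformly ergodic'', ''geometrically ergodic'', and ''not geometrically ergodic'' respectively. Then: For $\mathcal P_0=(X,\Theta)$: - if $Z_2$ is C: U for $Z_1\in\{$C, E, G, L$\}$; - if $Z_2$ is E: N for $Z_1=$C; for $Z_1=$E it is geometrically ergodic, and uniformly ergodic when $\sigma_2>\sigma_1$; U for $Z_1\in\{$G, L$\}$; - if $Z_2$ is G: N for $Z_1=$C; G for $Z_1\in\{$E, G, L$\}$; - if $Z_2$ is L: N for $Z_1=$C; G for $Z_1\in\{$E, G, L$\}$. For $\mathcal P_1=(\tilde X,\Theta)$: - if $Z_2$ is C: U for $Z_1=$C; N for $Z_1\in\{$E, G, L$\}$; - if $Z_2$ is E: U for $Z_1=$C; for $Z_1=$E it is geometrically ergodic, and uniformly ergodic when $\sigma_1>\sigma_2$; G for $Z_1\in\{$G, L$\}$; - if $Z_2$ is G: U for $Z_1\in\{$C, E$\}$; G for $Z_1\in\{$G, L$\}$; - if $Z_2$ is L: U for $Z_1\in\{$C, E$\}$; G for $Z_1\in\{$G, L$\}$.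
   Context: Fix an observed value $y\in\mathbb R$. Consider the model $Y=X+Z_1$, $X=\Theta+Z_2$, where $Z_1,Z_2$ are independent real random variables, independent of $\Theta$, and $\Theta$ is given the improper flat (Lebesgue) prior on $\mathbb R$. The error distributions are taken from the following families, with densities given up to proportionality and scale parameter $\sigma>0$: C (Cauchy) $g(x)\propto 1/(1+(x/\sigma)^2)$; E (double exponential) $g(x)\propto\exp\{-|x|/\sigma\}$; G (Gaussian) $g(x)\propto\exp\{-(x/\sigma)^2/2\}$; L (exponential power, lighter than Gaussian) $g(x)\propto\exp\{-|x/\sigma|^\beta\}$ with $\beta>2$. The scale of $Z_i$ is $\sigma_i$, $i=1,2$. Write $\tilde X=X-\Theta$. For a parametrisation $\mathcal P=(U,\Theta)$ with $U\in\{X,\tilde X\}$, the Gibbs sampler started at $\Theta_0$ iterates, for $n\ge1$: draw $U_n\sim\mathcal L(U\mid Y=y,\Theta=\Theta_{n-1})$, then $\Theta_n\sim\mathcal L(\Theta\mid Y=y,U=U_n)$. The centred parametrisation is $\mathcal P_0=(X,\Theta)$ and the non-centred one is $\mathcal P_1=(\tilde X,\Theta)$. A parametrisation is called geometrically ergodic if its marginal chain $\{\Theta_n\}$ satisfies $\|\mathcal L(\Theta_n\mid Y=y,\Theta_0)-\mathcal L(\Theta\mid Y=y)\|_{TV}\le M(\Theta_0)r^n$ for all $n$, for some $r<1$ and some function $M$; it is called uniformly ergodic if in addition $M$ can be taken bounded. *)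

(* Defs.v *)
From Stdlib Require Import Reals Lra ClassicalEpsilon.
Open Scope R_scope.

Definition improper_int (f : R -> R) (I : R) : Prop :=
  forall eps, 0 < eps -> exists A, forall a b, a <= - A -> A <= b ->
    exists pr : Riemann_integrable f a b, Rabs (RiemannInt pr - I) < eps.

(** The integral of f over R (its value when it exists; unspecified otherwise). *)
Definition Int (f : R -> R) : R :=
  epsilon (inhabits 0) (fun I => improper_int f I).

Inductive fam : Type :=
| FC
| FE
| FG
| FL (beta : R) (* exponential power exp(-|x/s|^beta), beta > 2 *).

Definition fam_ok (f : fam) : Prop :=
  match f with FL b => 2 < b | _ => True end.

Definition isC (f : fam) : Prop := f = FC.
Definition isE (f : fam) : Prop := f = FE.
Definition isG (f : fam) : Prop := f = FG.
Definition isL (f : fam) : Prop := exists b, f = FL b.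

Definition powabs (x b : R) : R :=
  if Req_dec_T x 0 then 0 else Rpower (Rabs x) b.

Definition gdens (f : fam) (s x : R) : R :=
  match f with
  | FC => / (1 + (x / s) ^ 2)
  | FE => exp (- (Rabs x / s))
  | FG => exp (- ((x / s) ^ 2 / 2))
  | FL b => exp (- powabs (x / s) b)
  end.

Inductive param : Type := Centred (* P0 = (X,Theta) *) | NonCentred (* P1 = (Xtilde,Theta) *).

(** Unnormalised joint posterior density of (U, Theta) given Y = y
    (flat prior on Theta): for P0, U = X, and
    p(x,t) = g1(y - x) g2(x - t); for P1, U = Xtilde = X - Theta, and
    p(u,t) = g1(y - t - u) g2(u). *)
Definition joint (P : param) (f1 : fam) (s1 : R) (f2 : fam) (s2 : R) (y : R)
  (u t : R) : R :=
  match P with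
  | Centred => gdens f1 s1 (y - u) * gdens f2 s2 (u - t)
  | NonCentred => gdens f1 s1 (y - t - u) * gdens f2 s2 u
  end.

Section Gibbs.
Variable p : R -> R -> R. (* unnormalised joint density p(u, theta) *)

Definition condU (t u : R) : R := p u t / Int (fun u' => p u' t).
Definition condT (u t : R) : R := p u t / Int (fun t' => p u t').

Definition kernel (t t' : R) : R := Int (fun u => condU t u * condT u t').

Definition posterior (t : R) : R :=
  Int (fun u => p u t) / Int (fun t' => Int (fun u => p u t')).

(** [lawS t0 n] : density of L(Theta_{n+1} | Y = y, Theta_0 = t0) *)
Fixpoint lawS (t0 : R) (n : nat) : R -> R :=
  match n with
  | O => fun t' => kernel t0 t'
  | S m => fun t' => Int (fun t => lawS t0 m t * kernel t t')
  end.

Definition tv (t0 : R) (n : nat) : R :=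
  / 2 * Int (fun t => Rabs (lawS t0 n t - posterior t)).

Definition geom_ergodic : Prop :=
  exists r, 0 <= r < 1 /\ exists M : R -> R,
    forall t0 n, tv t0 n <= M t0 * r ^ (S n).

Definition unif_ergodic : Prop :=
  exists r, 0 <= r < 1 /\ exists M : R,
    forall t0 n, tv t0 n <= M * r ^ (S n).
End Gibbs.

(* Main.v *)
(* After the substitution u -> y - u and a translation by y, both parametrisations are governed by
   one kernel k(t, t') = int q_t(u) b(u - t') du / int b, where q_t is proportional to
   a(u) b(u - t) and (a, b) is (g1, g2) for P0 and (g2, g1) for P1.  It is reversible with respect
   to D(t) = int a(u) b(u - t) du.

   Upper bounds.  If phi has total mass 0 and m is any function, then
   phi k = int phi(t) (k(t, .) - m) dt.  Hence int W(t') |k(t, t') - m(t')| dt' <= alpha W(t) with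
   alpha < 1 makes the W-weighted total variation distance to the posterior contract by alpha at
   each step.  With m a small multiple of b(|t| + 1), this holds for W = 1 as soon as D is
   dominated by b(|t| + 1): b Cauchy, or b exponential and a of lighter tail.  It holds for
   W = 1 + beta cosh(d t) when a and b both have exponential or lighter tails: pairing the
   points t + v and t - v shows that q_t moves mass towards the origin by an amount of order d,
   whereas the symmetric step with density b costs only a factor 1 + O(d^2).

   Lower bound.  If a is Cauchy and b is not, the steps of the chain have exponential moments, so
   after n steps the mass beyond A n is exponentially small, whereas the posterior mass there is
   of order 1 / n: the distance after n steps cannot be exponentially small. *)

From Stdlib Require Import Reals Lra Lia ClassicalEpsilon FunctionalExtensionality PropExtensionality.
From Coquelicot Require Import Coquelicot.
Require Import Defs.
Open Scope R_scope.

(** * Calculus of continuous functions *)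

(** [Int] is a choice operator on improper Riemann integrals, so it says something only where
    convergence has been proved. Every exchange of integrals therefore rests on continuity of the
    iterated integrals and on explicit dominating functions; multiples of the Cauchy density, the
    heaviest of the four tails, serve for most of them. Continuity of k in its starting point is
    awkward because q_t is normalised by D(t); reversibility reduces it to continuity in the end
    point.

    The factor beta in W = 1 + beta cosh(d t) settles a conflict. Near the origin the drift bound
    leaves an additive constant, which only the subtraction of m can pay for; far out k need not
    exceed m, so m is a loss, which only the drift can pay for. A small beta, with m proportional to
    it, makes both payments possible.

    The gain of order d against a cost of order d^2 is what covers two exponentials with arbitrary
    scales. There D need not be dominated by b: for equal scales D(t) is of order |t| b(t), and
    uniform contraction with W = 1 is out of reach of this method. *)

Definition cont (f : R -> R) : Prop := forall x : R, continuous f x.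

Lemma cont_const c : cont (fun _ => c).
Proof. intros x; apply continuous_const. Qed.

Lemma cont_id : cont (fun x => x).
Proof. intros x; apply continuous_id. Qed.

Lemma cont_ext f g : (forall x, f x = g x) -> cont f -> cont g.
Proof. intros h; now replace g with f by (apply functional_extensionality; auto). Qed.

Lemma cont_plus f g : cont f -> cont g -> cont (fun x => f x + g x).
Proof. intros hf hg x; apply (continuous_plus f g); auto. Qed.

Lemma cont_opp f : cont f -> cont (fun x => - f x).
Proof. intros hf x; apply (continuous_opp f); auto. Qed.

Lemma cont_minus f g : cont f -> cont g -> cont (fun x => f x - g x).
Proof. intros hf hg x; apply (continuous_minus f g); auto. Qed.

Lemma cont_mult f g : cont f -> cont g -> cont (fun x => f x * g x).
Proof. intros hf hg x; apply (continuous_mult f g); auto. Qed.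

Lemma cont_comp f g : cont f -> cont g -> cont (fun x => f (g x)).
Proof. intros hf hg x; apply (continuous_comp g f); auto. Qed.

Lemma cont_abs f : cont f -> cont (fun x => Rabs (f x)).
Proof. intros hf x; apply continuous_Rabs_comp; auto. Qed.

Lemma cont_exp f : cont f -> cont (fun x => exp (f x)).
Proof. intros hf x; apply continuous_exp_comp; auto. Qed.

Lemma cont_inv f : cont f -> (forall x, f x <> 0) -> cont (fun x => / f x).
Proof. intros hf h x; apply continuous_Rinv_comp; auto. Qed.

Lemma cont_div f g : cont f -> cont g -> (forall x, g x <> 0) -> cont (fun x => f x / g x).
Proof. intros hf hg h; apply cont_mult; auto using cont_inv. Qed.

Lemma cont_pow f n : cont f -> cont (fun x => f x ^ n).
Proof.
  intros hf; induction n as [|n IH]; simpl; [apply cont_const | now apply cont_mult].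
Qed.

Ltac cts := repeat lazymatch goal with
  | H : cont ?f |- cont ?f => exact H
  | |- cont (fun _ => ?c) => apply cont_const
  | |- cont (fun x => x) => apply cont_id
  | |- cont (fun x => @?f x + @?g x) => apply (cont_plus f g)
  | |- cont (fun x => @?f x - @?g x) => apply (cont_minus f g)
  | |- cont (fun x => - @?f x) => apply (cont_opp f)
  | |- cont (fun x => @?f x * @?g x) => apply (cont_mult f g)
  | |- cont (fun x => @?f x / @?g x) => apply (cont_div f g)
  | |- cont (fun x => / @?f x) => apply (cont_inv f)
  | |- cont (fun x => Rabs (@?f x)) => apply (cont_abs f)
  | |- cont (fun x => exp (@?f x)) => apply (cont_exp f)
  | |- cont (fun x => (@?f x) ^ ?n) => apply (cont_pow f n)
  | |- cont (fun x => ?f x) => solve [auto]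
  | |- cont (fun x => ?f (@?g x)) => apply (cont_comp f g)
  | |- cont _ => solve [auto]
  end.

Lemma cont_eps f : cont f <->
  (forall x eps, 0 < eps -> exists d, 0 < d /\
     forall x', Rabs (x' - x) < d -> Rabs (f x' - f x) < eps).
Proof.
  split.
  - intros hf x eps he.
    destruct (proj1 (filterlim_locally f (f x)) (hf x) (mkposreal eps he)) as [d hd].
    exists d; split; [apply cond_pos|]. intros x' hx'. apply (hd x'). exact hx'.
  - intros h x. apply filterlim_locally. intros eps.
    destruct (h x eps (cond_pos eps)) as [d [hd hx]].
    exists (mkposreal d hd). intros x' hx'. apply (hx x'). exact hx'.
Qed.

Lemma cont_ex f a b : cont f -> ex_RInt f a b.
Proof. intros h; apply @ex_RInt_continuous; auto. Qed.

#[local] Hint Resolve cont_ex : core.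

(** * Improper integrals of continuous functions *)

(** Continuity is bundled in, so that integrability on every box is automatic and only the limit has
    to be discussed. *)
Definition has_int (f : R -> R) (I : R) : Prop :=
  cont f /\ forall eps, 0 < eps -> exists A, 0 <= A /\
    forall a b, a <= - A -> A <= b -> Rabs (RInt f a b - I) < eps.

Definition summable (f : R -> R) : Prop := exists I, has_int f I.

Lemma improper_int_RInt f I : improper_int f I <->
  (forall eps, 0 < eps -> exists A, forall a b, a <= - A -> A <= b ->
     ex_RInt f a b /\ Rabs (RInt f a b - I) < eps).
Proof.
  split; intros h eps he; destruct (h eps he) as [A hA]; exists A; intros a b ha hb.
  - destruct (hA a b ha hb) as [pr hp]. split.
    + now apply ex_RInt_Reals_1.
    + now rewrite (RInt_Reals _ _ _ pr).
  - destruct (hA a b ha hb) as [ex hp].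
    exists (ex_RInt_Reals_0 _ _ _ ex). now rewrite <- RInt_Reals.
Qed.

Lemma improper_int_unique f I J : improper_int f I -> improper_int f J -> I = J.
Proof.
  rewrite !improper_int_RInt. intros h1 h2. apply cond_eq. intros eps he.
  destruct (h1 (eps/2)) as [A hA]; [lra|]. destruct (h2 (eps/2)) as [B hB]; [lra|].
  (* The thresholds in [improper_int] may be negative, hence the absolute values. *)
  set (M := Rmax (Rabs A) (Rabs B)).
  assert (Rabs A <= M) by apply Rmax_l. assert (Rabs B <= M) by apply Rmax_r.
  pose proof (Rle_abs A); pose proof (Rle_abs B).
  destruct (hA (-M) M) as [_ h3]; try lra. destruct (hB (-M) M) as [_ h4]; try lra.
  replace (I - J) with ((RInt f (-M) M - J) - (RInt f (-M) M - I)) by ring.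
  eapply Rle_lt_trans; [apply Rabs_triang|]. rewrite Rabs_Ropp. lra.
Qed.

(** Uniqueness of the limit pins down the value picked by [epsilon]; integrals get their values
    through this lemma. *)
Lemma has_int_Int f I : has_int f I -> Int f = I.
Proof.
  intros [hc h].
  assert (hI : improper_int f I).
  { apply improper_int_RInt. intros eps he. destruct (h eps he) as [A [hA h']].
    exists A. intros a b ha hb; split; auto. }
  apply (improper_int_unique f); auto.
  unfold Int. apply epsilon_spec. now exists I.
Qed.

Lemma summable_Int f : summable f -> has_int f (Int f).
Proof. intros [I h]. now rewrite (has_int_Int f I h). Qed.

Lemma summable_cont f : summable f -> cont f.
Proof. intros [I h]; apply h. Qed.

#[local] Hint Resolve summable_cont : core.

Lemma Int_ext f g : (forall x, f x = g x) -> Int f = Int g.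
Proof. intros h; now replace g with f by (apply functional_extensionality; auto). Qed.

Lemma Rint_plus f g a b : cont f -> cont g ->
  RInt (fun x => f x + g x) a b = RInt f a b + RInt g a b.
Proof. intros; apply (RInt_plus f g); auto. Qed.

Lemma Rint_scal f c a b : cont f -> RInt (fun x => c * f x) a b = c * RInt f a b.
Proof. intros; apply (RInt_scal f); auto. Qed.

Lemma Rint_chasles f a b c : cont f -> RInt f a c = RInt f a b + RInt f b c.
Proof. intros; symmetry; apply (RInt_Chasles f); auto. Qed.

Lemma Rint_ext (f g : R -> R) a b : (forall x, f x = g x) -> RInt f a b = RInt g a b.
Proof. intros; apply RInt_ext; auto. Qed.

Lemma Rint_le f g a b : cont f -> cont g -> a <= b ->
  (forall x, a <= x <= b -> f x <= g x) -> RInt f a b <= RInt g a b.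
Proof. intros; apply RInt_le; auto. intros; apply H2; lra. Qed.

Lemma Rint_ge0 f a b : cont f -> a <= b ->
  (forall x, a <= x <= b -> 0 <= f x) -> 0 <= RInt f a b.
Proof. intros; apply RInt_ge_0; auto. intros; apply H1; lra. Qed.

Lemma Rint_const c a b : RInt (fun _ => c) a b = (b - a) * c.
Proof. rewrite (RInt_const (V := R_CompleteNormedModule)). reflexivity. Qed.

Lemma has_int_plus f g I J : has_int f I -> has_int g J ->
  has_int (fun x => f x + g x) (I + J).
Proof.
  intros [cf hf] [cg hg]. split; [cts|]. intros eps he.
  destruct (hf (eps/2)) as [A [hA h1]]; [lra|]. destruct (hg (eps/2)) as [B [hB h2]]; [lra|].
  exists (A + B). split; [lra|]. intros a b ha hb.
  rewrite Rint_plus; auto.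
  replace (_ - _) with ((RInt f a b - I) + (RInt g a b - J)) by ring.
  specialize (h1 a b). specialize (h2 a b).
  eapply Rle_lt_trans; [apply Rabs_triang|].
  assert (Rabs (RInt f a b - I) < eps/2) by (apply h1; lra).
  assert (Rabs (RInt g a b - J) < eps/2) by (apply h2; lra). lra.
Qed.

Lemma has_int_scal f c I : has_int f I -> has_int (fun x => c * f x) (c * I).
Proof.
  intros [cf hf]. split; [cts|]. intros eps he.
  assert (hc : 0 < Rabs c + 1) by (pose proof (Rabs_pos c); lra).
  destruct (hf (eps / (Rabs c + 1))) as [A [hA h1]].
  { apply Rdiv_lt_0_compat; lra. }
  exists A. split; [lra|]. intros a b ha hb. rewrite Rint_scal; auto.
  replace (_ - _) with (c * (RInt f a b - I)) by ring. rewrite Rabs_mult.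
  specialize (h1 a b ha hb).
  apply Rle_lt_trans with ((Rabs c + 1) * Rabs (RInt f a b - I)).
  { apply Rmult_le_compat_r; [apply Rabs_pos|lra]. }
  apply Rmult_lt_compat_l with (r := Rabs c + 1) in h1; auto.
  replace ((Rabs c + 1) * (eps / (Rabs c + 1))) with eps in h1 by (field; lra). lra.
Qed.

Lemma summable_plus f g : summable f -> summable g -> summable (fun x => f x + g x).
Proof. intros [I h] [J h']; eexists; eapply has_int_plus; eauto. Qed.

Lemma summable_scal f c : summable f -> summable (fun x => c * f x).
Proof. intros [I h]; eexists; eapply has_int_scal; eauto. Qed.

Lemma summable_ext f g : (forall x, f x = g x) -> summable f -> summable g.
Proof. intros h; now replace g with f by (apply functional_extensionality; auto). Qed.

Lemma summable_minus f g : summable f -> summable g -> summable (fun x => f x - g x).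
Proof.
  intros hf hg. apply summable_ext with (fun x => f x + (-1) * g x); [intros; ring|].
  apply summable_plus; auto. now apply summable_scal.
Qed.

Lemma Int_plus f g : summable f -> summable g -> Int (fun x => f x + g x) = Int f + Int g.
Proof. intros; apply has_int_Int, has_int_plus; now apply summable_Int. Qed.

Lemma Int_scal f c : summable f -> Int (fun x => c * f x) = c * Int f.
Proof. intros; apply has_int_Int, has_int_scal; now apply summable_Int. Qed.

Lemma Int_minus f g : summable f -> summable g -> Int (fun x => f x - g x) = Int f - Int g.
Proof.
  intros hf hg. rewrite (Int_ext _ (fun x => f x + (-1) * g x)) by (intros; ring).
  rewrite Int_plus, Int_scal; auto; [ring|now apply summable_scal].
Qed.

Lemma RInt_box_mono f a b a' b' : cont f -> (forall x, 0 <= f x) ->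
  a' <= a -> a <= b -> b <= b' -> RInt f a b <= RInt f a' b'.
Proof.
  intros hc h0 h1 h2 h3.
  rewrite (Rint_chasles f a' a b'), (Rint_chasles f a b b'); auto.
  assert (0 <= RInt f a' a) by (apply Rint_ge0; auto).
  assert (0 <= RInt f b b') by (apply Rint_ge0; auto). lra.
Qed.

Lemma RInt_le_Int f a b : summable f -> (forall x, 0 <= f x) -> a <= b ->
  RInt f a b <= Int f.
Proof.
  intros hs h0 hab. apply le_epsilon. intros eps he.
  destruct (summable_Int f hs) as [hc h]. destruct (h eps he) as [A [hA h']].
  pose proof (Rle_abs a); pose proof (Rle_abs (-a)); rewrite Rabs_Ropp in *.
  pose proof (Rle_abs b); pose proof (Rle_abs (-b)); rewrite Rabs_Ropp in *.
  set (M := A + Rabs a + Rabs b).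
  assert (RInt f a b <= RInt f (-M) M) by (apply RInt_box_mono; unfold M in *; auto; lra).
  assert (hM : Rabs (RInt f (-M) M - Int f) < eps).
  { apply h'; unfold M; lra. }
  apply Rabs_def2 in hM. lra.
Qed.

(** For a nonnegative integrand the box integrals grow with the box, so their supremum over
    symmetric boxes is the limit over all boxes. *)
Lemma has_int_bounded f K : cont f -> (forall x, 0 <= f x) ->
  (forall B, 0 <= B -> RInt f (-B) B <= K) -> exists I, has_int f I /\ I <= K.
Proof.
  intros hc h0 hK.
  destruct (completeness (fun r => exists B, 0 <= B /\ r = RInt f (-B) B)) as [I [hI1 hI2]].
  - exists K. intros r [B [hB ->]]; auto.
  - exists (RInt f (-0) 0), 0. split; [lra|auto].
  - exists I. split.
    + split; auto. intros eps he.
      destruct (classic (exists B, 0 <= B /\ I - eps < RInt f (-B) B)) as [[B [hB hlt]]|hn].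
      * exists B. split; auto. intros a b ha hb.
        assert (RInt f (-B) B <= RInt f a b) by (apply RInt_box_mono; auto; lra).
        set (M := Rmax (-a) b). assert (-a <= M) by apply Rmax_l. assert (b <= M) by apply Rmax_r.
        assert (RInt f a b <= RInt f (-M) M) by (apply RInt_box_mono; auto; lra).
        assert (RInt f (-M) M <= I) by (apply hI1; exists M; split; auto; lra).
        apply Rabs_def1; lra.
      * exfalso. assert (I <= I - eps); [|lra].
        apply hI2. intros r [B [hB ->]].
        destruct (Rle_or_lt (RInt f (-B) B) (I - eps)); auto.
        exfalso; apply hn; now exists B.
    + apply hI2. intros r [B [hB ->]]; auto.
Qed.

Lemma summable_bounded f K : cont f -> (forall x, 0 <= f x) ->
  (forall B, 0 <= B -> RInt f (-B) B <= K) -> summable f /\ Int f <= K.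
Proof.
  intros hc h0 hK. destruct (has_int_bounded f K hc h0 hK) as [I [h1 h2]].
  split; [now exists I|]. now rewrite (has_int_Int f I h1).
Qed.

(** Adding [g] makes the integrand nonnegative: [f + g] lies between 0 and [2 * g], so monotone
    boundedness applies to it. *)
Lemma summable_dom f g : cont f -> summable g -> (forall x, Rabs (f x) <= g x) -> summable f.
Proof.
  intros hc hg hfg.
  assert (hs : summable (fun x => f x + g x)).
  { assert (hcg := summable_cont _ hg).
    apply (summable_bounded _ (2 * Int g)); [cts| |].
    - intros x. specialize (hfg x). pose proof (Rle_abs (- f x)).
      rewrite Rabs_Ropp in *. lra.
    - intros B hB. apply Rle_trans with (RInt (fun x => 2 * g x) (-B) B).
      + apply Rint_le; [cts|cts|lra|]. intros x _. pose proof (Rle_abs (f x)).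
        specialize (hfg x). lra.
      + rewrite Rint_scal; auto. apply Rmult_le_compat_l; [lra|].
        apply RInt_le_Int; auto; [|lra]. intros x. specialize (hfg x).
        pose proof (Rabs_pos (f x)); lra. }
  apply summable_ext with (fun x => (f x + g x) - g x); [intros; ring|].
  now apply summable_minus.
Qed.

Lemma Int_ge0 f : summable f -> (forall x, 0 <= f x) -> 0 <= Int f.
Proof.
  intros hs h0. apply Rle_trans with (RInt f 0 0); [|apply RInt_le_Int; auto; lra].
  apply Rint_ge0; auto; lra.
Qed.

Lemma Int_le f g : summable f -> summable g -> (forall x, f x <= g x) -> Int f <= Int g.
Proof.
  intros hf hg h. assert (0 <= Int (fun x => g x - f x)).
  { apply Int_ge0; [now apply summable_minus|]. intros x; specialize (h x); lra. }
  rewrite Int_minus in H; auto. lra.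
Qed.

Lemma summable_abs f g : cont f -> summable g -> (forall x, Rabs (f x) <= g x) ->
  summable (fun x => Rabs (f x)).
Proof.
  intros. apply summable_dom with g; auto; [cts|]. intros x; rewrite Rabs_Rabsolu; auto.
Qed.

Lemma Int_abs f : summable f -> summable (fun x => Rabs (f x)) ->
  Rabs (Int f) <= Int (fun x => Rabs (f x)).
Proof.
  intros hf ha. apply Rabs_le. split.
  - assert (Int (fun x => (-1) * f x) <= Int (fun x => Rabs (f x))).
    { apply Int_le; auto; [now apply summable_scal|]. intros x.
      pose proof (Rle_abs (- f x)); rewrite Rabs_Ropp in *; lra. }
    rewrite Int_scal in H; auto. lra.
  - apply Int_le; auto. intros x; apply Rle_abs.
Qed.

Lemma Int_pos f : summable f -> (forall x, 0 < f x) -> 0 < Int f.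
Proof.
  intros hs hp. apply Rlt_le_trans with (RInt f 0 1).
  - apply RInt_gt_0; auto; [lra|]. intros; now apply summable_cont.
  - apply RInt_le_Int; auto; [|lra]. intros x; left; auto.
Qed.

Lemma Int_tail f eps : summable f -> 0 < eps -> (forall x, 0 <= f x) ->
  exists A, 0 <= A /\ Int f <= RInt f (-A) A + eps.
Proof.
  intros hs he h0. destruct (summable_Int f hs) as [hc h].
  destruct (h eps he) as [A [hA h']]. exists A; split; auto.
  assert (h2 := h' (-A) A). apply Rabs_def2 in h2; lra.
Qed.

Lemma improper_int_affine f u v I : u = 1 \/ u = -1 ->
  improper_int f I -> improper_int (fun x => f (u * x + v)) I.
Proof.
  rewrite !improper_int_RInt. intros hu h eps he.
  destruct (h eps he) as [A hA]. exists (Rabs A + Rabs v). intros a b ha hb.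
  pose proof (Rle_abs v); pose proof (Rle_abs (-v)); rewrite Rabs_Ropp in *.
  pose proof (Rle_abs A).
  assert (E : forall w l, is_RInt f (u * a + v) (u * b + v) l -> u * w = 1 ->
     is_RInt (fun x => f (u * x + v)) a b (w * l)).
  { intros w l hl huw. apply is_RInt_comp_lin in hl.
    apply (is_RInt_scal _ _ _ w) in hl.
    eapply is_RInt_ext; [|exact hl]. intros x _. unfold scal; simpl; unfold mult; simpl.
    rewrite <- Rmult_assoc, (Rmult_comm w), huw. ring. }
  destruct hu as [-> | ->].
  - destruct (hA (1 * a + v) (1 * b + v)) as [hex hl]; [lra|lra|].
    assert (E1 := E 1 _ (RInt_correct (V := R_CompleteNormedModule) _ _ _ hex) ltac:(ring)).
    rewrite Rmult_1_l in E1.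
    split; [eexists; exact E1|]. now rewrite (is_RInt_unique _ _ _ _ E1).
  - destruct (hA (-1 * b + v) (-1 * a + v)) as [hex hl]; [lra|lra|].
    assert (E1 := E (-1) _ (is_RInt_swap _ _ _ _
        (RInt_correct (V := R_CompleteNormedModule) _ _ _ hex)) ltac:(ring)).
    assert (hop : forall r : R, -1 * opp r = r) by (intros r; change (-1 * - r = r); ring).
    rewrite hop in E1.
    split; [eexists; exact E1|]. now rewrite (is_RInt_unique _ _ _ _ E1).
Qed.

(** The predicates under the two choice operators are equal, so the identity holds for every [f],
    convergent or not. This is why the transport of the chain along translations needs no
    hypotheses. *)
Lemma Int_shift f v : Int (fun x => f (x - v)) = Int f.
Proof.
  unfold Int. f_equal. apply functional_extensionality; intros I.
  apply propositional_extensionality; split; intros h.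
  - apply improper_int_affine with (u := 1) (v := v) in h; auto.
    replace f with (fun x => f (1 * x + v - v)); auto.
    apply functional_extensionality; intros x; f_equal; ring.
  - apply improper_int_affine with (u := 1) (v := -v) in h; auto.
    replace (fun x => f (x - v)) with (fun x => f (1 * x + -v)); auto.
    apply functional_extensionality; intros x; f_equal; ring.
Qed.

Lemma Int_reflect f v : Int (fun x => f (v - x)) = Int f.
Proof.
  unfold Int. f_equal. apply functional_extensionality; intros I.
  apply propositional_extensionality; split; intros h.
  - apply improper_int_affine with (u := -1) (v := v) in h; auto.
    replace f with (fun x => f (v - (-1 * x + v))); auto.
    apply functional_extensionality; intros x; f_equal; ring.
  - apply improper_int_affine with (u := -1) (v := v) in h; auto.
    replace (fun x => f (v - x)) with (fun x => f (-1 * x + v)); auto.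
    apply functional_extensionality; intros x; f_equal; ring.
Qed.

(** * Tonelli's theorem *)

Definition jcont (f : R -> R -> R) : Prop := forall x y, continuity_2d_pt f x y.

Lemma jcont_swap f : jcont f -> jcont (fun x y => f y x).
Proof.
  intros h x y eps. destruct (h y x eps) as [d hd]. exists d. intros u v hu hv. now apply hd.
Qed.

Lemma jcont_r f x : jcont f -> cont (f x).
Proof.
  intros h. apply cont_eps. intros y eps he.
  destruct (h x y (mkposreal eps he)) as [d hd]. exists d; split; [apply cond_pos|].
  intros y' hy. apply hd; auto. rewrite Rminus_diag, Rabs_R0. apply cond_pos.
Qed.

Lemma jcont_l f y : jcont f -> cont (fun x => f x y).
Proof. intros h. apply (jcont_r (fun y x => f x y)), jcont_swap, h. Qed.

Lemma jcont_mult f g : jcont f -> jcont g -> jcont (fun x y => f x y * g x y).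
Proof. intros hf hg x y. now apply continuity_2d_pt_mult. Qed.

Lemma jcont_of_l f : cont f -> jcont (fun x _ => f x).
Proof.
  intros h x y eps. destruct (proj1 (cont_eps f) h x eps (cond_pos eps)) as [d [hd hx]].
  exists (mkposreal d hd). intros u v hu hv. now apply hx.
Qed.

Lemma jcont_of_r f : cont f -> jcont (fun _ y => f y).
Proof. intros h. apply (jcont_swap (fun y _ => f y)), jcont_of_l, h. Qed.

Lemma cont_RInt_param f a b : a <= b -> jcont f -> cont (fun x => RInt (f x) a b).
Proof.
  intros hab hj. apply cont_eps. intros x eps he.
  assert (hp : 0 < eps / (b - a + 1)) by (apply Rdiv_lt_0_compat; lra).
  destruct (uniform_continuity_2d_1d (fun y x => f x y) a b x
    (fun y _ => jcont_swap f hj y x) (mkposreal _ hp)) as [d hd].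
  exists d. split; [apply cond_pos|]. intros x' hx'.
  assert (hc : forall z, cont (f z)) by (intros z; now apply jcont_r).
  assert (hcm : cont (fun y => f x' y + (-1) * f x y)) by (cts; auto).
  replace (RInt (f x') a b - RInt (f x) a b) with (RInt (fun y => f x' y + (-1) * f x y) a b).
  2:{ rewrite Rint_plus, Rint_scal by (cts; apply hc). simpl; ring. }
  eapply Rle_lt_trans; [apply abs_RInt_le_const; auto|].
  - intros t ht. left. replace (f x' t + -1 * f x t) with (f x' t - f x t) by ring.
    pose proof (cond_pos d). apply Rabs_def2 in hx' as hx2.
    apply (hd t x t x'); auto; try (split; lra). rewrite Rminus_diag, Rabs_R0; auto.
  - simpl. replace eps with ((b - a + 1) * (eps / (b - a + 1))) at 2 by (field; lra).
    apply Rmult_lt_compat_r; lra.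
Qed.

Lemma is_derive_primitive f a x : cont f -> is_derive (fun z => RInt f a z) x (f x).
Proof.
  intros h. apply (is_derive_RInt f (fun z => RInt f a z) a x); auto.
  apply filter_forall. intros z. apply (RInt_correct (V := R_CompleteNormedModule)). auto.
Qed.

(** As functions of the upper end point of the outer variable, both sides vanish at [a] and have the
    same derivative. *)
Lemma RInt_swap_compact f a b c d : a <= b -> c <= d -> jcont f ->
  RInt (fun x => RInt (f x) c d) a b = RInt (fun y => RInt (fun x => f x y) a b) c d.
Proof.
  intros hab hcd hj. destruct (Req_dec a b) as [->|hne].
  { rewrite RInt_point.
    rewrite (RInt_ext _ (fun _ => 0)); [rewrite Rint_const; symmetry; apply Rmult_0_r|].
    intros y _. apply (RInt_point b (fun x => f x y)). }
  assert (hl : forall y, cont (fun x => f x y)) by (intros; now apply jcont_l).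
  set (Phi := fun z => RInt (fun y => RInt (fun x => f x y) a z) c d).
  set (Psi := fun z => RInt (fun x => RInt (f x) c d) a z).
  assert (E : Phi b - Psi b = Phi a - Psi a).
  { symmetry. apply (eq_is_derive (fun z => Phi z - Psi z)); [|lra]. intros t ht.
    cut (is_derive (fun z => Phi z - Psi z) t (RInt (f t) c d - RInt (f t) c d)).
    { intros hh. rewrite Rminus_diag in hh. exact hh. }
    apply (is_derive_minus Phi Psi).
    - assert (hD : forall z y, Derive (fun z0 => RInt (fun x => f x y) a z0) z = f z y).
      { intros z y. apply is_derive_unique.
        apply (is_derive_primitive (fun x => f x y)); auto. }
      replace (RInt (f t) c d) with
        (RInt (fun y => Derive (fun z0 => RInt (fun x => f x y) a z0) t) c d)
        by (apply RInt_ext; auto).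
      apply (is_derive_RInt_param (fun z y => RInt (fun x => f x y) a z)).
      + apply filter_forall. intros z y _. eexists.
        apply (is_derive_primitive (fun x => f x y)); auto.
      + intros y _. apply continuity_2d_pt_ext with f; auto.
      + apply filter_forall. intros z. apply cont_ex.
        (* Differentiation under the integral asks for integrability at all nearby end points [z],
           including those left of [a], where the orientation is reversed. *)
        destruct (Rle_or_lt a z).
        * apply (cont_RInt_param (fun y x => f x y)); auto. now apply jcont_swap.
        * assert (cont (fun y => -1 * RInt (fun x => f x y) z a)).
          { cts. apply (cont_RInt_param (fun y x => f x y)); [lra|]. now apply jcont_swap. }
          intros y. eapply continuous_ext; [|apply (H0 y)]. intros w. simpl.
          rewrite <- (opp_RInt_swap (fun x => f x w) z a); auto.
          change (-1 * RInt (fun x => f x w) z a = - RInt (fun x => f x w) z a). ring.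
    - apply (is_derive_primitive (fun x => RInt (f x) c d)).
      now apply cont_RInt_param. }
  assert (hPsi : Psi a = 0) by apply (RInt_point a (fun x => RInt (f x) c d)).
  assert (hPhi : Phi a = 0).
  { unfold Phi. rewrite (RInt_ext _ (fun _ => 0)), Rint_const; [apply Rmult_0_r|].
    intros y _. apply (RInt_point a (fun x => f x y)). }
  rewrite hPsi, hPhi, Rminus_diag in E. symmetry. exact (Rminus_diag_uniq _ _ E).
Qed.

(** Domination locally uniform in the second variable: the tails of the inner integrals are then
    small uniformly over a box. *)
Definition loc_dom (f : R -> R -> R) : Prop := forall B, 0 <= B -> exists g, summable g /\
  forall x y, Rabs y <= B -> f x y <= g x.

(* One half of Tonelli's theorem, stated so that only box integrals in [y] are needed. *)
Lemma Int_tonelli_le f H : jcont f -> (forall x y, 0 <= f x y) -> loc_dom f ->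
  cont (fun y => Int (fun x => f x y)) -> summable H ->
  (forall x B, 0 <= B -> RInt (f x) (-B) B <= H x) ->
  summable (fun y => Int (fun x => f x y)) /\ Int (fun y => Int (fun x => f x y)) <= Int H.
Proof.
  intros hj h0 hd hG hH hb.
  assert (hl : forall y, cont (fun x => f x y)) by (intros; now apply jcont_l).
  assert (hs : forall y, summable (fun x => f x y)).
  { intros y. destruct (hd (Rabs y) (Rabs_pos y)) as [g [hg hfg]].
    apply summable_dom with g; auto. intros x. rewrite Rabs_pos_eq; auto.
    apply hfg. lra. }
  apply summable_bounded; auto.
  { intros y; apply Int_ge0; auto. }
  intros B hB. apply le_epsilon. intros eps he.
  destruct (hd B hB) as [g [hg hfg]].
  assert (hg0 : forall x, 0 <= g x).
  { intros x. apply Rle_trans with (f x 0); auto. apply hfg. rewrite Rabs_R0; auto. }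
  (* The tail of [g] is spread over a box of length [2 * B], so its total cost stays below [eps]. *)
  destruct (Int_tail g (eps / (2 * B + 1))) as [A [hA ht]]; auto.
  { apply Rdiv_lt_0_compat; lra. }
  assert (hbox : cont (fun y => RInt (fun x => f x y) (-A) A)).
  { apply (cont_RInt_param (fun y x => f x y)); [lra|]. now apply jcont_swap. }
  apply Rle_trans with
    (RInt (fun y => RInt (fun x => f x y) (-A) A + eps / (2 * B + 1)) (-B) B).
  - apply Rint_le; auto; [cts; auto|lra|]. intros y hy.
    (* Since [g - f] is nonnegative, the tail of [f] outside the box is at most that of [g]. *)
    assert (Int (fun x => g x - f x y) >= RInt (fun x => g x + (-1) * f x y) (-A) A).
    { apply Rle_ge. rewrite (Rint_ext _ (fun x => g x - f x y)) by (intros; ring).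
      apply RInt_le_Int; [now apply summable_minus| |lra].
      intros x. assert (f x y <= g x); [|lra]. apply hfg. apply Rabs_le; lra. }
    rewrite Int_minus, Rint_plus, Rint_scal in H0; auto; [|cts; auto]. lra.
  - rewrite (Rint_plus (fun y => RInt (fun x => f x y) (-A) A)); [|auto|cts].
    rewrite Rint_const. apply Rplus_le_compat.
    + rewrite <- (RInt_swap_compact f); auto; try lra.
      apply Rle_trans with (RInt H (-A) A).
      * apply Rint_le; auto; [apply cont_RInt_param; auto; lra|lra].
      * apply RInt_le_Int; auto; [|lra]. intros x.
        apply Rle_trans with (RInt (f x) (-0) 0); [|apply hb; lra].
        apply Rint_ge0; [now apply jcont_r|lra|auto].
    + replace ((B - - B) * (eps / (2 * B + 1))) with (eps * (2 * B / (2 * B + 1))) by (field; lra).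
      rewrite <- (Rmult_1_r eps) at 2. apply Rmult_le_compat_l; [lra|].
      apply Rle_div_l; lra.
Qed.

(** The half version used in both directions. Continuity of the new iterated integral is assumed
    because summability includes it. *)
Lemma Int_tonelli f : jcont f -> (forall x y, 0 <= f x y) ->
  loc_dom f -> loc_dom (fun y x => f x y) ->
  cont (fun y => Int (fun x => f x y)) -> summable (fun x => Int (f x)) ->
  summable (fun y => Int (fun x => f x y)) /\
  Int (fun y => Int (fun x => f x y)) = Int (fun x => Int (f x)).
Proof.
  intros hj h0 hd hd' hG hH.
  assert (hs : forall x, summable (f x)).
  { intros y. destruct (hd' (Rabs y) (Rabs_pos y)) as [g [hg hfg]].
    apply summable_dom with g; auto; [now apply jcont_r|]. intros x. rewrite Rabs_pos_eq; auto.
    apply hfg. lra. }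
  assert (hs' : forall y, summable (fun x => f x y)).
  { intros y. destruct (hd (Rabs y) (Rabs_pos y)) as [g [hg hfg]].
    apply summable_dom with g; auto; [now apply jcont_l|]. intros x. rewrite Rabs_pos_eq; auto.
    apply hfg. lra. }
  destruct (Int_tonelli_le f (fun x => Int (f x))) as [h1 h2]; auto.
  { intros x B hB. apply RInt_le_Int; auto; lra. }
  split; auto. apply Rle_antisym; auto.
  apply (Int_tonelli_le (fun y x => f x y) (fun y => Int (fun x => f x y))); auto.
  - now apply jcont_swap.
  - intros y B hB. apply RInt_le_Int; auto; lra.
Qed.

(** Move in [y] first, at the displaced point [x'], with a modulus that is uniform there; then move
    in [x] at the fixed [y]. *)
Lemma jcont_equi f : (forall y, cont (fun x => f x y)) ->
  (forall x eps, 0 < eps -> exists d, 0 < d /\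
     forall x' y y', Rabs (x' - x) < d -> Rabs (y' - y) < d -> Rabs (f x' y' - f x' y) < eps) ->
  jcont f.
Proof.
  intros hx hy x y eps.
  destruct (hy x (eps/2)) as [d [hd h1]]; [apply is_pos_div_2|].
  destruct (proj1 (cont_eps _) (hx y) x (eps/2)) as [d' [hd' h2]]; [apply is_pos_div_2|].
  assert (hm : 0 < Rmin d d') by now apply Rmin_glb_lt.
  exists (mkposreal _ hm). simpl. intros u v hu hv.
  pose proof (Rmin_l d d'); pose proof (Rmin_r d d').
  replace (f u v - f x y) with ((f u v - f u y) + (f u y - f x y)) by ring.
  eapply Rle_lt_trans; [apply Rabs_triang|].
  assert (Rabs (f u v - f u y) < eps/2) by (apply h1; lra).
  assert (Rabs (f u y - f x y) < eps/2) by (apply h2; lra). lra.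
Qed.

Lemma cont_Int_param f g : (forall x, summable (f x)) -> summable g -> (forall u, 0 <= g u) ->
  (forall x0 eps, 0 < eps -> exists d, 0 < d /\
     forall x u, Rabs (x - x0) < d -> Rabs (f x u - f x0 u) <= eps * g u) ->
  cont (fun x => Int (f x)).
Proof.
  intros hf hg h0 h. apply cont_eps. intros x eps he.
  assert (hI := Int_ge0 g hg h0).
  destruct (h x (eps / (Int g + 1))) as [d [hd hx]]; [apply Rdiv_lt_0_compat; lra|].
  exists d; split; auto. intros x' hx'. rewrite <- Int_minus; auto.
  assert (hsc : summable (fun u => eps / (Int g + 1) * g u)) by now apply summable_scal.
  assert (hm : summable (fun u => f x' u - f x u)) by now apply summable_minus.
  assert (ha : summable (fun u => Rabs (f x' u - f x u))).
  { apply (summable_abs (fun u => f x' u - f x u) _ (summable_cont _ hm) hsc). intros; now apply hx. }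
  eapply Rle_lt_trans; [apply (Int_abs (fun u => f x' u - f x u)); auto|].
  apply Rle_lt_trans with (Int (fun u => eps / (Int g + 1) * g u)).
  - apply Int_le; auto.
  - rewrite Int_scal; auto.
    replace (eps / (Int g + 1) * Int g) with (eps * (Int g / (Int g + 1))) by (field; lra).
    rewrite <- (Rmult_1_r eps) at 2. apply Rmult_lt_compat_l; auto.
    apply Rlt_div_l; lra.
Qed.

(** * Cauchy envelopes *)

Definition cauchyd (x : R) : R := / (1 + x ^ 2).

Lemma cauchy_den x : 0 < 1 + x ^ 2.
Proof. pose proof (pow2_ge_0 x); lra. Qed.

Lemma cauchy_pos x : 0 < cauchyd x.
Proof. apply Rinv_0_lt_compat, cauchy_den. Qed.

Lemma cauchy_cont : cont cauchyd.
Proof. unfold cauchyd. cts. intros x; pose proof (cauchy_den x); lra. Qed.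

Lemma cauchy_summable : summable cauchyd.
Proof.
  apply (summable_bounded _ PI); [apply cauchy_cont| |].
  - intros x; left; apply cauchy_pos.
  - intros B hB.
    assert (h : is_RInt cauchyd (-B) B (minus (atan B) (atan (-B)))).
    { apply (is_RInt_derive atan cauchyd).
      - intros x _. unfold cauchyd. apply is_derive_Reals.
        apply derivable_pt_lim_atan.
      - intros x _. apply cauchy_cont. }
    rewrite (is_RInt_unique _ _ _ _ h). unfold minus, plus, opp; simpl.
    pose proof (atan_bound B); pose proof (atan_bound (-B)). lra.
Qed.

(** [cauchy_shift] and [cauchy_conv] keep this class stable, up to constants, under translation and
    convolution. *)
Definition envelope (f : R -> R) : Prop := exists C, forall x, Rabs (f x) <= C * cauchyd x.

Lemma summable_envelope f : cont f -> envelope f -> summable f.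
Proof.
  intros hc [C hC]. apply summable_dom with (fun x => C * cauchyd x); auto.
  apply summable_scal, cauchy_summable.
Qed.

(** With s = u - t the claim is 1 + (s + t)^2 <= 2 (1 + s^2)(1 + t^2), and the difference of the two
    sides is 1 + (s - t)^2 + 2 s^2 t^2. *)
Lemma cauchy_shift u t : cauchyd (u - t) <= 2 * (1 + t ^ 2) * cauchyd u.
Proof.
  unfold cauchyd. pose proof (cauchy_den u); pose proof (cauchy_den (u - t)).
  apply Rmult_le_reg_r with ((1 + u ^ 2) * (1 + (u - t) ^ 2)); [nra|].
  replace (/ (1 + (u - t) ^ 2) * ((1 + u ^ 2) * (1 + (u - t) ^ 2))) with (1 + u ^ 2) by (field; lra).
  replace (2 * (1 + t ^ 2) * / (1 + u ^ 2) * ((1 + u ^ 2) * (1 + (u - t) ^ 2)))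
    with (2 * (1 + t ^ 2) * (1 + (u - t) ^ 2)) by (field; lra).
  assert (0 <= (u - 2 * t) ^ 2) by apply pow2_ge_0.
  assert (0 <= (t * (u - t)) ^ 2) by apply pow2_ge_0.
  nra.
Qed.

(** Without denominators this is 1 + t^2 <= 2 (1 + u^2) + 2 (1 + (u - t)^2): one of u and u - t must
    be large if t is. Integrated in u, it shows that the convolution of Cauchy tails has a Cauchy
    tail. *)
Lemma cauchy_conv u t : cauchyd u * cauchyd (u - t) <= 2 * cauchyd t * (cauchyd u + cauchyd (u - t)).
Proof.
  unfold cauchyd. pose proof (cauchy_den u); pose proof (cauchy_den (u - t)); pose proof (cauchy_den t).
  apply Rmult_le_reg_r with ((1 + u ^ 2) * (1 + (u - t) ^ 2) * (1 + t ^ 2)).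
  { apply Rmult_lt_0_compat; auto; apply Rmult_lt_0_compat; auto. }
  replace (_ * _ * ((1 + u ^ 2) * (1 + (u - t) ^ 2) * (1 + t ^ 2))) with (1 + t ^ 2) by (field; lra).
  replace (2 * / (1 + t ^ 2) * (/ (1 + u ^ 2) + / (1 + (u - t) ^ 2)) * ((1 + u ^ 2) * (1 + (u - t) ^ 2) * (1 + t ^ 2)))
    with (2 * ((1 + u ^ 2) + (1 + (u - t) ^ 2))) by (field; lra).
  assert (0 <= (2 * u - t) ^ 2) by apply pow2_ge_0. nra.
Qed.

Lemma jcont_minus f g : jcont f -> jcont g -> jcont (fun x y => f x y - g x y).
Proof. intros hf hg x y. now apply continuity_2d_pt_minus. Qed.

Lemma jcont_abs f : jcont f -> jcont (fun x y => Rabs (f x y)).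
Proof.
  intros hf x y eps. destruct (hf x y eps) as [d hd]. exists d. intros u v hu hv.
  eapply Rle_lt_trans; [apply Rabs_triang_inv2|]. now apply hd.
Qed.

Lemma jcont_diff f : cont f -> jcont (fun x y => f (x - y)).
Proof.
  intros hf x y eps.
  destruct (proj1 (cont_eps f) hf (x - y) eps (cond_pos eps)) as [d [hd h]].
  assert (hd2 : 0 < d / 2) by lra. exists (mkposreal _ hd2). simpl. intros u v hu hv. apply h.
  replace (u - v - (x - y)) with ((u - x) - (v - y)) by ring.
  eapply Rle_lt_trans; [apply Rabs_triang|]. rewrite Rabs_Ropp. lra.
Qed.

Lemma cont_bounded f B : cont f -> 0 <= B ->
  exists M, 0 <= M /\ forall x, Rabs x <= B -> Rabs (f x) <= M.
Proof.
  intros hf hB.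
  destruct (continuity_ab_maj (fun x => Rabs (f x)) (-B) B) as [x0 [h _]]; [lra| |].
  { intros c _. apply continuity_pt_filterlim. apply (cont_abs f hf c). }
  exists (Rabs (f x0)). split; [apply Rabs_pos|]. intros x hx. apply h.
  now apply Rabs_le_between in hx.
Qed.

(** * The transition kernel *)

(* Not normalised; [density_decr] contains the symmetry of [f]. *)
Record density (f : R -> R) : Prop := {
  density_cont : cont f;
  density_pos : forall x, 0 < f x;
  density_env : exists C, 0 < C /\ forall x, f x <= C * cauchyd x;
  density_decr : forall x y, Rabs x <= Rabs y -> f y <= f x }.

Lemma cauchy_even x : cauchyd (- x) = cauchyd x.
Proof. unfold cauchyd. f_equal. ring. Qed.

Lemma cauchy_le1 x : cauchyd x <= 1.
Proof.
  unfold cauchyd. rewrite <- Rinv_1. apply Rinv_le_contravar; [lra|].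
  pose proof (pow2_ge_0 x); lra.
Qed.

Lemma density_even f x : density f -> f (- x) = f x.
Proof. intros h. apply Rle_antisym; apply (density_decr f h); rewrite Rabs_Ropp; lra. Qed.

Lemma density_sym f x y : density f -> f (x - y) = f (y - x).
Proof. intros h. rewrite <- density_even; auto. f_equal; ring. Qed.

Lemma density_max f x : density f -> f x <= f 0.
Proof. intros h. apply (density_decr f h). rewrite Rabs_R0; apply Rabs_pos. Qed.

Lemma density_summable f : density f -> summable f.
Proof.
  intros h. destruct (density_env f h) as [C [hC hf]].
  apply summable_envelope; [apply h|]. exists C. intros x.
  rewrite Rabs_pos_eq; auto. left; apply h.
Qed.

(** Heine on a box, smallness outside it; the margin 1 keeps two close points in a common regime.
    The uniform modulus is what makes [marg] continuous and the kernel equicontinuous. *)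
Lemma density_unif_cont f eps : density f -> 0 < eps ->
  exists d, 0 < d /\ forall x y, Rabs (x - y) < d -> Rabs (f x - f y) < eps.
Proof.
  intros h he. destruct (density_env f h) as [C [hC hf]].
  set (A := C / eps + 1). assert (hA1 : 0 < C / eps) by (apply Rdiv_lt_0_compat; lra).
  assert (hsmall : forall x, A <= Rabs x -> f x < eps).
  { intros x hx. eapply Rle_lt_trans; [apply hf|]. unfold cauchyd.
    apply Rlt_div_l; [apply cauchy_den|].
    rewrite <- (pow2_abs x). replace C with (eps * (C / eps)) by (field; lra).
    apply Rmult_lt_compat_l; auto. unfold A in hx. nra. }
  destruct (@Heine_cor2 f (-(A + 1)) (A + 1)) with (eps := mkposreal eps he) as [d hd].
  { intros x _. apply continuity_pt_filterlim, (density_cont f h). }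
  exists (Rmin d 1). split; [apply Rmin_glb_lt; [apply cond_pos|lra]|].
  intros x y hxy. pose proof (Rmin_l d 1); pose proof (Rmin_r d 1).
  assert (Rabs x - Rabs y <= Rabs (x - y)) by apply Rabs_triang_inv.
  assert (Rabs y - Rabs x <= Rabs (x - y)) by (rewrite Rabs_minus_sym; apply Rabs_triang_inv).
  pose proof (density_pos f h x); pose proof (density_pos f h y).
  destruct (Rle_or_lt (Rabs x) (A + 1)).
  - destruct (Rle_or_lt (Rabs y) (A + 1)).
    + apply hd; [now apply Rabs_le_between|now apply Rabs_le_between|lra].
    + assert (f x < eps) by (apply hsmall; lra). assert (f y < eps) by (apply hsmall; lra).
      apply Rabs_def1; lra.
  - assert (f x < eps) by (apply hsmall; lra). assert (f y < eps) by (apply hsmall; lra).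
    apply Rabs_def1; lra.
Qed.

Lemma density_envelope f : density f -> envelope f.
Proof.
  intros h. destruct (density_env f h) as [C [hC hf]]. exists C. intros x.
  rewrite Rabs_pos_eq; auto. left; apply h.
Qed.

Lemma conv_summable f g t : cont f -> cont g -> envelope f -> envelope g ->
  summable (fun u => f u * g (u - t)).
Proof.
  intros cf cg [C1 h1] [C2 h2]. apply summable_envelope; [cts|].
  exists (C1 * Rabs C2). intros u. rewrite Rabs_mult.
  replace (C1 * Rabs C2 * cauchyd u) with (C1 * cauchyd u * Rabs C2) by ring.
  apply Rmult_le_compat; auto using Rabs_pos.
  eapply Rle_trans; [apply h2|]. pose proof (Rle_abs C2). pose proof (cauchy_pos (u - t)).
  pose proof (cauchy_le1 (u - t)). pose proof (Rabs_pos C2). nra.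
Qed.

Lemma conv_bound f g : cont f -> cont g -> (forall x, 0 <= f x) -> (forall x, 0 <= g x) ->
  envelope f -> envelope g ->
  exists C, forall t, Int (fun u => f u * g (u - t)) <= C * cauchyd t.
Proof.
  intros cf cg f0 g0 [C1 h1] [C2 h2]. exists (C1 * C2 * 4 * Int cauchyd). intros t.
  assert (cs := cauchy_summable).
  assert (hs : summable (fun u => cauchyd (u - t))).
  { apply summable_envelope; [pose proof cauchy_cont; cts|]. exists (2 * (1 + t ^ 2)). intros u.
    rewrite Rabs_pos_eq; [apply cauchy_shift|left; apply cauchy_pos]. }
  apply Rle_trans with (Int (fun u => (C1 * C2 * 2 * cauchyd t) * (cauchyd u + cauchyd (u - t)))).
  - apply Int_le.
    + apply conv_summable; auto; [now exists C1|now exists C2].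
    + now apply summable_scal, summable_plus.
    + intros u. specialize (h1 u); specialize (h2 (u - t)).
      rewrite Rabs_pos_eq in h1, h2; auto.
      apply Rle_trans with ((C1 * cauchyd u) * (C2 * cauchyd (u - t))).
      * apply Rmult_le_compat; auto.
      * pose proof (cauchy_conv u t). pose proof (cauchy_pos u); pose proof (cauchy_pos (u - t)).
        assert (0 <= C1). { pose proof (f0 u). apply Rmult_le_reg_r with (cauchyd u); auto. lra. }
        assert (0 <= C2). { pose proof (g0 (u - t)). apply Rmult_le_reg_r with (cauchyd (u - t)); auto. lra. }
        assert (0 <= C1 * C2) by nra. nra.
  - rewrite Int_scal; [|now apply summable_plus]. rewrite Int_plus; auto.
    rewrite (Int_shift cauchyd). right; ring.
Qed.

#[local] Hint Resolve density_cont density_pos : core.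

Definition marg (a b : R -> R) (t : R) : R := Int (fun u => a u * b (u - t)).

Section Kernel.

Variables a b : R -> R.
Hypothesis (ha : density a) (hb : density b).

Notation B := (Int b).
Notation D := (marg a b).

Definition ker t t' := Int (fun u => a u * b (u - t) / D t * (b (u - t') / B)).

Lemma mass_pos : 0 < B.
Proof. apply Int_pos; auto. now apply density_summable. Qed.

Lemma joint_summable t : summable (fun u => a u * b (u - t)).
Proof. apply conv_summable; auto using density_envelope. Qed.

Lemma marg_pos t : 0 < D t.
Proof. apply Int_pos; [apply joint_summable|]. intros u; apply Rmult_lt_0_compat; auto. Qed.

(** Only u in [-1, 1] is kept: there a(u) >= a(1) and |u - t| <= |t| + 1. *)
Lemma marg_lower t : 2 * a 1 * b (Rabs t + 1) <= D t.
Proof.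
  apply Rle_trans with (RInt (fun _ => a 1 * b (Rabs t + 1)) (-1) 1).
  { rewrite Rint_const. lra. }
  apply Rle_trans with (RInt (fun u => a u * b (u - t)) (-1) 1).
  - apply Rint_le; [cts|cts|lra|]. intros u hu.
    assert (Rabs u <= 1) by (apply Rabs_le; lra).
    apply Rmult_le_compat; try (left; auto; fail).
    + apply (density_decr a ha). rewrite (Rabs_pos_eq 1); lra.
    + apply (density_decr b hb). pose proof (Rabs_pos t). rewrite (Rabs_pos_eq (_ + _)); [|lra].
      eapply Rle_trans; [apply Rabs_triang|]. rewrite Rabs_Ropp. lra.
  - apply RInt_le_Int; [apply joint_summable| |lra]. intros u. left; apply Rmult_lt_0_compat; auto.
Qed.

Lemma marg_upper : exists C, forall t, D t <= C * cauchyd t.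
Proof.
  apply conv_bound; auto using density_envelope; intros; left; auto.
Qed.

Lemma marg_le t : D t <= Int a * b 0.
Proof.
  rewrite Rmult_comm, <- Int_scal by now apply density_summable.
  apply Int_le; [apply joint_summable|now apply summable_scal, density_summable|].
  intros u. rewrite Rmult_comm. apply Rmult_le_compat_r; [left; auto|now apply density_max].
Qed.

Lemma marg_cont : cont D.
Proof.
  apply (cont_Int_param (fun t u => a u * b (u - t)) a); auto using joint_summable, density_summable.
  { intros; left; auto. }
  intros t eps he. destruct (density_unif_cont b eps hb he) as [d [hd h]].
  exists d; split; auto. intros s u hs.
  replace (a u * b (u - s) - a u * b (u - t)) with (a u * (b (u - s) - b (u - t))) by ring.
  rewrite Rabs_mult, (Rabs_pos_eq (a u)) by (left; auto). rewrite Rmult_comm.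
  apply Rmult_le_compat_r; [left; auto|]. left; apply h.
  replace (u - s - (u - t)) with (- (s - t)) by ring. now rewrite Rabs_Ropp.
Qed.

Lemma marg_summable : summable D.
Proof.
  destruct marg_upper as [C hC]. apply summable_envelope; [apply marg_cont|].
  exists C. intros t. rewrite Rabs_pos_eq; auto. left; apply marg_pos.
Qed.

Lemma integrand_nonneg t t' u : 0 <= a u * b (u - t) / D t * (b (u - t') / B).
Proof.
  pose proof (marg_pos t). pose proof mass_pos.
  apply Rmult_le_pos; apply Rdiv_le_0_compat; auto; try (left; auto; fail).
  apply Rmult_le_pos; left; auto.
Qed.

Lemma cond_summable t : summable (fun u => a u * b (u - t) / D t).
Proof.
  apply summable_ext with (fun u => / D t * (a u * b (u - t))); [intros; unfold Rdiv; ring|].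
  apply summable_scal, joint_summable.
Qed.

Lemma cond_mass t : Int (fun u => a u * b (u - t) / D t) = 1.
Proof.
  rewrite (Int_ext _ (fun u => / D t * (a u * b (u - t)))) by (intros; unfold Rdiv; ring).
  rewrite Int_scal by apply joint_summable. apply Rinv_l, Rgt_not_eq, marg_pos.
Qed.

Lemma integrand_le t t' u :
  a u * b (u - t) / D t * (b (u - t') / B) <= b 0 / B * (a u * b (u - t) / D t).
Proof.
  pose proof (marg_pos t). pose proof mass_pos.
  rewrite Rmult_comm. apply Rmult_le_compat_r.
  - apply Rdiv_le_0_compat; auto. apply Rmult_le_pos; left; auto.
  - apply Rmult_le_compat_r; [left; now apply Rinv_0_lt_compat|]. now apply density_max.
Qed.

Lemma integrand_summable t t' : summable (fun u => a u * b (u - t) / D t * (b (u - t') / B)).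
Proof.
  apply summable_dom with (fun u => b 0 / B * (a u * b (u - t) / D t)).
  - pose proof mass_pos. pose proof (marg_pos t). cts; intros _; lra.
  - apply summable_scal, cond_summable.
  - intros u. rewrite Rabs_pos_eq; [apply integrand_le|apply integrand_nonneg].
Qed.

Lemma ker_nonneg t t' : 0 <= ker t t'.
Proof. apply Int_ge0; [apply integrand_summable|apply integrand_nonneg]. Qed.

Lemma ker_bounded t t' : ker t t' <= b 0 / B.
Proof.
  rewrite <- (Rmult_1_r (b 0 / B)), <- (cond_mass t), <- Int_scal by apply cond_summable.
  apply Int_le; [apply integrand_summable|apply summable_scal, cond_summable|].
  intros; apply integrand_le.
Qed.

Lemma ker_reversible t t' : D t * ker t t' = D t' * ker t' t.
Proof.
  unfold ker. rewrite <- !Int_scal by apply integrand_summable. apply Int_ext. intros u.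
  pose proof (marg_pos t). pose proof (marg_pos t'). pose proof mass_pos. field; lra.
Qed.

(** [ker_bounded] has no decay in [t']. Reversibility exchanges the arguments at the price of the
    factor D(t') / D(t), which provides an integrable bound. *)
Lemma ker_le_marg t t' : ker t t' <= b 0 / (B * D t) * D t'.
Proof.
  pose proof (marg_pos t). pose proof (marg_pos t'). pose proof mass_pos.
  apply Rmult_le_reg_l with (D t); auto. rewrite ker_reversible.
  replace (D t * (b 0 / (B * D t) * D t')) with (D t' * (b 0 / B)) by (field; lra).
  apply Rmult_le_compat_l; [lra|apply ker_bounded].
Qed.

(** The end point enters only through [b (u - y) / B], and averaging over q_t does not enlarge the
    modulus of continuity, so [d] does not depend on [t]. *)
Lemma ker_equi eps : 0 < eps -> exists d, 0 < d /\
  forall t y y', Rabs (y' - y) < d -> Rabs (ker t y' - ker t y) <= eps.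
Proof.
  intros he. pose proof mass_pos as hB.
  destruct (density_unif_cont b (eps * B) hb) as [d [hd h]]; [nra|].
  exists d; split; auto. intros t y y' hy. unfold ker.
  rewrite <- Int_minus by apply integrand_summable.
  assert (hm := summable_minus _ _ (integrand_summable t y') (integrand_summable t y)).
  assert (hdom : forall u, Rabs (a u * b (u - t) / D t * (b (u - y') / B) -
      a u * b (u - t) / D t * (b (u - y) / B)) <= eps * (a u * b (u - t) / D t)).
  { intros u. assert (hq : 0 <= a u * b (u - t) / D t).
    { apply Rdiv_le_0_compat; [apply Rmult_le_pos; left; auto|apply marg_pos]. }
    set (q := a u * b (u - t) / D t) in *.
    replace (_ - _) with (q * ((b (u - y') - b (u - y)) / B)) by (field; lra).
    rewrite Rabs_mult, (Rabs_pos_eq q), Rmult_comm by auto. apply Rmult_le_compat_r; auto.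
    unfold Rdiv. rewrite Rabs_mult, (Rabs_pos_eq (/ B)) by (left; now apply Rinv_0_lt_compat).
    apply Rle_div_l; auto. left; apply h.
    replace (u - y' - (u - y)) with (- (y' - y)) by ring. now rewrite Rabs_Ropp. }
  assert (hsc := summable_scal _ eps (cond_summable t)).
  assert (hab := summable_abs _ _ (summable_cont _ hm) hsc hdom).
  eapply Rle_trans; [apply (Int_abs _ hm hab)|].
  rewrite <- (Rmult_1_r eps), <- (cond_mass t), <- Int_scal by apply cond_summable.
  apply Int_le; auto.
Qed.

Lemma ker_cont_r t : cont (ker t).
Proof.
  apply cont_eps. intros y eps he. destruct (ker_equi (eps / 2)) as [d [hd h]]; [lra|].
  exists d; split; auto. intros y' hy. specialize (h t y y' hy). lra.
Qed.

(** By reversibility k(t, y) = D(y) k(y, t) / D(t), where [t] is now an end point. *)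
Lemma ker_cont_l y : cont (fun t => ker t y).
Proof.
  assert (h : cont (fun t => D y * ker y t / D t)).
  { pose proof marg_cont. pose proof (ker_cont_r y). cts.
    intros t; pose proof (marg_pos t); lra. }
  apply cont_ext with (2 := h). intros s. rewrite ker_reversible.
  pose proof (marg_pos s). field. lra.
Qed.

Lemma ker_jcont : jcont ker.
Proof.
  apply jcont_equi; [apply ker_cont_l|]. intros t eps he.
  destruct (ker_equi (eps / 2)) as [d [hd h]]; [lra|].
  exists d; split; auto. intros x' y y' _ hy. specialize (h x' y y' hy). lra.
Qed.

Lemma translate_summable u : summable (fun t => b (u - t)).
Proof.
  destruct (density_env b hb) as [C [hC h]].
  apply summable_envelope; [cts|]. exists (C * (2 * (1 + u ^ 2))). intros t.
  rewrite Rabs_pos_eq by (left; auto). eapply Rle_trans; [apply h|].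
  rewrite Rmult_assoc. apply Rmult_le_compat_l; [lra|].
  replace (u - t) with (- (t - u)) by ring. rewrite cauchy_even. apply cauchy_shift.
Qed.

Lemma translate_mass u : Int (fun t => b (u - t)) = B.
Proof. apply Int_reflect. Qed.

Lemma integrand_jcont t : jcont (fun u t' => a u * b (u - t) / D t * (b (u - t') / B)).
Proof.
  pose proof mass_pos. pose proof (marg_pos t). apply jcont_mult.
  - apply (jcont_of_l (fun u => a u * b (u - t) / D t)). cts. intros _; lra.
  - apply (jcont_diff (fun x => b x / B)). cts. intros _; lra.
Qed.

(** A step of the chain is two half-steps, u from q_t and then t' from the density b(u - t') / B.
    [H] bounds the mean of [V] after the second one; it remains to average [H] over q_t. *)
Lemma ker_weight_le V H t : cont V -> (forall x, 0 <= V x) ->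
  (forall u, summable (fun t' => V t' * b (u - t')) /\ Int (fun t' => V t' * b (u - t')) <= B * H u) ->
  summable (fun u => H u * (a u * b (u - t))) ->
  summable (fun t' => V t' * ker t t') /\
  Int (fun t' => V t' * ker t t') <= Int (fun u => H u * (a u * b (u - t))) / D t.
Proof.
  intros cV V0 hV hH. pose proof mass_pos as hB. pose proof (marg_pos t) as hD.
  set (f := fun u t' => V t' * (a u * b (u - t) / D t * (b (u - t') / B))).
  assert (E : forall t', Int (fun u => f u t') = V t' * ker t t').
  { intros t'. unfold f, ker. apply Int_scal, integrand_summable. }
  assert (hsum : summable (fun u => / D t * (H u * (a u * b (u - t))))) by now apply summable_scal.
  destruct (Int_tonelli_le f (fun u => / D t * (H u * (a u * b (u - t))))) as [h1 h2]; auto.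
  - apply (jcont_mult (fun _ t' => V t')); [now apply jcont_of_r|apply integrand_jcont].
  - intros u t'. apply Rmult_le_pos; auto. apply integrand_nonneg.
  - intros R0 hR. destruct (cont_bounded V R0 cV hR) as [M [hM h]].
    exists (fun u => M * (b 0 / B * (a u * b (u - t) / D t))). split.
    + apply summable_scal, summable_scal, cond_summable.
    + intros u t' ht'. apply Rmult_le_compat; auto using integrand_nonneg, integrand_le.
      eapply Rle_trans; [apply Rle_abs|auto].
  - assert (hc := ker_cont_r t). assert (hc2 : cont (fun t' => V t' * ker t t')) by cts.
    apply cont_ext with (2 := hc2). intros; symmetry; apply E.
  - intros u R0 hR. destruct (hV u) as [s1 s2].
    assert (hq : 0 <= / D t * (a u * b (u - t)) / B).
    { apply Rdiv_le_0_compat; auto. apply Rmult_le_pos; [left; now apply Rinv_0_lt_compat|].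
      apply Rmult_le_pos; left; auto. }
    rewrite (Rint_ext (f u) (fun t' => (/ D t * (a u * b (u - t)) / B) * (V t' * b (u - t')))).
    2:{ intros x. unfold f. field. lra. }
    rewrite Rint_scal by auto.
    apply Rle_trans with (/ D t * (a u * b (u - t)) / B * (B * H u)).
    + apply Rmult_le_compat_l; auto. eapply Rle_trans; [|apply s2].
      apply RInt_le_Int; auto; [|lra]. intros x. apply Rmult_le_pos; auto. left; auto.
    + right. field. lra.
  - rewrite Int_scal in h2 by auto. split.
    + apply summable_ext with (2 := h1). apply E.
    + rewrite (Int_ext (fun t' => V t' * ker t t') _ (fun t' => eq_sym (E t'))).
      unfold Rdiv. rewrite Rmult_comm with (r2 := / D t). exact h2.
Qed.

Lemma ker_mass t : summable (ker t) /\ Int (ker t) = 1.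
Proof.
  set (f := fun u t' => a u * b (u - t) / D t * (b (u - t') / B)).
  pose proof mass_pos as hB. pose proof (marg_pos t) as hD.
  assert (E : forall u, Int (f u) = a u * b (u - t) / D t).
  { intros u. unfold f.
    rewrite (Int_ext _ (fun t' => (a u * b (u - t) / D t / B) * b (u - t'))) by (intros; field; lra).
    rewrite Int_scal by apply translate_summable. rewrite translate_mass. field. lra. }
  destruct (Int_tonelli f) as [h1 h2].
  - apply integrand_jcont.
  - intros; apply integrand_nonneg.
  - intros R0 _. exists (fun u => b 0 / B * (a u * b (u - t) / D t)). split.
    + apply summable_scal, cond_summable.
    + intros; apply integrand_le.
  - intros R0 hR. destruct (density_env b hb) as [C [hC h]].
    (* For |u| <= [R0] the translate b(u - t') stays below a Cauchy density times 2 (1 + R0^2), by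
       [cauchy_shift]. *)
    exists (fun t' => (a 0 * b 0 / D t / B * C * (2 * (1 + R0 ^ 2))) * cauchyd t'). split.
    + apply summable_scal, cauchy_summable.
    + intros t' u hu. unfold f.
      replace (a u * b (u - t) / D t * (b (u - t') / B))
        with ((a u * b (u - t) / D t / B) * b (u - t')) by (field; lra).
      rewrite 2!Rmult_assoc. apply Rmult_le_compat.
      * apply Rdiv_le_0_compat; auto. apply Rdiv_le_0_compat; auto. apply Rmult_le_pos; left; auto.
      * left; auto.
      * unfold Rdiv. do 2 (apply Rmult_le_compat_r; [left; now apply Rinv_0_lt_compat|]).
        apply Rmult_le_compat; try (left; auto; fail); now apply density_max.
      * eapply Rle_trans; [apply h|]. apply Rmult_le_compat_l; [lra|].
        replace (u - t') with (- (t' - u)) by ring. rewrite cauchy_even.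
        eapply Rle_trans; [apply cauchy_shift|].
        apply Rmult_le_compat_r; [left; apply cauchy_pos|].
        apply Rmult_le_compat_l; [lra|]. apply Rplus_le_compat_l.
        rewrite <- (pow2_abs u). apply pow_incr. split; auto. apply Rabs_pos.
  - apply ker_cont_r.
  - apply summable_ext with (2 := cond_summable t). intros; symmetry; apply E.
  - split; [exact h1|]. unfold ker. rewrite <- (cond_mass t). etransitivity; [apply h2|].
    apply Int_ext, E.
Qed.

(** * Action of the kernel on densities *)

Definition push phi t' := Int (fun t => phi t * ker t t').

Lemma push_summable phi t' : cont phi -> summable (fun t => Rabs (phi t)) ->
  summable (fun t => phi t * ker t t').
Proof.
  intros cp hp. pose proof (ker_cont_l t') as hk.
  apply summable_dom with (fun t => b 0 / B * Rabs (phi t)); [cts|now apply summable_scal|].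
  intros t. rewrite Rabs_mult, Rmult_comm. apply Rmult_le_compat_r; [apply Rabs_pos|].
  rewrite Rabs_pos_eq by apply ker_nonneg. apply ker_bounded.
Qed.

Lemma push_cont phi : cont phi -> summable (fun t => Rabs (phi t)) -> cont (push phi).
Proof.
  intros cp hp. apply (cont_Int_param (fun t' t => phi t * ker t t') (fun t => Rabs (phi t))); auto.
  - intros; now apply push_summable.
  - intros; apply Rabs_pos.
  - intros y eps he. destruct (ker_equi eps he) as [d [hd h]]. exists d; split; auto.
    intros y' t hy.
    replace (phi t * ker t y' - phi t * ker t y) with (phi t * (ker t y' - ker t y)) by ring.
    rewrite Rabs_mult, Rmult_comm.
    apply Rmult_le_compat_r; [apply Rabs_pos|auto].
Qed.

Lemma push_mass phi : summable phi -> (forall t, 0 <= phi t) ->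
  summable (push phi) /\ Int (push phi) = Int phi /\ (forall t, 0 <= push phi t).
Proof.
  intros hp p0.
  assert (hpa : summable (fun t => Rabs (phi t))).
  { apply summable_ext with (2 := hp). intros; rewrite Rabs_pos_eq; auto. }
  assert (E : forall t, Int (fun t' => phi t * ker t t') = phi t).
  { intros t. destruct (ker_mass t) as [h1 h2]. rewrite Int_scal, h2 by auto. ring. }
  destruct (Int_tonelli (fun t t' => phi t * ker t t')) as [h1 h2].
  - apply jcont_mult; [apply (jcont_of_l phi); auto|apply ker_jcont].
  - intros; apply Rmult_le_pos; auto using ker_nonneg.
  - intros R0 _. exists (fun t => b 0 / B * phi t). split; [now apply summable_scal|].
    intros t t' _. rewrite Rmult_comm. apply Rmult_le_compat_r; auto using ker_bounded.
  - intros R0 hR. destruct (cont_bounded phi R0 (summable_cont _ hp) hR) as [M [hM h]].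
    pose proof mass_pos.
    assert (hc : 0 < 2 * a 1 * b (R0 + 1)) by (apply Rmult_lt_0_compat; auto; pose proof (density_pos a ha 1); lra).
    (* [ker_le_marg] dominates k(t, .) by a multiple of [D]; for |t| <= [R0] its constant is
       controlled because D(t) >= 2 a(1) b(R0 + 1). *)
    exists (fun t' => (M * (b 0 / (B * (2 * a 1 * b (R0 + 1))))) * D t'). split.
    + apply summable_scal, marg_summable.
    + intros t' t ht. rewrite Rmult_assoc. apply Rmult_le_compat; auto using ker_nonneg.
      { eapply Rle_trans; [apply Rle_abs|auto]. }
      eapply Rle_trans; [apply ker_le_marg|]. apply Rmult_le_compat_r; [left; apply marg_pos|].
      apply Rmult_le_compat_l; [left; auto|]. apply Rinv_le_contravar; [nra|].
      apply Rmult_le_compat_l; [lra|]. eapply Rle_trans; [|apply marg_lower].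
      apply Rmult_le_compat_l; [pose proof (density_pos a ha 1); lra|]. apply (density_decr b hb).
      pose proof (Rabs_pos t). rewrite (Rabs_pos_eq (R0 + 1)), (Rabs_pos_eq (Rabs t + 1)); lra.
  - apply push_cont; auto.
  - apply summable_ext with (2 := hp). intros; symmetry; apply E.
  - split; [exact h1|]. split.
    + etransitivity; [apply h2|]. apply Int_ext, E.
    + intros t'. apply Int_ge0; [apply push_summable; auto|].
      intros; apply Rmult_le_pos; auto using ker_nonneg.
Qed.

End Kernel.

(** * Contraction of the chain *)

Section Chain.

Variables a b : R -> R.
Hypothesis (ha : density a) (hb : density b).

Notation B := (Int b).
Notation D := (marg a b).
Notation k := (ker a b).

Definition pair_density (u t : R) : R := a u * b (u - t).

Definition post (t : R) : R := D t / Int D.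

(** In the conditional law of t' given u the factor [a u] cancels, which leaves a translate of b /
    B. *)
Lemma kernel_pair_density t t' : kernel pair_density t t' = k t t'.
Proof.
  unfold kernel, ker. apply Int_ext. intros u. unfold condU, condT, pair_density.
  pose proof (mass_pos b hb). pose proof (marg_pos a b ha hb t).
  pose proof (density_pos a ha u).
  rewrite (Int_scal (fun t' => b (u - t'))) by now apply translate_summable.
  rewrite translate_mass. fold (D t). field. lra.
Qed.

Lemma marg_total_pos : 0 < Int D.
Proof. apply Int_pos; [now apply marg_summable|intros; now apply marg_pos]. Qed.

Lemma post_pos t : 0 < post t.
Proof. apply Rdiv_lt_0_compat; [now apply marg_pos|apply marg_total_pos]. Qed.

Lemma post_summable_weight V : summable (fun t => V t * D t) -> summable (fun t => V t * post t).
Proof.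
  intros h. apply summable_ext with (fun t => / Int D * (V t * D t)); [intros; unfold post, Rdiv; ring|].
  now apply summable_scal.
Qed.

Lemma post_summable : summable post.
Proof.
  apply summable_ext with (fun t => / Int D * D t); [intros; unfold post, Rdiv; ring|].
  now apply summable_scal, marg_summable.
Qed.

Lemma post_mass : Int post = 1.
Proof.
  rewrite (Int_ext _ (fun t => / Int D * D t)) by (intros; unfold post, Rdiv; ring).
  rewrite Int_scal by now apply marg_summable. apply Rinv_l, Rgt_not_eq, marg_total_pos.
Qed.

Lemma push_post t : push a b post t = post t.
Proof.
  unfold push. destruct (ker_mass a b ha hb t) as [h1 h2].
  rewrite (Int_ext _ (fun t' => post t * k t t')).
  - rewrite Int_scal, h2 by auto. ring.
  - intros t'. unfold post, Rdiv. pose proof (ker_reversible a b ha hb t t') as h.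
    transitivity (/ Int D * (D t' * k t' t)); [ring|rewrite <- h; ring].
Qed.

Lemma law_step t0 n : lawS pair_density t0 (S n) = push a b (lawS pair_density t0 n).
Proof.
  apply functional_extensionality; intros t'. simpl. apply Int_ext. intros t.
  now rewrite kernel_pair_density.
Qed.

Lemma law_first t0 : lawS pair_density t0 0 = k t0.
Proof. apply functional_extensionality; intros t'. apply kernel_pair_density. Qed.

Lemma law_prob t0 n : summable (lawS pair_density t0 n) /\ Int (lawS pair_density t0 n) = 1 /\
  (forall t, 0 <= lawS pair_density t0 n t).
Proof.
  induction n as [|n [h1 [h2 h3]]].
  - rewrite law_first. destruct (ker_mass a b ha hb t0). repeat split; auto.
    intros; now apply ker_nonneg.
  - rewrite law_step. destruct (push_mass a b ha hb _ h1 h3) as [g1 [g2 g3]].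
    repeat split; auto. congruence.
Qed.

(** [L] may exceed 1: the lemma serves to control how fast exponential moments can grow. *)
Lemma push_weight_le V L phi : cont V -> (forall t, 0 <= V t) ->
  (forall t, summable (fun t' => V t' * k t t') /\ Int (fun t' => V t' * k t t') <= L * V t) ->
  summable phi -> (forall t, 0 <= phi t) -> summable (fun t => V t * phi t) ->
  summable (fun t => V t * push a b phi t) /\
  Int (fun t => V t * push a b phi t) <= L * Int (fun t => V t * phi t).
Proof.
  intros cV V0 hV hp p0 hVp.
  assert (hpa : summable (fun t => Rabs (phi t))).
  { apply summable_ext with (2 := hp). intros; rewrite Rabs_pos_eq; auto. }
  assert (E : forall t', Int (fun t => V t' * (phi t * k t t')) = V t' * push a b phi t').
  { intros t'. apply Int_scal, push_summable; auto. }
  destruct (Int_tonelli_le (fun t t' => V t' * (phi t * k t t')) (fun t => L * (V t * phi t)))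
    as [h1 h2].
  - apply (jcont_mult (fun _ t' => V t')); [now apply jcont_of_r|].
    apply (jcont_mult (fun t _ => phi t)); [apply jcont_of_l; auto|now apply ker_jcont].
  - intros. apply Rmult_le_pos; auto. apply Rmult_le_pos; auto. now apply ker_nonneg.
  - intros R0 hR. destruct (cont_bounded V R0 cV hR) as [M [hM h]].
    exists (fun t => M * (b 0 / B) * phi t). split; [now apply summable_scal|].
    intros t t' ht. rewrite Rmult_assoc. apply Rmult_le_compat; auto.
    + apply Rmult_le_pos; auto; now apply ker_nonneg.
    + eapply Rle_trans; [apply Rle_abs|auto].
    + rewrite Rmult_comm. apply Rmult_le_compat_r; auto. now apply ker_bounded.
  - apply cont_ext with (fun t' => V t' * push a b phi t'); [intros; symmetry; apply E|].
    assert (hc := push_cont a b ha hb phi (summable_cont _ hp) hpa). cts.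
  - now apply summable_scal.
  - intros t R0 hR. destruct (hV t) as [s1 s2].
    rewrite (Rint_ext _ (fun t' => phi t * (V t' * k t t'))) by (intros; ring).
    rewrite Rint_scal by auto.
    replace (L * (V t * phi t)) with (phi t * (L * V t)) by ring.
    apply Rmult_le_compat_l; auto. eapply Rle_trans; [|apply s2].
    apply RInt_le_Int; auto; [|lra]. intros; apply Rmult_le_pos; auto; now apply ker_nonneg.
  - rewrite Int_scal in h2 by auto. split.
    + apply summable_ext with (2 := h1). apply E.
    + eapply Rle_trans; [|exact h2]. right. apply Int_ext. intros; symmetry; apply E.
Qed.

(** [lawS] at [n] is the law after n + 1 steps, hence the exponent [S n]. *)
Lemma law_weight_le V L t0 n : cont V -> (forall t, 0 <= V t) -> 0 <= L ->
  (forall t, summable (fun t' => V t' * k t t') /\ Int (fun t' => V t' * k t t') <= L * V t) ->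
  summable (fun t => V t * lawS pair_density t0 n t) /\
  Int (fun t => V t * lawS pair_density t0 n t) <= L ^ (S n) * V t0.
Proof.
  intros cV V0 hL hV. induction n as [|n [h1 h2]].
  - rewrite law_first. destruct (hV t0). split; auto. simpl. lra.
  - rewrite law_step. destruct (law_prob t0 n) as [p1 [p2 p3]].
    destruct (push_weight_le V L _ cV V0 hV p1 p3 h1) as [g1 g2]. split; auto.
    eapply Rle_trans; [apply g2|]. simpl. rewrite Rmult_assoc.
    apply Rmult_le_compat_l; auto.
Qed.

(* Since [phi] has total mass 0, [k t t'] may be replaced by [k t t' - m t'], whose weighted
   total variation is smaller than that of [k t]. *)
Lemma push_contract W m Mb alpha phi : cont W -> (forall t, 1 <= W t) ->
  summable m -> (forall t, 0 <= m t <= Mb) ->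
  (forall t R0, 0 <= R0 -> RInt (fun t' => W t' * Rabs (k t t' - m t')) (-R0) R0 <= alpha * W t) ->
  cont phi -> Int phi = 0 -> summable (fun t => W t * Rabs (phi t)) ->
  summable (fun t => W t * Rabs (push a b phi t)) /\
  Int (fun t => W t * Rabs (push a b phi t)) <= alpha * Int (fun t => W t * Rabs (phi t)).
Proof.
  intros cW W1 sm hm hJ cp p0 hWp.
  assert (W0 : forall t, 0 <= W t) by (intros t; specialize (W1 t); lra).
  assert (cm := summable_cont _ sm).
  assert (hpa : summable (fun t => Rabs (phi t))).
  { apply (summable_abs phi _ cp hWp). intros t. specialize (W1 t).
    pose proof (Rabs_pos (phi t)). nra. }
  assert (hp : summable phi) by (apply summable_dom with (1 := cp) (2 := hpa); intros; lra).
  set (K := b 0 / B + Mb).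
  assert (hK : forall t t', Rabs (k t t' - m t') <= K).
  { intros t t'. pose proof (ker_bounded a b ha hb t t'). pose proof (ker_nonneg a b ha hb t t').
    specialize (hm t'). apply Rabs_le. unfold K. lra. }
  set (g := fun t' t => Rabs (phi t) * Rabs (k t t' - m t')).
  assert (hck : forall t', cont (fun t => k t t')) by (intros; now apply ker_cont_l).
  assert (hcd : forall t', cont (fun t => k t t' - m t')).
  { intros t'. apply (cont_minus (fun t => k t t') (fun _ => m t')); auto. apply cont_const. }
  assert (sg : forall t', summable (g t')).
  { intros t'. apply summable_dom with (fun t => K * Rabs (phi t)).
    - specialize (hcd t'). apply cont_mult; apply cont_abs; auto.
    - now apply summable_scal.
    - intros t. unfold g. rewrite Rabs_pos_eq by (apply Rmult_le_pos; apply Rabs_pos).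
      rewrite Rmult_comm. apply Rmult_le_compat_r; auto using Rabs_pos. }
  set (G := fun t' => Int (g t')).
  assert (cG : cont G).
  { apply (cont_Int_param g (fun t => Rabs (phi t))); auto using Rabs_pos.
    intros y eps he. destruct (ker_equi a b ha hb (eps / 2)) as [d [hd h]]; [lra|].
    destruct (proj1 (cont_eps m) cm y (eps / 2)) as [d' [hd' h']]; [lra|].
    exists (Rmin d d'). split; [now apply Rmin_glb_lt|]. intros y' t hy.
    pose proof (Rmin_l d d'); pose proof (Rmin_r d d').
    unfold g. replace (_ - _) with (Rabs (phi t) * (Rabs (k t y' - m y') - Rabs (k t y - m y))) by ring.
    rewrite Rabs_mult, Rabs_Rabsolu, Rmult_comm. apply Rmult_le_compat_r; [apply Rabs_pos|].
    eapply Rle_trans; [apply Rabs_triang_inv2|].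
    replace (_ - _) with ((k t y' - k t y) - (m y' - m y)) by ring.
    eapply Rle_trans; [apply Rabs_triang|]. rewrite Rabs_Ropp.
    specialize (h t y y'). specialize (h' y').
    assert (Rabs (k t y' - k t y) <= eps / 2) by (apply h; lra).
    assert (Rabs (m y' - m y) < eps / 2) by (apply h'; lra). lra. }
  assert (E : forall t', Int (fun t => W t' * g t' t) = W t' * G t').
  { intros t'. now apply Int_scal. }
  assert (hle : forall t', Rabs (push a b phi t') <= G t').
  { intros t'.
    assert (sk := push_summable a b ha hb phi t' cp hpa).
    assert (skm : summable (fun t => phi t * (k t t' - m t'))).
    { apply summable_ext with (fun t => phi t * k t t' - m t' * phi t); [intros; ring|].
      apply summable_minus; auto. now apply summable_scal. }
    replace (push a b phi t') with (Int (fun t => phi t * (k t t' - m t'))).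
    2:{ rewrite (Int_ext _ (fun t => phi t * k t t' - m t' * phi t)) by (intros; ring).
        rewrite Int_minus, Int_scal, p0 by (auto; now apply summable_scal).
        unfold push. ring. }
    assert (ska : summable (fun t => Rabs (phi t * (k t t' - m t')))).
    { apply summable_ext with (2 := sg t'). intros; unfold g; now rewrite Rabs_mult. }
    eapply Rle_trans; [apply (Int_abs _ skm ska)|].
    right. apply Int_ext. intros; unfold g; now rewrite Rabs_mult. }
  destruct (Int_tonelli_le (fun t t' => W t' * g t' t) (fun t => alpha * (W t * Rabs (phi t))))
    as [h1 h2].
  - apply (jcont_mult (fun _ t' => W t')); [now apply jcont_of_r|].
    apply (jcont_mult (fun t _ => Rabs (phi t))); [apply jcont_of_l, cont_abs, cp|].
    apply jcont_abs, jcont_minus; [now apply ker_jcont|now apply jcont_of_r].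
  - intros. unfold g. apply Rmult_le_pos; auto. apply Rmult_le_pos; apply Rabs_pos.
  - intros R0 hR. destruct (cont_bounded W R0 cW hR) as [M [hM h]].
    exists (fun t => M * K * Rabs (phi t)). split; [now apply summable_scal|].
    intros t t' ht. unfold g. rewrite Rmult_assoc. apply Rmult_le_compat; auto.
    + apply Rmult_le_pos; apply Rabs_pos.
    + eapply Rle_trans; [apply Rle_abs|auto].
    + rewrite Rmult_comm. apply Rmult_le_compat_r; auto. apply Rabs_pos.
  - apply cont_ext with (fun t' => W t' * G t'); [intros; symmetry; apply E|]. cts.
  - now apply summable_scal.
  - intros t R0 hR. unfold g.
    rewrite (Rint_ext _ (fun t' => Rabs (phi t) * (W t' * Rabs (k t t' - m t')))) by (intros; ring).
    assert (cr := ker_cont_r a b ha hb t).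
    rewrite Rint_scal by cts.
    replace (alpha * (W t * Rabs (phi t))) with (Rabs (phi t) * (alpha * W t)) by ring.
    apply Rmult_le_compat_l; auto using Rabs_pos.
  - rewrite Int_scal in h2 by auto.
    assert (h3 : summable (fun t' => W t' * G t')) by (apply summable_ext with (2 := h1); apply E).
    assert (cpush := push_cont a b ha hb phi cp hpa).
    assert (h4 : summable (fun t => W t * Rabs (push a b phi t))).
    { apply summable_dom with (2 := h3); [cts|]. intros t.
      rewrite Rabs_pos_eq by (apply Rmult_le_pos; auto using Rabs_pos).
      apply Rmult_le_compat_l; auto. }
    split; auto. eapply Rle_trans; [|exact h2].
    rewrite (Int_ext _ _ E). apply Int_le; auto.
    intros; apply Rmult_le_compat_l; auto.
Qed.

(** [push_contract] iterated on the difference between law and posterior. After the first step the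
    law is compared with [m], at cost [alpha * W t0], while [m] and the posterior are counted in
    full; this is the constant [N]. *)
Theorem ergodic_bound W m Mb alpha : cont W -> (forall t, 1 <= W t) -> 0 <= alpha < 1 ->
  summable (fun t => W t * m t) -> summable m -> (forall t, 0 <= m t <= Mb) ->
  summable (fun t => W t * D t) ->
  (forall t, summable (fun t' => W t' * Rabs (k t t' - m t')) /\
             Int (fun t' => W t' * Rabs (k t t' - m t')) <= alpha * W t) ->
  exists r C, 0 <= r < 1 /\ 0 <= C /\
    forall t0 n, tv pair_density t0 n <= C * W t0 * r ^ (S n).
Proof.
  intros cW W1 hal sWm sm hm sWD hJ.
  assert (W0 : forall t, 0 <= W t) by (intros t; specialize (W1 t); lra).
  assert (sWp := post_summable_weight W sWD).
  set (N := Int (fun t => W t * m t) + Int (fun t => W t * post t)).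
  assert (hN : 0 <= N).
  { apply Rplus_le_le_0_compat; apply Int_ge0; auto; intros t; apply Rmult_le_pos; auto.
    - apply hm.
    - left; apply post_pos. }
  set (phi := fun t0 n t => lawS pair_density t0 n t - post t).
  assert (sphi : forall t0 n, summable (phi t0 n)).
  { intros t0 n. apply summable_minus; [apply law_prob|apply post_summable]. }
  assert (hphi : forall t0 n, summable (fun t => W t * Rabs (phi t0 n t)) /\
     Int (fun t => W t * Rabs (phi t0 n t)) <= alpha ^ n * (alpha * W t0 + N)).
  { intros t0 n. induction n as [|n [h1 h2]].
    - destruct (hJ t0) as [j1 j2].
      assert (hs : summable (fun t => W t * Rabs (k t0 t - m t) + (W t * m t + W t * post t))).
      { apply summable_plus; auto. apply summable_plus; auto. }
      assert (hle : forall t, W t * Rabs (phi t0 0%nat t) <=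
          W t * Rabs (k t0 t - m t) + (W t * m t + W t * post t)).
      { intros t. unfold phi. rewrite law_first. rewrite <- !Rmult_plus_distr_l.
        apply Rmult_le_compat_l; auto.
        replace (k t0 t - post t) with ((k t0 t - m t) + (m t + - post t)) by ring.
        eapply Rle_trans; [apply Rabs_triang|]. apply Rplus_le_compat_l.
        eapply Rle_trans; [apply Rabs_triang|]. rewrite Rabs_Ropp.
        pose proof (post_pos t). specialize (hm t). rewrite !Rabs_pos_eq; lra. }
      assert (hs2 : summable (fun t => W t * Rabs (phi t0 0%nat t))).
      { apply summable_dom with (2 := hs); [pose proof (summable_cont _ (sphi t0 0%nat)); cts|].
        intros t. rewrite Rabs_pos_eq; auto. apply Rmult_le_pos; auto using Rabs_pos. }
      split; auto. eapply Rle_trans; [apply (Int_le _ _ hs2 hs hle)|].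
      rewrite !Int_plus by (auto; apply summable_plus; auto). fold N. simpl. lra.
    - assert (E : phi t0 (S n) = push a b (phi t0 n)).
      { apply functional_extensionality; intros t. unfold phi at 1. rewrite law_step.
        destruct (law_prob t0 n) as [p1 [p2 p3]].
        rewrite <- (push_post t). unfold push. rewrite <- Int_minus.
        - apply Int_ext. intros; unfold phi; ring.
        - apply push_summable; auto. apply summable_ext with (2 := p1).
          intros; rewrite Rabs_pos_eq; auto.
        - apply push_summable; auto using post_summable. apply summable_ext with (2 := post_summable).
          intros; rewrite Rabs_pos_eq; auto. left; apply post_pos. }
      rewrite E.
      destruct (push_contract W m Mb alpha (phi t0 n)) as [g1 g2]; auto.
      + intros t R0 hR. destruct (hJ t) as [j1 j2]. eapply Rle_trans; [|exact j2].
        apply RInt_le_Int; auto; [|lra]. intros; apply Rmult_le_pos; auto using Rabs_pos.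
      + unfold phi. destruct (law_prob t0 n) as [p1 [p2 p3]].
        rewrite Int_minus, p2, post_mass; auto using post_summable. ring.
      + split; auto. eapply Rle_trans; [exact g2|]. simpl. rewrite Rmult_assoc.
        apply Rmult_le_compat_l; [lra|exact h2]. }
  (* Only alpha^n is available where a multiple of r^(n+1) is wanted, and [alpha] may be 0. With r
     >= 1/2 the missing factor costs at most 2, which the 1/2 in [tv] absorbs. *)
  set (r := Rmax alpha (/ 2)).
  assert (hr1 : alpha <= r) by apply Rmax_l. assert (hr2 : / 2 <= r) by apply Rmax_r.
  assert (hr3 : r < 1) by (apply Rmax_lub_lt; lra).
  exists r, (1 + N). split; [lra|]. split; [lra|]. intros t0 n. unfold tv.
  destruct (hphi t0 n) as [h1 h2].
  assert (ha1 : Int (fun t => Rabs (lawS pair_density t0 n t - posterior pair_density t))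
     <= Int (fun t => W t * Rabs (phi t0 n t))).
  { change (Int (fun t => Rabs (phi t0 n t)) <= Int (fun t => W t * Rabs (phi t0 n t))).
    assert (hle : forall t, Rabs (phi t0 n t) <= W t * Rabs (phi t0 n t)).
    { intros t. specialize (W1 t). pose proof (Rabs_pos (phi t0 n t)). nra. }
    apply Int_le; auto. apply summable_abs with (2 := h1); auto. }
  assert (hpow : alpha ^ n <= 2 * r ^ S n).
  { apply Rle_trans with (r ^ n); [apply pow_incr; lra|]. simpl.
    assert (0 <= r ^ n) by (apply pow_le; lra). nra. }
  assert (hW : 1 <= W t0) by auto.
  assert (alpha ^ n * (alpha * W t0 + N) <= 2 * r ^ S n * ((1 + N) * W t0)).
  { apply Rmult_le_compat; auto; [apply pow_le; lra|nra|nra]. }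
  lra.
Qed.

End Chain.

(** * Criteria for uniform and geometric ergodicity *)

Section Criteria.

Variables a b : R -> R.
Hypothesis (ha : density a) (hb : density b).

Notation B := (Int b).
Notation D := (marg a b).
Notation k := (ker a b).

(** A lower bound for the second half-step b(u - t) / B that is uniform over u in [-1, 1]; its total
    mass is not normalised. *)
Definition minor (t : R) : R := b (Rabs t + 1) / B.

(** The coefficient of [minor t'] is a lower bound for the q_t-mass of [-1, 1]. *)
Lemma ker_minor t t' : 2 * a 1 * b (Rabs t + 1) / D t * minor t' <= k t t'.
Proof.
  pose proof (mass_pos b hb) as hB. pose proof (marg_pos a b ha hb t) as hD.
  apply Rle_trans with
    (RInt (fun _ => a 1 * b (Rabs t + 1) / D t * minor t') (-1) 1).
  { rewrite Rint_const. unfold Rdiv. right. ring. }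
  apply Rle_trans with (RInt (fun u => a u * b (u - t) / D t * (b (u - t') / B)) (-1) 1).
  - pose proof (density_cont a ha); pose proof (density_cont b hb).
    apply Rint_le; [cts|cts; intros _; lra|lra|]. intros u hu.
    assert (hu1 : Rabs u <= 1) by (apply Rabs_le; lra).
    assert (hbu : forall s, b (Rabs s + 1) <= b (u - s)).
    { intros s. apply (density_decr b hb). pose proof (Rabs_pos s).
      rewrite (Rabs_pos_eq (_ + _)); [|lra].
      eapply Rle_trans; [apply Rabs_triang|]. rewrite Rabs_Ropp. lra. }
    pose proof (density_pos a ha 1). pose proof (density_pos b hb (Rabs t + 1)).
    pose proof (density_pos b hb (Rabs t' + 1)).
    assert (hi : forall x, 0 < x -> 0 <= / x) by (intros; left; now apply Rinv_0_lt_compat).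
    apply Rmult_le_compat.
    + apply Rmult_le_pos; auto. apply Rmult_le_pos; lra.
    + apply Rmult_le_pos; auto; lra.
    + apply Rmult_le_compat_r; auto. apply Rmult_le_compat; auto; try lra.
      apply (density_decr a ha). rewrite (Rabs_pos_eq 1); lra.
    + apply Rmult_le_compat_r; auto.
  - apply RInt_le_Int; [now apply integrand_summable| |lra]. intros; now apply integrand_nonneg.
Qed.

Lemma minor_cont : cont minor.
Proof.
  pose proof (mass_pos b hb) as hB. pose proof (density_cont b hb). unfold minor. cts. intros _; lra.
Qed.

Lemma minor_pos t : 0 < minor t.
Proof. apply Rdiv_lt_0_compat; [now apply density_pos|now apply mass_pos]. Qed.

Lemma minor_le t : minor t <= / B * b t.
Proof.
  unfold minor, Rdiv. rewrite Rmult_comm. apply Rmult_le_compat_l.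
  - left; apply Rinv_0_lt_compat; now apply mass_pos.
  - apply (density_decr b hb). pose proof (Rabs_pos t). rewrite (Rabs_pos_eq (_ + _)); lra.
Qed.

Lemma minor_weight_summable V : cont V -> (forall t, 0 <= V t) -> summable (fun t => V t * b t) ->
  summable (fun t => V t * minor t).
Proof.
  intros cV V0 hs. pose proof minor_cont.
  apply summable_dom with (fun t => / B * (V t * b t)); [cts|now apply summable_scal|].
  intros t. pose proof (minor_pos t). rewrite Rabs_pos_eq by (apply Rmult_le_pos; auto; lra).
  replace (/ B * (V t * b t)) with (V t * (/ B * b t)) by ring.
  apply Rmult_le_compat_l; auto. apply minor_le.
Qed.

Lemma minor_summable : summable minor.
Proof.
  apply summable_ext with (fun t => 1 * minor t); [intros; ring|].
  apply minor_weight_summable; [apply cont_const|intros; lra|].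
  apply summable_scal. now apply density_summable.
Qed.

Lemma minor_max t : minor t <= / B * b 0.
Proof.
  eapply Rle_trans; [apply minor_le|]. apply Rmult_le_compat_l; [|now apply density_max].
  left; apply Rinv_0_lt_compat; now apply mass_pos.
Qed.

(** Doeblin's condition: the hypothesis bounds the q_t-mass of [-1, 1] below by [e], uniformly in
    [t]. Then k(t, .) - e [minor] is nonnegative and has the same mass 1 - q for every [t]. *)
Theorem uniform_criterion : (exists C, forall t, D t <= C * b (Rabs t + 1)) ->
  unif_ergodic (pair_density a b).
Proof.
  intros [C hC]. pose proof (density_pos a ha 1) as ha1.
  assert (hC0 : 0 < C).
  { pose proof (hC 0) as h. pose proof (marg_pos a b ha hb 0).
    pose proof (density_pos b hb (Rabs 0 + 1)).
    apply Rmult_lt_reg_r with (b (Rabs 0 + 1)); auto. lra. }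
  set (e := 2 * a 1 / C). assert (he : 0 < e) by (apply Rdiv_lt_0_compat; lra).
  assert (hk : forall t t', e * minor t' <= k t t').
  { intros t t'. eapply Rle_trans; [|apply ker_minor].
    apply Rmult_le_compat_r; [left; apply minor_pos|].
    pose proof (marg_pos a b ha hb t). apply (Rle_div_r e _ (D t)); auto.
    replace (2 * a 1 * b (Rabs t + 1)) with (e * (C * b (Rabs t + 1))) by (unfold e; field; lra).
    apply Rmult_le_compat_l; [lra|apply hC]. }
  assert (sm : summable (fun t => e * minor t)) by apply summable_scal, minor_summable.
  set (q := Int (fun t => e * minor t)).
  assert (hq : 0 < q).
  { apply Int_pos; auto. intros. apply Rmult_lt_0_compat; auto. apply minor_pos. }
  assert (hJ : forall t, summable (fun t' => 1 * Rabs (k t t' - e * minor t')) /\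
     Int (fun t' => 1 * Rabs (k t t' - e * minor t')) = 1 - q).
  { intros t. destruct (ker_mass a b ha hb t) as [k1 k2].
    assert (E : forall t', k t t' - e * minor t' = 1 * Rabs (k t t' - e * minor t')).
    { intros t'. specialize (hk t t'). rewrite Rabs_pos_eq; lra. }
    split; [apply summable_ext with (1 := E); now apply summable_minus|].
    rewrite <- (Int_ext _ _ E), Int_minus, k2; auto. }
  assert (hq1 : q <= 1).
  { destruct (hJ 0) as [j1 j2]. assert (0 <= 1 - q); [|lra]. rewrite <- j2.
    apply Int_ge0; auto. intros; pose proof (Rabs_pos (k 0 x - e * minor x)); lra. }
  destruct (ergodic_bound a b ha hb (fun _ => 1) (fun t => e * minor t) (e * (/ B * b 0)) (1 - q))
    as [r [M [hr [hM h]]]]; auto.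
  - apply cont_const.
  - intros; lra.
  - lra.
  - now apply summable_scal.
  - intros t. pose proof (minor_pos t). split; [nra|].
    apply Rmult_le_compat_l; [lra|apply minor_max].
  - now apply summable_scal, marg_summable.
  - intros t. destruct (hJ t) as [j1 j2]. split; auto. lra.
  - exists r; split; auto. exists M. intros t0 n. specialize (h t0 n). now rewrite Rmult_1_r in h.
Qed.

(** Harris' theorem in weighted total variation: drift together with minorisation on bounded sets
    yields the one-step contraction factor 1 - K [be] for the weight 1 + [be] V. *)
Theorem geometric_criterion V g K : cont V -> (forall t, 0 <= V t) -> 0 <= g < 1 -> 0 < K ->
  (forall M, exists R0, 0 <= R0 /\ forall t, R0 <= Rabs t -> M <= V t) ->
  summable (fun t => V t * b t) -> summable (fun t => V t * D t) ->
  (forall t, summable (fun t' => V t' * k t t') /\ Int (fun t' => V t' * k t t') <= g * V t + K) ->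
  geom_ergodic (pair_density a b).
Proof.
  intros cV V0 hg hK hV sVb sVD hd.
  assert (sVm := minor_weight_summable V cV V0 sVb). assert (sm := minor_summable).
  set (n0 := Int minor). assert (hn0 : 0 < n0) by (apply Int_pos; auto using minor_pos).
  set (N := n0 + Int (fun t => V t * minor t)).
  assert (hN1 : 0 <= Int (fun t => V t * minor t)).
  { apply Int_ge0; auto. intros t; apply Rmult_le_pos; auto; left; apply minor_pos. }
  set (g' := (1 + g) / 2).
  (* Beyond [R0] the spare drift be (g' - g) V(t) covers 2 K be + e N, that is, twice the drift
     constant plus the loss caused by [m], once e = 2 K be / n0. *)
  destruct (hV ((2 * K + 2 * K * N / n0) / (g' - g))) as [R0 [hR0 hVR]].
  pose proof (density_pos a ha 1) as ha1. pose proof (density_pos b hb (R0 + 1)) as hbR.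
  pose proof (density_pos b hb 0) as hb0.
  assert (hA : 0 < Int a) by (apply Int_pos; auto; now apply density_summable).
  (* The coefficient in [ker_minor], made uniform over |t| <= [R0] by D(t) <= Int a * b(0). *)
  set (e0 := 2 * a 1 * b (R0 + 1) / (Int a * b 0)).
  assert (he0 : 0 < e0).
  { apply Rdiv_lt_0_compat; apply Rmult_lt_0_compat; lra. }
  assert (hsmall : forall t t', Rabs t <= R0 -> e0 * minor t' <= k t t').
  { intros t t' ht. eapply Rle_trans; [|apply ker_minor].
    apply Rmult_le_compat_r; [left; apply minor_pos|].
    pose proof (marg_pos a b ha hb t). pose proof (marg_le a b ha hb t). unfold e0, Rdiv.
    pose proof (Rabs_pos t).
    apply Rmult_le_compat; [nra|left; apply Rinv_0_lt_compat; nra| |now apply Rinv_le_contravar].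
    apply Rmult_le_compat_l; [lra|]. apply (density_decr b hb).
    rewrite (Rabs_pos_eq (R0 + 1)), (Rabs_pos_eq (Rabs t + 1)); lra. }
  (* Three demands: be <= 1 bounds the W-mass of e [minor] by e N; the second bound gives e <= e0;
     the third gives g' <= 1 - K be, so that the part proportional to V contracts too. *)
  set (be := Rmin 1 (Rmin (e0 * n0 / (2 * K)) ((1 - g') / K))).
  assert (hg' : g' < 1) by (unfold g'; lra).
  assert (hbe : 0 < be).
  { apply Rmin_glb_lt; [lra|]. apply Rmin_glb_lt; apply Rdiv_lt_0_compat; try lra.
    apply Rmult_lt_0_compat; lra. }
  assert (hbe1 : be <= 1) by apply Rmin_l.
  assert (hbe2 : be * (2 * K) <= e0 * n0).
  { apply Rle_div_r; [lra|]. eapply Rle_trans; [apply Rmin_r|apply Rmin_l]. }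
  assert (hbe3 : be * K <= 1 - g').
  { apply Rle_div_r; [lra|]. eapply Rle_trans; [apply Rmin_r|apply Rmin_r]. }
  (* Chosen so that subtracting e [minor] removes mass 2 K be: one K be cancels the drift constant,
     the other is the contraction. *)
  set (e := 2 * K * be / n0).
  assert (he : 0 < e) by (apply Rdiv_lt_0_compat; auto; nra).
  assert (hee : e <= e0) by (apply Rle_div_l; lra).
  assert (hen : e * n0 = 2 * K * be) by (unfold e; field; lra).
  set (W := fun t => 1 + be * V t).
  assert (cW : cont W) by (unfold W; cts).
  assert (W1 : forall t, 1 <= W t) by (intros t; unfold W; specialize (V0 t); nra).
  assert (W0 : forall t, 0 <= W t) by (intros t; specialize (W1 t); lra).
  assert (sum_W : forall f, summable f -> summable (fun t => V t * f t) ->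
     summable (fun t => W t * f t) /\
     Int (fun t => W t * f t) = Int f + be * Int (fun t => V t * f t)).
  { intros f s1 s2. assert (E : forall t, f t + be * (V t * f t) = W t * f t) by (intros; unfold W; ring).
    split.
    - apply summable_ext with (1 := E). apply summable_plus; auto. now apply summable_scal.
    - rewrite <- (Int_ext _ _ E), Int_plus, Int_scal; auto. now apply summable_scal. }
  assert (sme : summable (fun t => e * minor t)) by now apply summable_scal.
  assert (sVme : summable (fun t => V t * (e * minor t))).
  { apply summable_ext with (fun t => e * (V t * minor t)); [intros; ring|now apply summable_scal]. }
  destruct (sum_W _ sme sVme) as [w1 w2].
  assert (hw2 : e * n0 <= Int (fun t => W t * (e * minor t)) <= e * N).
  { rewrite w2, (Int_scal minor e) by auto. rewrite (Int_ext (fun t => V t * (e * minor t)) (fun t => e * (V t * minor t)))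
      by (intros; ring). rewrite Int_scal by auto. unfold N. clear w2 w1 hVR N.
    generalize dependent (Int (fun t => V t * minor t)). intros z hz.
    assert (0 <= e * z) by (apply Rmult_le_pos; lra).
    assert (0 <= be * (e * z)) by (apply Rmult_le_pos; lra). fold n0.
    assert (be * (e * z) <= 1 * (e * z)) by (apply Rmult_le_compat_r; lra). lra. }
  destruct (ergodic_bound a b ha hb W (fun t => e * minor t) (e * (/ B * b 0)) (1 - K * be))
    as [r [M [hr [hM h]]]]; auto.
  - split; [unfold g' in *; nra|nra].
  - intros t. pose proof (minor_pos t). split; [nra|].
    apply Rmult_le_compat_l; [lra|apply minor_max].
  - apply (sum_W D); auto. now apply marg_summable.
  - intros t. destruct (ker_mass a b ha hb t) as [k1 k2]. destruct (hd t) as [d1 d2].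
    destruct (sum_W _ k1 d1) as [x1 x2]. rewrite k2 in x2. fold (k t) in d2.
    assert (hx : Int (fun t' => W t' * k t t') <= 1 + be * (g * V t + K)).
    { rewrite x2. apply Rplus_le_compat_l, Rmult_le_compat_l; [lra|exact d2]. }
    destruct (Rle_or_lt (Rabs t) R0) as [ht|ht].
    (* Near the origin the difference is nonnegative, so the mass of e [minor] is subtracted in
       full. *)
    + assert (E : forall t', W t' * k t t' - W t' * (e * minor t') = W t' * Rabs (k t t' - e * minor t')).
      { intros t'. rewrite Rabs_pos_eq; [ring|]. specialize (hsmall t t' ht).
        pose proof (minor_pos t'). assert (e * minor t' <= e0 * minor t'); [|lra].
        apply Rmult_le_compat_r; lra. }
      split; [apply summable_ext with (1 := E); now apply summable_minus|].
      rewrite <- (Int_ext _ _ E), Int_minus by auto.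
      specialize (V0 t). unfold W at 3. unfold g' in *.
      apply Rle_trans with (1 + be * (g * V t + K) - 2 * K * be); [lra|].
      assert (0 <= be * V t) by nra.
      assert (g * (be * V t) <= (1 - K * be) * (be * V t)) by (apply Rmult_le_compat_r; nra). lra.
    (* Far out the sign is unknown, the absolute value is bounded by the sum, and the excess drift
       pays for [m]. *)
    + assert (hs : summable (fun t' => W t' * k t t' + W t' * (e * minor t'))) by now apply summable_plus.
      assert (hle : forall t', W t' * Rabs (k t t' - e * minor t') <= W t' * k t t' + W t' * (e * minor t')).
      { intros t'. rewrite <- Rmult_plus_distr_l. apply Rmult_le_compat_l; auto.
        pose proof (minor_pos t'). pose proof (ker_nonneg a b ha hb t t').
        apply Rabs_le. nra. }
      assert (hs2 : summable (fun t' => W t' * Rabs (k t t' - e * minor t'))).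
      { pose proof (ker_cont_r a b ha hb t). pose proof minor_cont.
        apply summable_dom with (2 := hs); [cts|]. intros t'. rewrite Rabs_pos_eq; auto.
        apply Rmult_le_pos; auto using Rabs_pos. }
      split; auto. eapply Rle_trans; [apply (Int_le _ _ hs2 hs hle)|].
      rewrite Int_plus by auto. specialize (hVR t (Rlt_le _ _ ht)).
      assert (hgg : 0 < g' - g) by (unfold g'; lra).
      apply Rle_div_l in hVR; auto.
      assert (hVR2 : be * (2 * K + 2 * K * N / n0) <= be * (V t * (g' - g))).
      { apply Rmult_le_compat_l; lra. }
      replace (be * (2 * K + 2 * K * N / n0)) with (2 * K * be + e * N) in hVR2 by (unfold e; field; lra).
      unfold W at 3. specialize (V0 t).
      assert (0 <= be * V t) by nra.
      assert (g' * (be * V t) <= (1 - K * be) * (be * V t)) by (apply Rmult_le_compat_r; nra).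
      lra.
  - exists r; split; auto. exists (fun t0 => M * W t0). exact h.
Qed.

End Criteria.

(** * Tails of the error densities *)

Definition exp_tail (f : R -> R) (c : R) : Prop :=
  exists C, 0 < C /\ forall x, f x <= C * exp (- (c * Rabs x)).

(* A quantitative form of log-concavity in the tails: it compares the values of [f] at the two
   points at distance [v] from a large [t]. *)
Definition steep (f : R -> R) (c : R) : Prop :=
  exists T, 0 <= T /\ forall t v, T <= t -> 0 <= v <= t ->
    f (t + v) <= exp (- (2 * c * v)) * f (t - v).

Lemma exp_le x y : x <= y -> exp x <= exp y.
Proof. intros [h | ->]; [left; now apply exp_increasing|lra]. Qed.

(** For v = t = |x| / 2 steepness compares f(|x|) with f(0) and yields the rate c; the factor exp(2
    c T) takes care of |x| < 2 T. *)
Lemma steep_exp_tail f c : (forall x, 0 < f x) ->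
  (forall x y, Rabs x <= Rabs y -> f y <= f x) -> 0 <= c -> steep f c -> exp_tail f c.
Proof.
  intros f0 hdec hc [T [hT h]]. exists (f 0 * exp (2 * c * T)).
  pose proof (exp_pos (2 * c * T)). split; [apply Rmult_lt_0_compat; auto|].
  intros x. pose proof (Rabs_pos x). rewrite Rmult_assoc, <- exp_plus.
  destruct (Rle_or_lt (2 * T) (Rabs x)) as [hx|hx].
  - apply Rle_trans with (f 0 * exp (- (c * Rabs x))).
    + apply Rle_trans with (f (Rabs x)); [apply hdec; rewrite Rabs_Rabsolu; lra|].
      specialize (h (Rabs x / 2) (Rabs x / 2)).
      replace (Rabs x / 2 + Rabs x / 2) with (Rabs x) in h by field.
      replace (Rabs x / 2 - Rabs x / 2) with 0 in h by ring.
      replace (2 * c * (Rabs x / 2)) with (c * Rabs x) in h by field.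
      rewrite Rmult_comm. apply h; lra.
    + apply Rmult_le_compat_l; [left; auto|]. apply exp_le. nra.
  - apply Rle_trans with (f 0 * 1).
    + rewrite Rmult_1_r. apply hdec. rewrite Rabs_R0; lra.
    + apply Rmult_le_compat_l; [left; auto|]. rewrite <- exp_0. apply exp_le. nra.
Qed.

Lemma exp_sqr_lower y : 0 <= y -> (1 + y / 2) ^ 2 <= exp y.
Proof.
  intros hy. replace (exp y) with (exp (y / 2) ^ 2).
  - apply pow_incr. split; [lra|]. apply exp_ineq1_le.
  - simpl. rewrite Rmult_1_r, <- exp_plus. f_equal; field.
Qed.

(** The constant 4 / c^2 turns the term (c |x| / 2)^2 of [exp_sqr_lower] into x^2. *)
Lemma exp_cauchyd c x : 0 < c -> exp (- (c * Rabs x)) <= (1 + 4 / c ^ 2) * cauchyd x.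
Proof.
  intros hc. unfold cauchyd. apply (Rle_div_r _ _ (1 + x ^ 2)); [apply cauchy_den|].
  rewrite exp_Ropp. rewrite Rmult_comm. apply (Rle_div_l _ _ (exp (c * Rabs x))); [apply exp_pos|].
  assert (hx := Rabs_pos x). rewrite <- (pow2_abs x). set (y := Rabs x) in *. clearbody y.
  assert (0 < / c ^ 2) by (apply Rinv_0_lt_compat; nra).
  apply Rle_trans with ((1 + 4 / c ^ 2) * (1 + c * y / 2) ^ 2).
  - replace ((1 + 4 / c ^ 2) * (1 + c * y / 2) ^ 2)
      with (1 + y ^ 2 + (c * y + c ^ 2 * y ^ 2 / 4 + 4 * / c ^ 2 + 4 * / c ^ 2 * (c * y))) by (field; lra).
    assert (0 <= c * y) by nra. assert (0 <= c ^ 2 * y ^ 2) by (apply Rmult_le_pos; apply pow2_ge_0).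
    assert (0 <= / c ^ 2 * (c * y)) by (apply Rmult_le_pos; lra). lra.
  - apply Rmult_le_compat_l; [unfold Rdiv; lra|]. apply exp_sqr_lower. nra.
Qed.

Lemma exp_tail_weight f c d : exp_tail f c -> d < c ->
  exists C, 0 < C /\ forall x, f x * exp (d * Rabs x) <= C * cauchyd x.
Proof.
  intros [C [hC h]] hd. exists (C * (1 + 4 / (c - d) ^ 2)). split.
  - apply Rmult_lt_0_compat; auto. assert (0 < / (c - d) ^ 2) by (apply Rinv_0_lt_compat; nra).
    unfold Rdiv. lra.
  - intros x. pose proof (exp_pos (d * Rabs x)).
    apply Rle_trans with (C * exp (- (c * Rabs x)) * exp (d * Rabs x)).
    + apply Rmult_le_compat_r; [lra|auto].
    + rewrite !Rmult_assoc. apply Rmult_le_compat_l; [lra|]. rewrite <- exp_plus.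
      replace (- (c * Rabs x) + d * Rabs x) with (- ((c - d) * Rabs x)) by ring.
      apply exp_cauchyd. lra.
Qed.

(** * Continuity, monotonicity and steepness of the four families *)

Lemma powabs_cont b : 1 <= b -> cont (fun x => powabs x b).
Proof.
  intros hb. apply cont_eps. intros x eps he. destruct (Req_dec x 0) as [->|hx].
  - exists (Rmin 1 eps). split; [apply Rmin_glb_lt; lra|]. intros x' hx'.
    pose proof (Rmin_l 1 eps); pose proof (Rmin_r 1 eps). rewrite Rminus_0_r in hx'.
    unfold powabs at 2. destruct (Req_dec_T 0 0); [|lra]. rewrite Rminus_0_r.
    unfold powabs. destruct (Req_dec_T x' 0) as [h|h]; [rewrite Rabs_R0; lra|].
    assert (0 < Rabs x') by now apply Rabs_pos_lt.
    rewrite Rabs_pos_eq by (left; apply exp_pos).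
    apply Rle_lt_trans with (Rabs x'); [|lra].
    unfold Rpower. rewrite <- (exp_ln (Rabs x')) at 2 by auto. apply exp_le.
    assert (ln (Rabs x') <= 0) by (rewrite <- ln_1; apply ln_le; lra). nra.
  - assert (hpos : 0 < Rabs x) by now apply Rabs_pos_lt.
    assert (hc : continuous (fun z => exp (b * ln (Rabs z))) x).
    { apply continuous_exp_comp. apply (continuous_mult (fun _ => b)); [apply continuous_const|].
      apply continuous_comp; [apply continuous_Rabs|].
      apply continuity_pt_filterlim, derivable_continuous_pt.
      exists (/ Rabs x). now apply derivable_pt_lim_ln. }
    destruct (proj1 (filterlim_locally _ _) hc (mkposreal eps he)) as [d hd].
    exists (Rmin d (Rabs x)). split; [apply Rmin_glb_lt; auto; apply cond_pos|].
    intros x' hx'. pose proof (Rmin_l d (Rabs x)); pose proof (Rmin_r d (Rabs x)).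
    unfold powabs. destruct (Req_dec_T x' 0) as [->|h].
    { rewrite Rminus_0_l, Rabs_Ropp in hx'. lra. }
    destruct (Req_dec_T x 0); [lra|]. apply (hd x').
    change (Rabs (x' - x) < d). lra.
Qed.

Lemma powabs_mono b x y : 0 < b -> Rabs x <= Rabs y -> powabs x b <= powabs y b.
Proof.
  intros hb h. unfold powabs. destruct (Req_dec_T x 0) as [->|hx].
  - destruct (Req_dec_T y 0); [lra|left; apply exp_pos].
  - pose proof (Rabs_pos_lt x hx). destruct (Req_dec_T y 0) as [->|hy]; [rewrite Rabs_R0 in h; lra|].
    apply exp_le, Rmult_le_compat_l; [lra|]. now apply ln_le.
Qed.

(** Write x^b = x^(b-1) x and bound y^b by x^(b-1) y; then x^(b-1) >= x, because b >= 2 and x >= 1.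
    The gap is thus at least of Gaussian size. *)
Lemma powabs_gap b x y : 2 <= b -> 1 <= x -> 0 <= y <= x -> x * (x - y) <= powabs x b - powabs y b.
Proof.
  intros hb hx hy.
  assert (E : forall z, 0 < z -> powabs z b = Rpower z (b - 1) * z).
  { intros z hz. unfold powabs. destruct (Req_dec_T z 0); [lra|]. rewrite Rabs_pos_eq by lra.
    rewrite <- (Rpower_1 z) at 3 by auto. rewrite <- Rpower_plus. f_equal; ring. }
  assert (hxx : x <= Rpower x (b - 1)).
  { rewrite <- (Rpower_1 x) at 1 by lra. destruct hx as [hx|<-].
    - apply Rle_Rpower; lra.
    - unfold Rpower. rewrite ln_1, !Rmult_0_r. lra. }
  assert (hyb : powabs y b <= Rpower x (b - 1) * y).
  { destruct (proj1 hy) as [h|<-].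
    - rewrite E by auto. apply Rmult_le_compat_r; [lra|].
      apply exp_le, Rmult_le_compat_l; [lra|]. apply ln_le; lra.
    - unfold powabs. destruct (Req_dec_T 0 0); [|lra]. rewrite Rmult_0_r. lra. }
  rewrite (E x) by lra.
  apply Rle_trans with (Rpower x (b - 1) * (x - y)); [|lra].
  apply Rmult_le_compat_r; lra.
Qed.

Lemma gdens_pos f s x : 0 < gdens f s x.
Proof.
  destruct f; try apply exp_pos. apply Rinv_0_lt_compat. pose proof (pow2_ge_0 (x / s)); lra.
Qed.

Lemma div_abs_le s x y : 0 < s -> Rabs x <= Rabs y -> Rabs (x / s) <= Rabs (y / s).
Proof.
  intros hs h. unfold Rdiv. rewrite !Rabs_mult. apply Rmult_le_compat_r; auto. apply Rabs_pos.
Qed.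

Lemma gdens_decr f s x y : 0 < s -> fam_ok f -> Rabs x <= Rabs y -> gdens f s y <= gdens f s x.
Proof.
  intros hs hf h. assert (h2 := div_abs_le s x y hs h).
  assert (hsq : (x / s) ^ 2 <= (y / s) ^ 2).
  { rewrite <- (pow2_abs (x / s)), <- (pow2_abs (y / s)). apply pow_incr.
    split; [apply Rabs_pos|auto]. }
  destruct f; simpl in *.
  - pose proof (pow2_ge_0 (x / s)). apply Rinv_le_contravar; simpl in *; lra.
  - apply exp_le, Ropp_le_contravar. apply Rmult_le_compat_r; auto.
    left; now apply Rinv_0_lt_compat.
  - apply exp_le. simpl in *. lra.
  - apply exp_le, Ropp_le_contravar, powabs_mono; auto; lra.
Qed.

Lemma gdens_cont f s : 0 < s -> fam_ok f -> cont (gdens f s).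
Proof.
  intros hs hf. destruct f; simpl in *.
  - change (cont (fun x => / (1 + (x / s) ^ 2))). cts; intros x; try lra.
    pose proof (pow2_ge_0 (x / s)); lra.
  - change (cont (fun x => exp (- (Rabs x / s)))). cts; intros _; lra.
  - change (cont (fun x => exp (- ((x / s) ^ 2 / 2)))). cts; intros _; lra.
  - change (cont (fun x => exp (- powabs (x / s) beta))).
    apply cont_exp, cont_opp, (cont_comp (fun z => powabs z beta)); [apply powabs_cont; lra|].
    cts; intros _; lra.
Qed.

Definition light (f : fam) : Prop := f <> FC.
Definition lighter (f : fam) : Prop := f <> FC /\ f <> FE.

Lemma steep_exponential s : 0 < s -> steep (gdens FE s) (/ s).
Proof.
  intros hs. exists 0. split; [lra|]. intros t v ht hv. simpl. rewrite <- exp_plus.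
  apply exp_le. rewrite !Rabs_pos_eq by lra. right. field. lra.
Qed.

(** Every rate [c] is reached: the exponents at t + v and t - v differ by at least 2 t v / s^2,
    which exceeds 2 c v once t >= c s^2. The summand [s] in [T] ensures (t + v) / s >= 1, as
    [powabs_gap] requires. *)
Lemma steep_lighter f s c : 0 < s -> fam_ok f -> lighter f -> steep (gdens f s) c.
Proof.
  intros hs hf [h1 h2]. set (T := s + Rabs c * s ^ 2).
  assert (hT0 : 0 <= Rabs c * s ^ 2) by (apply Rmult_le_pos; [apply Rabs_pos|apply pow2_ge_0]).
  exists T. split; [unfold T; lra|]. intros t v ht hv.
  assert (hts : s <= t) by (unfold T in ht; lra).
  assert (hct : c * s ^ 2 <= t).
  { pose proof (Rle_abs c). assert (c * s ^ 2 <= Rabs c * s ^ 2).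
    { apply Rmult_le_compat_r; auto. apply pow2_ge_0. }
    unfold T in ht; lra. }
  assert (hgap : 2 * c * v <= t / s * (2 * v / s)).
  { replace (t / s * (2 * v / s)) with (t * / s ^ 2 * (2 * v)) by (field; lra).
    replace (2 * c * v) with (c * (2 * v)) by ring. apply Rmult_le_compat_r; [lra|].
    apply (Rle_div_r c t); auto. nra. }
  assert (hi : 0 < / s) by now apply Rinv_0_lt_compat.
  destruct f; try congruence; simpl gdens; rewrite <- exp_plus; apply exp_le.
  - replace (((t + v) / s) ^ 2 / 2) with (((t - v) / s) ^ 2 / 2 + t / s * (2 * v / s)) by (field; lra).
    lra.
  - simpl in hf.
    assert (hg := powabs_gap beta ((t + v) / s) ((t - v) / s)).
    assert (hb : (t + v) / s * ((t + v) / s - (t - v) / s) <=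
                 powabs ((t + v) / s) beta - powabs ((t - v) / s) beta).
    { apply hg; [lra| |].
      - apply (Rle_div_r 1); lra.
      - split; [apply Rdiv_le_0_compat; lra|]. apply Rmult_le_compat_r; lra. }
    replace ((t + v) / s - (t - v) / s) with (2 * v / s) in hb by (field; lra).
    assert (t / s * (2 * v / s) <= (t + v) / s * (2 * v / s)).
    { apply Rmult_le_compat_r; [apply Rdiv_le_0_compat; lra|]. apply Rmult_le_compat_r; lra. }
    lra.
Qed.

Lemma steep_light f s : 0 < s -> fam_ok f -> light f -> exists c, 0 < c /\ steep (gdens f s) c.
Proof.
  intros hs hf hl. exists (/ s). split; [now apply Rinv_0_lt_compat|].
  destruct f; try (apply steep_lighter; auto; split; congruence).
  now apply steep_exponential.
Qed.

Lemma gdens_exp_tail f s c : 0 < s -> fam_ok f -> 0 <= c -> steep (gdens f s) c ->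
  exp_tail (gdens f s) c.
Proof.
  intros. apply steep_exp_tail; auto; [apply gdens_pos|]. intros; now apply gdens_decr.
Qed.

Lemma gdens_cauchy_bounds s : 0 < s -> exists c C, 0 < c /\ 0 < C /\
  forall x, c * cauchyd x <= gdens FC s x <= C * cauchyd x.
Proof.
  intros hs. assert (hs2 : 0 < s ^ 2) by (apply pow_lt; auto).
  assert (E : forall x, gdens FC s x = s ^ 2 / (s ^ 2 + x ^ 2)).
  { intros x. simpl gdens. pose proof (pow2_ge_0 x). field. simpl in *. lra. }
  exists (s ^ 2 / (1 + s ^ 2)), (1 + s ^ 2). split; [apply Rdiv_lt_0_compat; lra|]. split; [lra|].
  intros x. pose proof (pow2_ge_0 x). rewrite E. unfold cauchyd. split.
  - replace (s ^ 2 / (1 + s ^ 2) * / (1 + x ^ 2)) with (s ^ 2 * / ((1 + s ^ 2) * (1 + x ^ 2))) by (field; lra).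
    apply Rmult_le_compat_l; [lra|]. apply Rinv_le_contravar; nra.
  - apply (Rle_div_r (s ^ 2 / (s ^ 2 + x ^ 2)) (1 + s ^ 2)); [lra|].
    apply Rmult_le_reg_r with (s ^ 2 + x ^ 2); [lra|].
    replace (s ^ 2 / (s ^ 2 + x ^ 2) * (1 + x ^ 2) * (s ^ 2 + x ^ 2)) with (s ^ 2 * (1 + x ^ 2)) by (field; lra).
    nra.
Qed.

Lemma gdens_density f s : 0 < s -> fam_ok f -> density (gdens f s).
Proof.
  intros hs hf. constructor.
  - now apply gdens_cont.
  - apply gdens_pos.
  - assert (hd : f = FC \/ light f) by (destruct f; auto; right; congruence).
    destruct hd as [->|hl].
    + destruct (gdens_cauchy_bounds s hs) as [c [C [hc [hC h]]]]. exists C; split; auto.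
      intros x; apply h.
    + destruct (steep_light f s hs hf hl) as [c [hc h]].
      destruct (exp_tail_weight _ c 0 (gdens_exp_tail f s c hs hf (Rlt_le _ _ hc) h) hc) as [C [hC h']].
      exists C; split; auto. intros x. specialize (h' x).
      now rewrite Rmult_0_l, exp_0, Rmult_1_r in h'.
  - intros; now apply gdens_decr.
Qed.

(** * Exponential moments of the kernel *)

Lemma cosh_cont d : cont (fun t => cosh (d * t)).
Proof. unfold cosh. cts. intros _; lra. Qed.

Lemma cosh_pos x : 0 < cosh x.
Proof. unfold cosh. pose proof (exp_pos x); pose proof (exp_pos (-x)); lra. Qed.

Lemma cosh_exp_abs x : cosh x <= exp (Rabs x) <= 2 * cosh x.
Proof.
  unfold cosh. pose proof (exp_pos x); pose proof (exp_pos (-x)).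
  unfold Rabs. destruct (Rcase_abs x).
  - assert (exp x <= exp (- x)) by (apply exp_le; lra). lra.
  - assert (exp (- x) <= exp x) by (apply exp_le; lra). lra.
Qed.

Lemma cosh_opp x : cosh (- x) = cosh x.
Proof. unfold cosh. rewrite Ropp_involutive. lra. Qed.

Lemma cosh_add_le x y : cosh (x + y) <= cosh x * exp (Rabs y).
Proof.
  unfold cosh. replace (- (x + y)) with (- x + - y) by ring. rewrite !exp_plus.
  pose proof (exp_pos x); pose proof (exp_pos (-x)).
  assert (exp y <= exp (Rabs y)) by apply exp_le, Rle_abs.
  assert (exp (- y) <= exp (Rabs y)).
  { apply exp_le. rewrite <- Rabs_Ropp. apply Rle_abs. }
  nra.
Qed.

(** With e = exp(x/2), cosh x - 1 = (e - 1/e)^2 / 2, and e - 1/e <= x e because exp(-x) >= 1 - x. *)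
Lemma cosh_quadratic x : 0 <= x -> cosh x <= 1 + x ^ 2 / 2 * exp x.
Proof.
  intros hx. set (e := exp (x / 2)). assert (he : 0 < e) by apply exp_pos.
  assert (E : exp x = e * e) by (unfold e; rewrite <- exp_plus; f_equal; field).
  assert (E' : exp (- x) = / e * / e).
  { rewrite exp_Ropp, E. field. lra. }
  assert (h : e - / e <= x * e).
  { assert (h1 : 1 - x <= / e * / e) by (rewrite <- E'; pose proof (exp_ineq1_le (- x)); lra).
    apply Rmult_le_compat_l with (r := e) in h1; [|lra].
    replace (e * (/ e * / e)) with (/ e) in h1 by (field; lra). lra. }
  assert (h0 : 0 <= e - / e).
  { assert (1 <= e) by (unfold e; pose proof (exp_ineq1_le (x / 2)); lra).
    assert (/ e <= / 1) by (apply Rinv_le_contravar; lra). rewrite Rinv_1 in *. lra. }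
  assert (hsq : (e - / e) * (e - / e) <= (x * e) * (x * e)) by (apply Rmult_le_compat; auto).
  unfold cosh. rewrite E, E'. assert (e * / e = 1) by (field; lra). nra.
Qed.

Lemma exp_tail_envelope f c d : density f -> exp_tail f c -> d < c ->
  envelope (fun x => f x * exp (d * Rabs x)).
Proof.
  intros hf ht hd. destruct (exp_tail_weight f c d ht hd) as [C [hC h]]. exists C. intros x.
  rewrite Rabs_pos_eq; auto. left. apply Rmult_lt_0_compat; auto. apply exp_pos.
Qed.

Lemma exp_weight_cont f d : cont f -> cont (fun x => f x * exp (d * Rabs x)).
Proof. intros; cts. Qed.

Lemma exp_weight_summable f c d : density f -> exp_tail f c -> d < c ->
  summable (fun x => f x * exp (d * Rabs x)).
Proof.
  intros hf ht hd. apply summable_envelope; [apply exp_weight_cont; auto|].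
  now apply exp_tail_envelope with c.
Qed.

Definition mom (b : R -> R) (d : R) : R := Int (fun z => cosh (d * z) * b z) / Int b.

Lemma cosh_weight_le f d x : 0 <= d -> 0 <= f -> cosh (d * x) * f <= f * exp (d * Rabs x).
Proof.
  intros hd hf. rewrite Rmult_comm. apply Rmult_le_compat_l; auto.
  eapply Rle_trans; [apply cosh_exp_abs|]. rewrite Rabs_mult, (Rabs_pos_eq d) by auto. lra.
Qed.

Lemma cosh_weight_summable f c d : density f -> exp_tail f c -> 0 <= d < c ->
  summable (fun x => cosh (d * x) * f x).
Proof.
  intros hf ht hd. pose proof (cosh_cont d). assert (cont f) by auto.
  apply summable_dom with (fun x => f x * exp (d * Rabs x)).
  - apply (cont_mult (fun x => cosh (d * x)) f); auto.
  - apply exp_weight_summable with c; auto; lra.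
  - intros x. pose proof (cosh_pos (d * x)). pose proof (density_pos f hf x).
    rewrite Rabs_pos_eq by nra. apply cosh_weight_le; lra.
Qed.

(** As [b] is even, z and -z may be averaged, and cosh(d(u - z)) + cosh(d(u + z)) = 2 cosh(du)
    cosh(dz): the weight is an eigenfunction of convolution with b. *)
Lemma mom_translate b c d u : density b -> exp_tail b c -> 0 <= d < c ->
  summable (fun t => cosh (d * t) * b (u - t)) /\
  Int (fun t => cosh (d * t) * b (u - t)) <= Int b * (mom b d * cosh (d * u)).
Proof.
  intros hb ht hd. assert (cb := density_cont b hb). pose proof (cosh_cont d) as cc.
  set (F := fun z => cosh (d * (u - z)) * b z).
  assert (cF : cont F).
  { apply (cont_mult (fun z => cosh (d * (u - z))) b); auto.
    apply (cont_comp (fun t => cosh (d * t)) (fun z => u - z)); auto. cts. }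
  assert (sb := cosh_weight_summable b c d hb ht hd).
  assert (hF0 : forall z, 0 <= F z).
  { intros z. apply Rmult_le_pos; left; auto. apply cosh_pos. }
  assert (sw := exp_weight_summable b c d hb ht (proj2 hd)).
  assert (hFle : forall z, F z <= cosh (d * u) * (b z * exp (d * Rabs z))).
  { intros z. unfold F. rewrite (Rmult_comm (b z)), <- Rmult_assoc.
    apply Rmult_le_compat_r; [left; auto|].
    replace (d * (u - z)) with (d * u + - (d * z)) by ring.
    eapply Rle_trans; [apply cosh_add_le|]. rewrite Rabs_Ropp, Rabs_mult, (Rabs_pos_eq d); lra. }
  assert (sF : summable F).
  { apply summable_dom with (fun z => cosh (d * u) * (b z * exp (d * Rabs z))); auto.
    - now apply summable_scal.
    - intros z. rewrite Rabs_pos_eq; auto. }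
  assert (sF' : summable (fun z => F (- z))).
  { apply summable_dom with (fun z => cosh (d * u) * (b z * exp (d * Rabs z))).
    - cts.
    - now apply summable_scal.
    - intros z. rewrite Rabs_pos_eq by auto. specialize (hFle (- z)).
      rewrite Rabs_Ropp, (density_even b z hb) in hFle. exact hFle. }
  assert (EI : Int (fun t => cosh (d * t) * b (u - t)) = Int F).
  { rewrite <- (Int_reflect F u). apply Int_ext. intros t. unfold F. do 2 f_equal. ring. }
  assert (Eodd : Int (fun z => F (- z)) = Int F).
  { rewrite <- (Int_reflect F 0). apply Int_ext. intros t. f_equal. ring. }
  split.
  - destruct (exp_tail_weight b c d ht (proj2 hd)) as [C [hC h]].
    apply summable_envelope.
    { apply (cont_mult (fun t => cosh (d * t))); auto. cts. }
    exists (cosh (d * u) * (C * (2 * (1 + u ^ 2)))). intros t.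
    assert (hp := hF0 (u - t)). specialize (hFle (u - t)). unfold F in hp, hFle.
    replace (u - (u - t)) with t in hp, hFle by ring. rewrite Rabs_pos_eq by auto.
    eapply Rle_trans; [apply hFle|]. rewrite Rmult_assoc.
    apply Rmult_le_compat_l; [left; apply cosh_pos|].
    eapply Rle_trans; [apply h|]. rewrite Rmult_assoc. apply Rmult_le_compat_l; [lra|].
    replace (u - t) with (- (t - u)) by ring. rewrite cauchy_even. apply cauchy_shift.
  - rewrite EI. unfold mom.
    replace (Int b * (Int (fun z => cosh (d * z) * b z) / Int b * cosh (d * u)))
      with (cosh (d * u) * Int (fun z => cosh (d * z) * b z)).
    2:{ pose proof (mass_pos b hb). field. lra. }
    rewrite <- Int_scal by auto.
    assert (Int F + Int F = 2 * Int (fun x => cosh (d * u) * (cosh (d * x) * b x))); [|lra].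
    rewrite <- Eodd at 2. rewrite <- Int_plus by auto. rewrite <- Int_scal by now apply summable_scal.
    apply Int_ext. intros z. unfold F. rewrite (density_even b z hb). unfold cosh.
    replace (d * (u - z)) with (d * u + - (d * z)) by ring.
    replace (d * (u - - z)) with (d * u + d * z) by ring.
    replace (- (d * u + - (d * z))) with (- (d * u) + d * z) by ring.
    replace (- (d * u + d * z)) with (- (d * u) + - (d * z)) by ring.
    rewrite !exp_plus. field.
Qed.

(** Evenness of cosh removes the linear term in [d]. The available decay is split: one factor
    exp(c|z|/4) absorbs z^2, another absorbs exp(d|z|), and the rate c/2 in [S] is still
    integrable. *)
Lemma mom_quadratic b c : density b -> 0 < c -> exp_tail b c ->
  exists Q, 0 <= Q /\ forall d, 0 <= d <= c / 4 -> 0 <= mom b d <= 1 + Q * d ^ 2.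
Proof.
  intros hb hc ht. set (S := Int (fun z => b z * exp (c / 2 * Rabs z))).
  assert (sS : summable (fun z => b z * exp (c / 2 * Rabs z))).
  { apply exp_weight_summable with c; auto. lra. }
  assert (hB := mass_pos b hb).
  assert (hS : 0 <= S).
  { apply Int_ge0; auto. intros. left. apply Rmult_lt_0_compat; auto. apply exp_pos. }
  (* From exp(y) >= y^2 / 4 at y = c|z|/4, that is, z^2 <= 2 q exp(c|z|/4). *)
  set (q := 2 / (c / 4) ^ 2). assert (hq : 0 < q) by (apply Rdiv_lt_0_compat; [lra|apply pow_lt; lra]).
  exists (q * S / Int b). split.
  { apply Rdiv_le_0_compat; auto. apply Rmult_le_pos; lra. }
  intros d hd.
  assert (sb := cosh_weight_summable b c d hb ht ltac:(lra)). split.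
  { apply Rdiv_le_0_compat; auto. apply Int_ge0; auto. intros; left; apply Rmult_lt_0_compat; auto.
    apply cosh_pos. }
  unfold mom. apply (Rle_div_l _ _ (Int b)); auto.
  replace ((1 + q * S / Int b * d ^ 2) * Int b) with (Int b + d ^ 2 * q * S) by (field; lra).
  unfold S. rewrite <- Int_scal, <- Int_plus by (auto; try apply summable_scal; auto; now apply density_summable).
  apply Int_le; auto.
  { apply summable_plus; [now apply density_summable|now apply summable_scal]. }
  intros z. pose proof (density_pos b hb z). pose proof (Rabs_pos z) as hz.
  assert (h1 : cosh (d * z) <= 1 + (d * Rabs z) ^ 2 / 2 * exp (d * Rabs z)).
  { replace (cosh (d * z)) with (cosh (d * Rabs z)); [apply cosh_quadratic; nra|].
    unfold Rabs. destruct (Rcase_abs z); auto.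
    replace (d * - z) with (- (d * z)) by ring. apply cosh_opp. }
  assert (h2 := exp_sqr_lower (c / 4 * Rabs z) ltac:(nra)).
  assert (h3 : Rabs z ^ 2 <= 2 * q * exp (c / 4 * Rabs z)).
  { unfold q. replace (2 * (2 / (c / 4) ^ 2) * exp (c / 4 * Rabs z))
      with (4 * exp (c / 4 * Rabs z) / (c / 4) ^ 2) by (field; lra).
    apply (Rle_div_r (Rabs z ^ 2)); [apply pow_lt; lra|].
    set (x := Rabs z) in *. assert (0 <= c / 4 * x) by nra. nra. }
  assert (h4 : exp (d * Rabs z) <= exp (c / 4 * Rabs z)) by (apply exp_le; nra).
  assert (h5 : exp (c / 2 * Rabs z) = exp (c / 4 * Rabs z) * exp (c / 4 * Rabs z)).
  { rewrite <- exp_plus. f_equal; field. }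
  rewrite h5. set (E := exp (c / 4 * Rabs z)) in *. set (F := exp (d * Rabs z)) in *.
  assert (hF : 0 < F) by apply exp_pos. assert (hE : 0 < E) by apply exp_pos.
  assert (h6 : (d * Rabs z) ^ 2 / 2 * F <= d ^ 2 * q * (E * E)).
  { replace ((d * Rabs z) ^ 2 / 2 * F) with (d ^ 2 / 2 * (Rabs z ^ 2 * F)) by field.
    replace (d ^ 2 * q * (E * E)) with (d ^ 2 / 2 * (2 * q * E * E)) by field.
    apply Rmult_le_compat_l; [pose proof (pow2_ge_0 d); lra|].
    apply Rmult_le_compat; auto; [apply pow2_ge_0|lra]. }
  rewrite Rmult_comm.
  apply Rle_trans with (b z * (1 + d ^ 2 * q * (E * E))); [|lra].
  apply Rmult_le_compat_l; lra.
Qed.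

Lemma cosh_joint_le a b d t u : density a -> density b -> 0 <= d ->
  cosh (d * u) * (a u * b (u - t)) <= cosh (d * t) * (a u * (b (u - t) * exp (d * Rabs (u - t)))).
Proof.
  intros ha hb hd.
  replace (cosh (d * t) * (a u * (b (u - t) * exp (d * Rabs (u - t)))))
    with (cosh (d * t) * exp (d * Rabs (u - t)) * (a u * b (u - t))) by ring.
  apply Rmult_le_compat_r; [apply Rmult_le_pos; left; auto|].
  replace (d * u) with (d * t + d * (u - t)) by ring.
  eapply Rle_trans; [apply cosh_add_le|]. rewrite Rabs_mult, (Rabs_pos_eq d) by auto. lra.
Qed.

Lemma cosh_joint_summable a b c d t : density a -> density b -> exp_tail b c -> 0 <= d < c ->
  summable (fun u => cosh (d * u) * (a u * b (u - t))).
Proof.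
  intros ha hb ht hd. assert (ca := density_cont a ha). assert (cb := density_cont b hb).
  assert (cc := cosh_cont d).
  apply summable_dom with (fun u => cosh (d * t) * (a u * (b (u - t) * exp (d * Rabs (u - t))))).
  - apply (cont_mult (fun u => cosh (d * u))); auto. cts.
  - apply summable_scal. apply (conv_summable a (fun x => b x * exp (d * Rabs x))); auto.
    + now apply exp_weight_cont.
    + now apply density_envelope.
    + apply exp_tail_envelope with c; auto; lra.
  - intros u. rewrite Rabs_pos_eq; [apply cosh_joint_le; auto; lra|].
    apply Rmult_le_pos; [left; apply cosh_pos|apply Rmult_le_pos; left; auto].
Qed.

Lemma ker_cosh_le a b c d t : density a -> density b -> exp_tail b c -> 0 <= d < c ->
  summable (fun t' => cosh (d * t') * ker a b t t') /\
  Int (fun t' => cosh (d * t') * ker a b t t') <=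
    mom b d * Int (fun u => cosh (d * u) * (a u * b (u - t))) / marg a b t.
Proof.
  intros ha hb ht hd.
  assert (hs := cosh_joint_summable a b c d t ha hb ht hd).
  assert (E : forall u, mom b d * (cosh (d * u) * (a u * b (u - t))) =
     mom b d * cosh (d * u) * (a u * b (u - t))) by (intros; ring).
  destruct (ker_weight_le a b ha hb (fun t' => cosh (d * t')) (fun u => mom b d * cosh (d * u)) t)
    as [h1 h2].
  - apply cosh_cont.
  - intros; left; apply cosh_pos.
  - intros u. now apply mom_translate with c.
  - apply summable_ext with (1 := E). now apply summable_scal.
  - split; auto. rewrite <- (Int_ext _ _ E), Int_scal in h2 by auto. exact h2.
Qed.

(** * Drift condition *)

Lemma RInt_fold f t : cont f ->
  RInt f 0 (2 * t) = RInt (fun v => f (t + v) + f (t - v)) 0 t.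
Proof.
  intros cf.
  rewrite (Rint_plus (fun v => f (t + v)) (fun v => f (t - v))); [|cts|cts].
  rewrite (Rint_chasles f 0 t (2 * t)), Rplus_comm by auto. f_equal.
  - replace t with (1 * 0 + t) at 1 by ring. replace (2 * t) with (1 * t + t) by ring.
    rewrite <- (RInt_comp_lin f 1 t 0 t) by auto. apply Rint_ext. intros x.
    unfold scal; simpl; unfold mult; simpl. rewrite Rmult_1_l. f_equal; ring.
  - rewrite <- (opp_RInt_swap f) by auto.
    replace (RInt f t 0) with (RInt f (-1 * 0 + t) (-1 * t + t)) by (f_equal; ring).
    rewrite <- (RInt_comp_lin f (-1) t 0 t) by auto.
    rewrite (Rint_ext _ (fun x => -1 * f (t - x))).
    + rewrite Rint_scal by cts. change (- (-1 * RInt (fun x => f (t - x)) 0 t) = RInt (fun x => f (t - x)) 0 t).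
      ring.
    + intros x. unfold scal; simpl; unfold mult; simpl. do 2 f_equal; ring.
Qed.

(* The two points [t + v] and [t - v] get the same weight from [b]; steepness of [a] makes the
   one nearer to the origin heavier, so the exponential weight decreases on average. *)
Lemma pair_contract c d v A A' : 0 < c -> 0 <= d <= 1 -> d <= c -> 0 <= v -> 0 < A -> 0 < A' ->
  A' <= exp (- (2 * c * v)) * A ->
  exp (d * v) * A' + exp (- (d * v)) * A <= A + A' /\
  (1 <= v -> exp (d * v) * A' + exp (- (d * v)) * A <= (1 - d * ((1 - exp (- c)) / 4)) * (A + A')).
Proof.
  intros hc hd hdc hv hA hA' h.
  set (x := exp (- (d * v))).
  assert (hx : 0 < x) by apply exp_pos.
  assert (hx1 : x <= 1) by (unfold x; rewrite <- exp_0; apply exp_le; nra).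
  assert (hdv : exp (d * v) = / x) by (unfold x; now rewrite exp_Ropp, Rinv_inv).
  assert (hcv : exp (- (c * v)) <= 1) by (rewrite <- exp_0; apply exp_le; nra).
  assert (h1 : exp (d * v) * A' <= exp (- (c * v)) * A).
  { apply Rle_trans with (exp (d * v) * (exp (- (2 * c * v)) * A)).
    - apply Rmult_le_compat_l; auto. left; apply exp_pos.
    - rewrite <- Rmult_assoc, <- exp_plus. apply Rmult_le_compat_r; [lra|]. apply exp_le. nra. }
  (* The gain factors into the relative displacement 1 - x and the imbalance of the two weights. *)
  assert (E : A + A' - (exp (d * v) * A' + x * A) = (1 - x) * (A - exp (d * v) * A')).
  { rewrite hdv. field. lra. }
  assert (hAA : A' <= A).
  { eapply Rle_trans; [exact h|]. rewrite <- (Rmult_1_l A) at 2. apply Rmult_le_compat_r; [lra|].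
    rewrite <- exp_0. apply exp_le. nra. }
  assert (h2 : A * (1 - exp (- (c * v))) <= A - exp (d * v) * A') by lra.
  split.
  - assert (0 <= (1 - x) * (A - exp (d * v) * A')); [|lra]. apply Rmult_le_pos; [lra|].
    assert (0 <= A * (1 - exp (- (c * v)))) by (apply Rmult_le_pos; lra). lra.
  (* The 1/4 in the claim is 1/2 from 1 - exp(-d) >= d/2, valid for d <= 1, times 1/2 from A >= (A +
     A') / 2. *)
  - intros hv1.
    assert (hxd : d / 2 <= 1 - x).
    { assert (hxx : x <= exp (- d)) by (unfold x; apply exp_le; nra).
      assert (exp (- d) * (1 + d) <= 1).
      { rewrite exp_Ropp. pose proof (exp_pos d). pose proof (exp_ineq1_le d).
        apply Rle_trans with (/ exp d * exp d); [apply Rmult_le_compat_l; auto; left; now apply Rinv_0_lt_compat|].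
        right. field. lra. }
      pose proof (exp_pos (- d)). nra. }
    assert (hcc : exp (- (c * v)) <= exp (- c)) by (apply exp_le; nra).
    assert (hc1 : exp (- c) < 1) by (rewrite <- exp_0; apply exp_increasing; lra).
    assert (h3 : A * (1 - exp (- c)) <= A - exp (d * v) * A').
    { eapply Rle_trans; [|exact h2]. apply Rmult_le_compat_l; lra. }
    assert (h4 : d / 2 * (A * (1 - exp (- c))) <= (1 - x) * (A - exp (d * v) * A')).
    { apply Rmult_le_compat; try lra. apply Rmult_le_pos; lra. }
    assert (h5 : d * ((1 - exp (- c)) / 4) * (A + A') <= d / 2 * (A * (1 - exp (- c)))).
    { replace (d / 2 * (A * (1 - exp (- c)))) with (d * ((1 - exp (- c)) / 4) * (2 * A)) by field.
      apply Rmult_le_compat_l; [|lra]. apply Rmult_le_pos; lra. }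
    lra.
Qed.

(** On [0, 1] the distance to t is at most t, so b is evaluated at t itself and not at t + 1. This
    matches the bound by b(t) outside (0, 2t) in [joint_cosh_large]. *)
Lemma marg_ge_shift a b t : density a -> density b -> 1 <= t -> a 1 * b t <= marg a b t.
Proof.
  intros ha hb ht. apply Rle_trans with (RInt (fun u => a u * b (u - t)) 0 1).
  - apply Rle_trans with (RInt (fun _ => a 1 * b t) 0 1); [rewrite Rint_const; lra|].
    assert (cont a) by auto. assert (cont b) by auto.
    apply Rint_le; [cts|cts|lra|]. intros u hu. apply Rmult_le_compat; try (left; auto; fail).
    + apply (density_decr a ha). rewrite !Rabs_pos_eq; lra.
    + apply (density_decr b hb). rewrite (Rabs_pos_eq t) by lra. apply Rabs_le; lra.
  - apply RInt_le_Int; [now apply joint_summable| |lra]. intros; apply Rmult_le_pos; left; auto.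
Qed.

(** Pairs with v < 1 yield no definite gain, but their weight is at most q = 2 b(0) / b(2) times
    that of the remaining pairs. So a fraction 1 / (1 + q) of the mass gains the factor of
    [pair_contract]. *)
Lemma fold_contract a b c T d t : density a -> density b -> 0 < c -> 0 <= d <= 1 -> d <= c ->
  (forall t v, T <= t -> 0 <= v <= t -> a (t + v) <= exp (- (2 * c * v)) * a (t - v)) ->
  T <= t -> 2 <= t ->
  RInt (fun u => exp (d * u) * (a u * b (u - t))) 0 (2 * t) <=
    (1 - d * ((1 - exp (- c)) / 4 / (1 + 2 * b 0 / b 2))) * (exp (d * t) * marg a b t).
Proof.
  intros ha hb hc hd hdc hst hT ht.
  assert (ca := density_cont a ha). assert (cb := density_cont b hb).
  set (w := fun v => a (t + v) * b v + a (t - v) * b v).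
  assert (cw : cont w) by (unfold w; cts).
  assert (w0 : forall v, 0 <= w v).
  { intros v. apply Rplus_le_le_0_compat; apply Rmult_le_pos; left; auto. }
  assert (hw : RInt w 0 t <= marg a b t).
  { apply Rle_trans with (RInt (fun u => a u * b (u - t)) 0 (2 * t)).
    - rewrite RInt_fold by cts. right. apply Rint_ext. intros v. unfold w.
      replace (t + v - t) with v by ring. replace (t - v - t) with (- v) by ring.
      now rewrite (density_even b v hb).
    - apply RInt_le_Int; [now apply joint_summable| |lra]. intros; apply Rmult_le_pos; left; auto. }
  set (eta := d * ((1 - exp (- c)) / 4)).
  assert (hc1 : exp (- c) < 1) by (rewrite <- exp_0; apply exp_increasing; lra).
  assert (he0 : 0 < exp (- c)) by apply exp_pos.
  assert (heta : 0 <= eta <= 1).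
  { unfold eta. split; [apply Rmult_le_pos; lra|]. nra. }
  set (h := fun v => exp (d * (t + v)) * (a (t + v) * b (t + v - t)) +
                     exp (d * (t - v)) * (a (t - v) * b (t - v - t))).
  assert (ch : cont h) by (unfold h; cts).
  assert (hpt : forall v, 0 <= v <= t -> h v <= exp (d * t) * w v /\
             (1 <= v -> h v <= exp (d * t) * (1 - eta) * w v)).
  { intros v hv.
    destruct (pair_contract c d v (a (t - v)) (a (t + v))) as [h1 h2]; auto; try lra.
    assert (E : h v = exp (d * t) * b v * (exp (d * v) * a (t + v) + exp (- (d * v)) * a (t - v))).
    { unfold h. replace (t + v - t) with v by ring. replace (t - v - t) with (- v) by ring.
      rewrite (density_even b v hb). replace (d * (t + v)) with (d * t + d * v) by ring.
      replace (d * (t - v)) with (d * t + - (d * v)) by ring. rewrite !exp_plus. ring. }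
    assert (hp : 0 <= exp (d * t) * b v) by (apply Rmult_le_pos; left; auto; apply exp_pos).
    rewrite E. unfold w. split; [|intros hv1].
    - replace (exp (d * t) * (a (t + v) * b v + a (t - v) * b v))
        with (exp (d * t) * b v * (a (t - v) + a (t + v))) by ring. now apply Rmult_le_compat_l.
    - replace (exp (d * t) * (1 - eta) * (a (t + v) * b v + a (t - v) * b v))
        with (exp (d * t) * b v * ((1 - eta) * (a (t - v) + a (t + v)))) by ring.
      apply Rmult_le_compat_l; auto. }
  set (W1 := RInt w 0 1). set (W2 := RInt w 1 t).
  assert (hW : W1 + W2 <= marg a b t).
  { unfold W1, W2. rewrite <- Rint_chasles; auto. }
  assert (hb2 := density_pos b hb 2). assert (hb0 := density_pos b hb 0).
  (* Both weights are compared with a(t - 1): for v <= 1 it bounds a from above, and for 1 <= v <= 2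
     it bounds a(t - v) from below. *)
  assert (hq : W1 <= 2 * b 0 / b 2 * W2).
  { assert (hat := density_pos a ha (t - 1)).
    assert (W1 <= 2 * b 0 * a (t - 1)).
    { apply Rle_trans with (RInt (fun _ => 2 * b 0 * a (t - 1)) 0 1); [|rewrite Rint_const; lra].
      apply Rint_le; [auto|cts|lra|]. intros v hv. unfold w.
      assert (a (t + v) <= a (t - 1)) by (apply (density_decr a ha); rewrite !Rabs_pos_eq; lra).
      assert (a (t - v) <= a (t - 1)) by (apply (density_decr a ha); rewrite !Rabs_pos_eq; lra).
      assert (b v <= b 0) by now apply density_max.
      pose proof (density_pos b hb v). pose proof (density_pos a ha (t + v)).
      pose proof (density_pos a ha (t - v)).
      assert (a (t + v) * b v <= a (t - 1) * b 0) by (apply Rmult_le_compat; lra).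
      assert (a (t - v) * b v <= a (t - 1) * b 0) by (apply Rmult_le_compat; lra). lra. }
    assert (a (t - 1) * b 2 <= W2).
    { apply Rle_trans with (RInt w 1 2).
      - apply Rle_trans with (RInt (fun _ => a (t - 1) * b 2) 1 2); [rewrite Rint_const; lra|].
        apply Rint_le; [cts|auto|lra|]. intros v hv. unfold w.
        assert (a (t - 1) <= a (t - v)) by (apply (density_decr a ha); rewrite !Rabs_pos_eq; lra).
        assert (b 2 <= b v) by (apply (density_decr b hb); rewrite !Rabs_pos_eq; lra).
        assert (0 <= a (t + v) * b v) by (apply Rmult_le_pos; left; auto).
        assert (a (t - 1) * b 2 <= a (t - v) * b v) by (apply Rmult_le_compat; lra). lra.
      - apply RInt_box_mono; auto; lra. }
    apply Rle_trans with (2 * b 0 / b 2 * (a (t - 1) * b 2)).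
    - replace (2 * b 0 / b 2 * (a (t - 1) * b 2)) with (2 * b 0 * a (t - 1)) by (field; lra). auto.
    - apply Rmult_le_compat_l; auto. apply Rdiv_le_0_compat; lra. }
  assert (hW2 : 0 <= W2) by (apply Rint_ge0; auto; lra).
  assert (hW1 : 0 <= W1) by (apply Rint_ge0; auto; lra).
  set (q := 2 * b 0 / b 2) in *. assert (hq0 : 0 < q) by (apply Rdiv_lt_0_compat; lra).
  rewrite RInt_fold by cts. fold h.
  rewrite (Rint_chasles h 0 1 t) by auto.
  assert (hexp := exp_pos (d * t)).
  assert (h1 : RInt h 0 1 <= exp (d * t) * W1).
  { unfold W1. rewrite <- Rint_scal by auto. apply Rint_le; [auto|cts|lra|].
    intros v hv. apply hpt. lra. }
  assert (h2 : RInt h 1 t <= exp (d * t) * (1 - eta) * W2).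
  { unfold W2. rewrite <- Rint_scal by auto. apply Rint_le; [auto|cts|lra|].
    intros v hv. apply hpt; lra. }
  replace (d * ((1 - exp (- c)) / 4 / (1 + q))) with (eta / (1 + q)) by (unfold eta; field; lra).
  apply Rle_trans with (exp (d * t) * (W1 + (1 - eta) * W2)); [lra|].
  rewrite <- Rmult_assoc, (Rmult_comm _ (exp (d * t))), Rmult_assoc.
  apply Rmult_le_compat_l; [lra|].
  assert (hz : eta / (1 + q) * (W1 + W2) <= eta * W2).
  { unfold Rdiv. rewrite Rmult_assoc. apply Rmult_le_compat_l; [lra|].
    rewrite Rmult_comm. apply (Rle_div_l (W1 + W2)); lra. }
  assert (hz2 : eta / (1 + q) <= 1) by (apply (Rle_div_l eta); lra).
  apply Rle_trans with ((1 - eta / (1 + q)) * (W1 + W2)); [lra|].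
  apply Rmult_le_compat_l; lra.
Qed.

(** Outside (0, 2t) one has b(u - t) <= b(t), so that part is O(b(t)) and hence O(D(t)). Inside,
    cosh(du) <= 1/2 + exp(du)/2; the first term gives the constant 1/2, the second contracts by
    [fold_contract]. *)
Lemma joint_cosh_large a b c ca T d t : density a -> density b -> 0 < c -> 0 <= d <= 1 -> d <= c ->
  (forall t v, T <= t -> 0 <= v <= t -> a (t + v) <= exp (- (2 * c * v)) * a (t - v)) ->
  exp_tail a ca -> d < ca -> T <= t -> 2 <= t ->
  Int (fun u => cosh (d * u) * (a u * b (u - t))) <=
    ((1 - d * ((1 - exp (- c)) / 4 / (1 + 2 * b 0 / b 2))) * cosh (d * t) +
     (/ 2 + Int (fun u => a u * exp (d * Rabs u)) / a 1)) * marg a b t.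
Proof.
  intros ha hb hc hd hdc hst hta hda hT ht.
  assert (cca := density_cont a ha). assert (ccb := density_cont b hb).
  set (F := fun u => cosh (d * u) * (a u * b (u - t))).
  assert (cF : cont F).
  { pose proof (cosh_cont d). apply (cont_mult (fun u => cosh (d * u))); auto. cts. }
  assert (F0 : forall u, 0 <= F u).
  { intros u. apply Rmult_le_pos; [left; apply cosh_pos|apply Rmult_le_pos; left; auto]. }
  assert (sG := exp_weight_summable a ca d ha hta hda).
  set (S := Int (fun u => a u * exp (d * Rabs u))) in *.
  assert (G0 : forall u, 0 <= a u * exp (d * Rabs u)).
  { intros u. apply Rmult_le_pos; left; auto; apply exp_pos. }
  assert (hS : 0 <= S) by (apply Int_ge0; auto).
  set (lam := 1 - d * ((1 - exp (- c)) / 4 / (1 + 2 * b 0 / b 2))).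
  assert (hmid := fold_contract a b c T d t ha hb hc hd hdc hst hT ht). fold lam in hmid.
  assert (hD := marg_pos a b ha hb t). assert (hDb := marg_ge_shift a b t ha hb ltac:(lra)).
  assert (ha1 := density_pos a ha 1). assert (hbt := density_pos b hb t).
  (* The sign of [lam] is read off from [hmid], whose left side is an integral of a nonnegative
     function. *)
  assert (hlam : 0 <= lam).
  { assert (0 <= RInt (fun u => exp (d * u) * (a u * b (u - t))) 0 (2 * t)).
    { apply Rint_ge0; [cts|lra|]. intros u _. apply Rmult_le_pos; [left; apply exp_pos|apply Rmult_le_pos; left; auto]. }
    apply Rmult_le_reg_r with (exp (d * t) * marg a b t); [|lra].
    apply Rmult_lt_0_compat; auto; apply exp_pos. }
  assert (hbox : forall R0, 2 * t <= R0 -> RInt F (-R0) R0 <=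
     b t * S + (/ 2 * marg a b t + / 2 * (lam * (exp (d * t) * marg a b t)))).
  { intros R0 hR. rewrite (Rint_chasles F (-R0) 0 R0), (Rint_chasles F 0 (2 * t) R0) by auto.
    set (G := fun u => b t * (a u * exp (d * Rabs u))).
    assert (cG : cont G) by (unfold G; cts).
    assert (hout : forall u, t <= Rabs (u - t) -> F u <= G u).
    { intros u hu. unfold F, G.
      assert (b (u - t) <= b t) by (apply (density_decr b hb); rewrite (Rabs_pos_eq t); lra).
      apply Rle_trans with (b (u - t) * (a u * exp (d * Rabs u))).
      - rewrite <- Rmult_assoc, (Rmult_comm _ (b (u - t))).
        apply Rmult_le_compat_l; [left; auto|]. apply cosh_weight_le; [lra|left; auto].
      - apply Rmult_le_compat_r; auto. }
    assert (o1 : RInt F (-R0) 0 <= RInt G (-R0) 0).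
    { apply Rint_le; auto; [lra|]. intros u hu. apply hout. rewrite Rabs_left1; lra. }
    assert (o2 : RInt F (2 * t) R0 <= RInt G (2 * t) R0).
    { apply Rint_le; auto. intros u hu. apply hout. rewrite Rabs_pos_eq; lra. }
    assert (o3 : 0 <= RInt G 0 (2 * t)).
    { apply Rint_ge0; auto; [lra|]. intros u _. apply Rmult_le_pos; auto; lra. }
    assert (o4 : RInt G (-R0) R0 <= b t * S).
    { unfold S. rewrite <- Int_scal by auto. apply RInt_le_Int; [now apply summable_scal| |lra].
      intros u. apply Rmult_le_pos; auto; lra. }
    rewrite (Rint_chasles G (-R0) 0 R0), (Rint_chasles G 0 (2 * t) R0) in o4 by auto.
    assert (o5 : RInt F 0 (2 * t) <= RInt (fun u => / 2 * (a u * b (u - t)) +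
        / 2 * (exp (d * u) * (a u * b (u - t)))) 0 (2 * t)).
    { apply Rint_le; [auto|cts|lra|]. intros u hu. unfold F, cosh.
      assert (exp (- (d * u)) <= 1) by (rewrite <- exp_0; apply exp_le; nra).
      assert (0 <= a u * b (u - t)) by (apply Rmult_le_pos; left; auto). nra. }
    rewrite Rint_plus, !Rint_scal in o5 by cts.
    assert (o6 : RInt (fun u => a u * b (u - t)) 0 (2 * t) <= marg a b t).
    { apply RInt_le_Int; [now apply joint_summable| |lra]. intros; apply Rmult_le_pos; left; auto. }
    lra. }
  destruct (summable_bounded F (b t * S + (/ 2 * marg a b t + / 2 * (lam * (exp (d * t) * marg a b t)))))
    as [_ hI]; auto.
  { intros R0 hR. eapply Rle_trans; [|apply (hbox (R0 + 2 * t)); lra].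
    apply RInt_box_mono; auto; lra. }
  eapply Rle_trans; [exact hI|].
  assert (e1 : b t * S <= S / a 1 * marg a b t).
  { replace (b t * S) with (S / a 1 * (a 1 * b t)) by (field; lra).
    apply Rmult_le_compat_l; auto. apply Rdiv_le_0_compat; auto. }
  assert (e2 : exp (d * t) <= 2 * cosh (d * t)).
  { rewrite <- (Rabs_pos_eq (d * t)) at 1 by nra. apply cosh_exp_abs. }
  assert (e3 : lam * marg a b t * exp (d * t) <= lam * marg a b t * (2 * cosh (d * t))).
  { apply Rmult_le_compat_l; auto. apply Rmult_le_pos; lra. }
  lra.
Qed.

Lemma joint_cosh_uniform a b c d : density a -> density b -> exp_tail b c -> 0 <= d < c ->
  exists S, 0 <= S /\ forall t,
    Int (fun u => cosh (d * u) * (a u * b (u - t))) <= S * cosh (d * t).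
Proof.
  intros ha hb ht hd. destruct (exp_tail_weight b c d ht (proj2 hd)) as [C [hC h]].
  assert (sa := density_summable a ha). exists (C * Int a). split.
  { apply Rmult_le_pos; [lra|]. apply Int_ge0; auto. intros; left; auto. }
  intros t. replace (C * Int a * cosh (d * t)) with (C * cosh (d * t) * Int a) by ring.
  rewrite <- Int_scal by auto. apply Int_le; [now apply cosh_joint_summable with c|now apply summable_scal|].
  intros u. eapply Rle_trans; [apply cosh_joint_le; auto; lra|].
  pose proof (cosh_pos (d * t)). pose proof (density_pos a ha u).
  replace (C * cosh (d * t) * a u) with (cosh (d * t) * (a u * C)) by ring.
  do 2 (apply Rmult_le_compat_l; [lra|]). eapply Rle_trans; [apply h|].
  pose proof (cauchy_le1 (u - t)). nra.
Qed.

Lemma joint_cosh_even a b d t : density a -> density b ->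
  Int (fun u => cosh (d * u) * (a u * b (u - - t))) = Int (fun u => cosh (d * u) * (a u * b (u - t))).
Proof.
  intros ha hb. rewrite <- (Int_reflect (fun u => cosh (d * u) * (a u * b (u - t))) 0).
  apply Int_ext. intros u. replace (d * (0 - u)) with (- (d * u)) by ring. rewrite cosh_opp.
  rewrite Rminus_0_l, (density_even a u ha). replace (- u - t) with (- (u - - t)) by ring.
  now rewrite (density_even b _ hb).
Qed.

Lemma marg_even a b t : density a -> density b -> marg a b (- t) = marg a b t.
Proof.
  intros ha hb. unfold marg. rewrite <- (Int_reflect (fun u => a u * b (u - t)) 0).
  apply Int_ext. intros u. rewrite Rminus_0_l, (density_even a u ha).
  replace (- u - t) with (- (u - - t)) by ring. now rewrite (density_even b _ hb).
Qed.

Lemma cosh_unbounded d M : 0 < d -> exists R0, 0 <= R0 /\ forall t, R0 <= Rabs t -> M <= cosh (d * t).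
Proof.
  intros hd. exists (2 * Rabs M / d). pose proof (Rabs_pos M). pose proof (Rle_abs M). split.
  { apply Rdiv_le_0_compat; lra. }
  intros t ht. destruct (cosh_exp_abs (d * t)) as [_ h]. rewrite Rabs_mult, (Rabs_pos_eq d) in h by lra.
  pose proof (exp_ineq1_le (d * Rabs t)). apply (Rle_div_l (2 * Rabs M)) in ht; lra.
Qed.

Theorem light_geometric a b ca cb : density a -> density b ->
  0 < ca -> steep a ca -> exp_tail a ca -> 0 < cb -> exp_tail b cb ->
  geom_ergodic (pair_density a b).
Proof.
  intros ha hb hca hst hta hcb htb.
  destruct (mom_quadratic b cb hb hcb htb) as [Q [hQ hmom]].
  destruct hst as [T [hT hst]].
  assert (hb2 := density_pos b hb 2). assert (hb0 := density_pos b hb 0).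
  set (x := (1 - exp (- ca)) / 4 / (1 + 2 * b 0 / b 2)).
  assert (hc1 : exp (- ca) < 1) by (rewrite <- exp_0; apply exp_increasing; lra).
  assert (he0 := exp_pos (- ca)).
  assert (hq : 0 < 2 * b 0 / b 2) by (apply Rdiv_lt_0_compat; lra).
  assert (hx : 0 < x) by (apply Rdiv_lt_0_compat; lra).
  assert (hx1 : x <= 1) by (apply (Rle_div_l ((1 - exp (- ca)) / 4)); lra).
  (* d <= ca/2 keeps the weight integrable against [a], d <= cb/4 allows [mom_quadratic], and the
     last bound gives Q d^2 < d x, so that the gain wins. *)
  set (d := Rmin (Rmin 1 (ca / 2)) (Rmin (cb / 4) (x / (2 * (Q + 1))))).
  assert (hd0 : 0 < d).
  { repeat apply Rmin_glb_lt; try lra. apply Rdiv_lt_0_compat; lra. }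
  assert (hd1 : d <= 1) by (eapply Rle_trans; [apply Rmin_l|apply Rmin_l]).
  assert (hd2 : d <= ca / 2) by (eapply Rle_trans; [apply Rmin_l|apply Rmin_r]).
  assert (hd3 : d <= cb / 4) by (eapply Rle_trans; [apply Rmin_r|apply Rmin_l]).
  assert (hd4 : d * (2 * (Q + 1)) <= x).
  { apply Rle_div_r; [lra|]. eapply Rle_trans; [apply Rmin_r|apply Rmin_r]. }
  destruct (hmom d ltac:(lra)) as [hm0 hm1].
  set (g := (1 + Q * d ^ 2) * (1 - d * x)).
  assert (hg : 0 <= g < 1).
  { assert (0 <= Q * d ^ 2) by (apply Rmult_le_pos; auto; apply pow2_ge_0).
    assert (0 <= d * x <= 1) by nra.
    split; [apply Rmult_le_pos; lra|]. unfold g.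
    assert (Q * d ^ 2 < d * x); [|nra].
    replace (Q * d ^ 2) with (d * (Q * d)) by ring. apply Rmult_lt_compat_l; nra. }
  destruct (joint_cosh_uniform a b cb d ha hb htb ltac:(lra)) as [S [hS hSt]].
  set (T1 := Rmax T 2).
  assert (hT1 : T <= T1) by apply Rmax_l. assert (hT2 : 2 <= T1) by apply Rmax_r.
  assert (ha1 := density_pos a ha 1). assert (hbT := density_pos b hb (T1 + 1)).
  set (K1 := / 2 + Int (fun u => a u * exp (d * Rabs u)) / a 1).
  assert (hK1 : 0 <= K1).
  { apply Rplus_le_le_0_compat; [lra|]. apply Rdiv_le_0_compat; auto. apply Int_ge0.
    - apply exp_weight_summable with ca; auto; lra.
    - intros; apply Rmult_le_pos; left; auto; apply exp_pos. }
  (* Constant for |t| < [T1], where steepness says nothing: the numerator is crudely bounded and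
     [marg] is bounded below. *)
  set (K2 := S * exp (d * T1) / (2 * a 1 * b (T1 + 1))).
  assert (hden : 0 < 2 * a 1 * b (T1 + 1)) by (apply Rmult_lt_0_compat; lra).
  assert (hexp := exp_pos (d * T1)).
  assert (hK2 : 0 <= K2) by (apply Rdiv_le_0_compat; auto; apply Rmult_le_pos; lra).
  assert (hdx : 0 <= 1 - d * x) by nra.
  assert (hN : forall t, Int (fun u => cosh (d * u) * (a u * b (u - t))) <=
      ((1 - d * x) * cosh (d * t) + (K1 + K2)) * marg a b t).
  { assert (hbig : forall t, T1 <= t -> Int (fun u => cosh (d * u) * (a u * b (u - t))) <=
      ((1 - d * x) * cosh (d * t) + (K1 + K2)) * marg a b t).
    { intros t ht. eapply Rle_trans; [apply (joint_cosh_large a b ca ca T d t); auto; lra|].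
      fold x K1. pose proof (marg_pos a b ha hb t). apply Rmult_le_compat_r; lra. }
    intros t. destruct (Rle_or_lt T1 (Rabs t)) as [h|h].
    - unfold Rabs in h. destruct (Rcase_abs t); [|now apply hbig].
      specialize (hbig (- t) h). rewrite (joint_cosh_even a b d t ha hb), (marg_even a b t ha hb) in hbig.
      replace (d * - t) with (- (d * t)) in hbig by ring. now rewrite cosh_opp in hbig.
    - assert (hD : 2 * a 1 * b (T1 + 1) <= marg a b t).
      { eapply Rle_trans; [|now apply marg_lower]. apply Rmult_le_compat_l; [lra|].
        apply (density_decr b hb). pose proof (Rabs_pos t).
        rewrite (Rabs_pos_eq (T1 + 1)), (Rabs_pos_eq (Rabs t + 1)); lra. }
      eapply Rle_trans; [apply hSt|].
      apply Rle_trans with (K2 * marg a b t).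
      + apply Rle_trans with (K2 * (2 * a 1 * b (T1 + 1))); [|now apply Rmult_le_compat_l].
        unfold K2. replace (S * exp (d * T1) / (2 * a 1 * b (T1 + 1)) * (2 * a 1 * b (T1 + 1)))
          with (S * exp (d * T1)) by (field; split; lra).
        apply Rmult_le_compat_l; auto. eapply Rle_trans; [apply cosh_exp_abs|].
        apply exp_le. rewrite Rabs_mult, (Rabs_pos_eq d) by lra. nra.
      + pose proof (cosh_pos (d * t)).
        apply Rmult_le_compat_r; [lra|]. assert (0 <= (1 - d * x) * cosh (d * t)) by nra. lra. }
  set (K := (1 + Q * d ^ 2) * (K1 + K2) + 1).
  assert (hQd : 0 <= Q * d ^ 2) by (apply Rmult_le_pos; auto; apply pow2_ge_0).
  assert (hK : 0 < K).
  { assert (0 <= (1 + Q * d ^ 2) * (K1 + K2)) by (apply Rmult_le_pos; lra). unfold K; lra. }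
  apply (geometric_criterion a b ha hb (fun t => cosh (d * t)) g K); auto.
  - apply cosh_cont.
  - intros; left; apply cosh_pos.
  - intros M. now apply cosh_unbounded.
  - apply cosh_weight_summable with cb; auto; lra.
  (* As |t| <= |u| + |u - t|, the exponential weight distributes over the two factors of the
     convolution. *)
  - destruct (conv_bound (fun x => a x * exp (d * Rabs x)) (fun x => b x * exp (d * Rabs x)))
      as [C hC]; auto using exp_weight_cont.
    { intros; apply Rmult_le_pos; left; auto; apply exp_pos. }
    { intros; apply Rmult_le_pos; left; auto; apply exp_pos. }
    { apply exp_tail_envelope with ca; auto; lra. }
    { apply exp_tail_envelope with cb; auto; lra. }
    apply summable_envelope.
    { apply (cont_mult (fun t => cosh (d * t))); [apply cosh_cont|now apply marg_cont]. }
    exists C. intros t. assert (hD := marg_pos a b ha hb t). assert (hc := cosh_pos (d * t)).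
    rewrite Rabs_pos_eq by nra. eapply Rle_trans; [|apply hC].
    unfold marg. rewrite <- Int_scal by now apply joint_summable.
    apply Int_le.
    + now apply summable_scal, joint_summable.
    + apply (conv_summable (fun x => a x * exp (d * Rabs x)) (fun x => b x * exp (d * Rabs x)));
        auto using exp_weight_cont.
      * apply exp_tail_envelope with ca; auto; lra.
      * apply exp_tail_envelope with cb; auto; lra.
    + intros u. replace (a u * exp (d * Rabs u) * (b (u - t) * exp (d * Rabs (u - t))))
        with (exp (d * Rabs u) * exp (d * Rabs (u - t)) * (a u * b (u - t))) by ring.
      apply Rmult_le_compat_r; [apply Rmult_le_pos; left; auto|].
      eapply Rle_trans; [apply cosh_exp_abs|]. rewrite <- exp_plus. apply exp_le.
      rewrite Rabs_mult, (Rabs_pos_eq d), <- Rmult_plus_distr_l by lra.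
      apply Rmult_le_compat_l; [lra|]. replace t with (u + - (u - t)) at 1 by ring.
      eapply Rle_trans; [apply Rabs_triang|]. rewrite Rabs_Ropp. lra.
  - intros t. destruct (ker_cosh_le a b cb d t ha hb htb ltac:(lra)) as [h1 h2]. split; auto.
    eapply Rle_trans; [exact h2|]. assert (hD := marg_pos a b ha hb t).
    apply (Rle_div_l _ _ (marg a b t)); auto.
    assert (hI : 0 <= Int (fun u => cosh (d * u) * (a u * b (u - t)))).
    { apply Int_ge0; [apply cosh_joint_summable with cb; auto; lra|].
      intros; apply Rmult_le_pos; [left; apply cosh_pos|apply Rmult_le_pos; left; auto]. }
    apply Rle_trans with ((1 + Q * d ^ 2) * (((1 - d * x) * cosh (d * t) + (K1 + K2)) * marg a b t)).
    + apply Rmult_le_compat; auto.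
    + rewrite <- Rmult_assoc. apply Rmult_le_compat_r; [lra|]. unfold g, K. lra.
Qed.

(** * Failure of geometric ergodicity *)

(** The mirror image of [marg_lower]: keeping u within 1 of t lets a heavy tail of [a] pass to the
    marginal. *)
Lemma marg_lower_prior a b t : density a -> density b -> 2 * b 1 * a (Rabs t + 1) <= marg a b t.
Proof.
  intros ha hb. assert (cont a) by auto. assert (cont b) by auto.
  apply Rle_trans with (RInt (fun _ => b 1 * a (Rabs t + 1)) (t - 1) (t + 1)).
  { rewrite Rint_const. lra. }
  apply Rle_trans with (RInt (fun u => a u * b (u - t)) (t - 1) (t + 1)).
  - apply Rint_le; [cts|cts|lra|]. intros u hu. rewrite (Rmult_comm (b 1)).
    assert (hut : Rabs (u - t) <= 1) by (apply Rabs_le; lra).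
    apply Rmult_le_compat; try (left; auto; fail).
    + apply (density_decr a ha). pose proof (Rabs_pos t). rewrite (Rabs_pos_eq (_ + _)) by lra.
      replace u with (t + (u - t)) by ring. eapply Rle_trans; [apply Rabs_triang|]. lra.
    + apply (density_decr b hb). rewrite (Rabs_pos_eq 1); lra.
  - apply RInt_le_Int; [now apply joint_summable| |lra]. intros; apply Rmult_le_pos; left; auto.
Qed.

Lemma cauchyd_succ t : cauchyd t <= 4 * cauchyd (Rabs t + 1).
Proof.
  unfold cauchyd. rewrite <- (pow2_abs t). set (x := Rabs t). assert (0 <= x) by apply Rabs_pos.
  replace (4 * / (1 + (x + 1) ^ 2)) with (/ ((1 + (x + 1) ^ 2) / 4)) by (field; nra).
  apply Rinv_le_contravar; nra.
Qed.

(** For rho < sg < 1, Bernoulli's inequality for 1/sg bounds n sg^n by sg / (1 - sg), and (rho /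
    sg)^n tends to 0. *)
Lemma pow_linear_small rho eps : 0 <= rho < 1 -> 0 < eps -> exists n : nat, INR (S n) * rho ^ S n < eps.
Proof.
  intros hr he. set (sg := (1 + rho) / 2). assert (hs : rho < sg < 1) by (unfold sg; lra).
  set (k := sg / (1 - sg)).
  assert (hk : forall n, INR n * sg ^ n <= k * 1).
  { intros n. assert (hsp : 0 < sg ^ n) by (apply pow_lt; lra).
    destruct n as [|n]; [simpl; rewrite Rmult_0_l; apply Rmult_le_pos; [apply Rdiv_le_0_compat; lra|lra]|].
    assert (h := poly (S n) (/ sg - 1)).
    assert (hi : 1 < / sg) by (rewrite <- Rinv_1; apply Rinv_lt_contravar; lra).
    assert (h' : 1 + INR (S n) * (/ sg - 1) <= / sg ^ S n).
    { rewrite <- pow_inv. replace (/ sg) with (1 + (/ sg - 1)) at 2 by ring. apply h. lra. }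
    apply Rmult_le_compat_r with (r := sg ^ S n) in h'; [|lra].
    rewrite Rinv_l in h' by lra.
    unfold k. rewrite Rmult_1_r. apply (Rle_div_r (INR (S n) * sg ^ S n)); [lra|].
    replace (INR (S n) * sg ^ S n * (1 - sg)) with (sg * (INR (S n) * (/ sg - 1) * sg ^ S n)) by (field; lra).
    rewrite <- (Rmult_1_r sg) at 4. apply Rmult_le_compat_l; [lra|]. lra. }
  assert (hk0 : 0 < k) by (apply Rdiv_lt_0_compat; lra).
  assert (hq : 0 <= rho / sg < 1).
  { split; [apply Rdiv_le_0_compat; lra|]. apply (Rlt_div_l rho); lra. }
  destruct (pow_lt_1_zero (rho / sg)) with (y := eps / k) as [N hN].
  { rewrite Rabs_pos_eq; lra. }
  { apply Rdiv_lt_0_compat; lra. }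
  exists N. specialize (hN (S N) ltac:(lia)). specialize (hk (S N)).
  rewrite Rabs_pos_eq in hN by (apply pow_le; lra).
  replace rho with (sg * (rho / sg)) at 1 by (field; lra). rewrite Rpow_mult_distr, <- Rmult_assoc.
  apply Rle_lt_trans with (k * (rho / sg) ^ S N).
  - apply Rmult_le_compat_r; [apply pow_le; lra|lra].
  - apply Rmult_lt_compat_l with (r := k) in hN; auto.
    replace (k * (eps / k)) with eps in hN by (field; lra). exact hN.
Qed.

Lemma exp_INR_mult n x : exp (INR n * x) = exp x ^ n.
Proof.
  induction n as [|n IH]; [simpl; rewrite Rmult_0_l; apply exp_0|].
  rewrite S_INR, Rmult_plus_distr_r, exp_plus, IH, Rmult_1_l. simpl. ring.
Qed.

(** The exponential moment of u - t under q_t is bounded uniformly in t, since its numerator and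
    D(t) both have exactly Cauchy decay. So the cosh moment grows at most by the factor [L] per
    step. *)
Theorem heavy_not_geometric a b cb : density a -> density b ->
  (exists c, 0 < c /\ forall x, c * cauchyd x <= a x) -> 0 < cb -> exp_tail b cb ->
  ~ geom_ergodic (pair_density a b).
Proof.
  intros ha hb [c0 [hc0 hlow]] hcb ht [r [hr [M hM]]].
  set (d := cb / 2). assert (hd : 0 < d < cb) by (unfold d; lra).
  destruct (conv_bound a (fun x => b x * exp (d * Rabs x))) as [C hC];
    auto using exp_weight_cont, density_envelope.
  { intros; left; auto. }
  { intros; apply Rmult_le_pos; left; auto; apply exp_pos. }
  { apply exp_tail_envelope with cb; auto; lra. }
  assert (hb1 := density_pos b hb 1).
  set (c1 := b 1 * c0 / 2). assert (hc1 : 0 < c1) by (unfold c1; nra).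
  assert (hD : forall t, c1 * cauchyd t <= marg a b t).
  { intros t. eapply Rle_trans; [|now apply marg_lower_prior].
    specialize (hlow (Rabs t + 1)). pose proof (cauchyd_succ t).
    apply Rle_trans with (2 * b 1 * (c0 * cauchyd (Rabs t + 1))); [|apply Rmult_le_compat_l; lra].
    unfold c1. assert (b 1 * c0 / 2 * cauchyd t <= b 1 * c0 / 2 * (4 * cauchyd (Rabs t + 1))); [|lra].
    apply Rmult_le_compat_l; nra. }
  set (L := mom b d * (Rabs C / c1) + 1).
  assert (hmom : 0 <= mom b d).
  { apply Rdiv_le_0_compat; [|now apply mass_pos]. apply Int_ge0.
    - apply cosh_weight_summable with cb; auto; lra.
    - intros; apply Rmult_le_pos; left; auto; apply cosh_pos. }
  assert (hCc : 0 <= Rabs C / c1) by (apply Rdiv_le_0_compat; auto; apply Rabs_pos).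
  assert (hL : 1 <= L) by (unfold L; nra).
  assert (hV : forall t, summable (fun t' => cosh (d * t') * ker a b t t') /\
     Int (fun t' => cosh (d * t') * ker a b t t') <= L * cosh (d * t)).
  { intros t. destruct (ker_cosh_le a b cb d t ha hb ht ltac:(lra)) as [h1 h2]. split; auto.
    eapply Rle_trans; [exact h2|]. assert (hm := marg_pos a b ha hb t). specialize (hD t).
    assert (hcc := cosh_pos (d * t)).
    apply (Rle_div_l _ _ (marg a b t)); auto.
    assert (hN : Int (fun u => cosh (d * u) * (a u * b (u - t))) <= cosh (d * t) * (C * cauchyd t)).
    { assert (hsc : summable (fun u => a u * (b (u - t) * exp (d * Rabs (u - t))))).
      { apply (conv_summable a (fun x => b x * exp (d * Rabs x))); auto using exp_weight_cont, density_envelope.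
        apply exp_tail_envelope with cb; auto; lra. }
      apply Rle_trans with (cosh (d * t) * Int (fun u => a u * (b (u - t) * exp (d * Rabs (u - t))))).
      - rewrite <- Int_scal by auto. apply Int_le.
        + apply cosh_joint_summable with cb; auto; lra.
        + now apply summable_scal.
        + intros u. apply cosh_joint_le; auto; lra.
      - apply Rmult_le_compat_l; [lra|apply hC]. }
    assert (hCm : C * cauchyd t <= Rabs C / c1 * marg a b t).
    { pose proof (cauchy_pos t). apply Rle_trans with (Rabs C * cauchyd t).
      - apply Rmult_le_compat_r; [lra|apply Rle_abs].
      - replace (Rabs C * cauchyd t) with (Rabs C / c1 * (c1 * cauchyd t)) by (field; lra).
        now apply Rmult_le_compat_l. }
    apply Rle_trans with (mom b d * (cosh (d * t) * (Rabs C / c1 * marg a b t))).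
    - apply Rmult_le_compat_l; auto. eapply Rle_trans; [exact hN|]. apply Rmult_le_compat_l; lra.
    - unfold L. assert (0 <= cosh (d * t) * marg a b t) by nra. lra. }
  (* The speed [A] makes exp(-d A) beat the growth [L] by a factor 2, because exp(d A) >= 1 + d
     A. *)
  set (A := Rmax 1 (2 * L / d)).
  assert (hA1 : 1 <= A) by apply Rmax_l.
  assert (hA2 : 2 * L <= d * A).
  { rewrite (Rmult_comm d A). apply (Rle_div_l (2 * L) A d); [lra|apply Rmax_r]. }
  assert (hAL : exp (- (d * A)) * L <= / 2).
  { rewrite exp_Ropp. pose proof (exp_pos (d * A)). pose proof (exp_ineq1_le (d * A)).
    apply Rmult_le_reg_l with (exp (d * A)); auto. rewrite <- Rmult_assoc, Rinv_r by lra. lra. }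
  assert (hZ := marg_total_pos a b ha hb). set (Z := Int (marg a b)) in *.
  (* The 5 comes from 1 + (2 R0)^2 <= 5 R0^2, valid for R0 >= 1. *)
  set (c2 := c1 / Z / (5 * A)).
  assert (hc2 : 0 < c2) by (apply Rdiv_lt_0_compat; [now apply Rdiv_lt_0_compat|lra]).
  set (rho := Rmax (/ 2) r). assert (h1r : / 2 <= rho) by apply Rmax_l.
  assert (h2r : r <= rho) by apply Rmax_r. assert (h3r : rho < 1) by (apply Rmax_lub_lt; lra).
  (* The 2 accounts for the mass left to the chain, 2 |M 0| for the factor 1/2 in [tv]. *)
  set (M' := 2 + 2 * Rabs (M 0)). assert (hM' : 2 <= M') by (unfold M'; pose proof (Rabs_pos (M 0)); lra).
  destruct (pow_linear_small rho (c2 / M')) as [n hn]; [lra|apply Rdiv_lt_0_compat; lra|].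
  assert (hSn : 1 <= INR (S n)) by (rewrite S_INR; pose proof (pos_INR n); lra).
  set (R0 := A * INR (S n)). assert (hR : 1 <= R0) by (unfold R0; nra).
  destruct (law_prob a b ha hb 0 n) as [p1 [p2 p3]].
  set (law := lawS (pair_density a b) 0 n) in *.
  assert (sp := post_summable a b ha hb).
  assert (cl := summable_cont _ p1). assert (cp := summable_cont _ sp).
  destruct (law_weight_le a b ha hb (fun t => cosh (d * t)) L 0 n) as [l1 l2]; auto.
  { apply cosh_cont. }
  { intros; left; apply cosh_pos. }
  { lra. }
  fold law in l1, l2. rewrite Rmult_0_r, cosh_0, Rmult_1_r in l2.
  (* Markov's inequality, with cosh(d t) >= exp(d R0) / 2 on [R0, 2 R0]. *)
  assert (e1 : RInt law R0 (2 * R0) <= 2 * (/ 2) ^ S n).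
  { assert (h : RInt (fun t => exp (d * R0) / 2 * law t) R0 (2 * R0) <= L ^ S n).
    { eapply Rle_trans; [|exact l2]. eapply Rle_trans; [|apply RInt_le_Int with (a := R0) (b := 2 * R0); auto; try lra].
      - pose proof (cosh_cont d). apply Rint_le; [cts|auto|lra|]. intros t htt.
        apply Rmult_le_compat_r; auto. destruct (cosh_exp_abs (d * t)) as [_ h].
        assert (exp (d * R0) <= exp (Rabs (d * t))); [|lra].
        apply exp_le. rewrite Rabs_pos_eq; nra.
      - intros t. apply Rmult_le_pos; auto. left; apply cosh_pos. }
    rewrite Rint_scal in h by auto. pose proof (exp_pos (d * R0)) as hp.
    assert (E : exp (- (d * R0)) = exp (- (d * A)) ^ S n).
    { unfold R0. rewrite <- exp_INR_mult. f_equal. ring. }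
    assert (h2 : exp (- (d * R0)) * L ^ S n <= (/ 2) ^ S n).
    { rewrite E, <- Rpow_mult_distr. apply pow_incr. split; auto.
      apply Rmult_le_pos; [left; apply exp_pos|lra]. }
    revert h. generalize (RInt law R0 (2 * R0) : R). intros J h.
    rewrite exp_Ropp in h2.
    apply Rmult_le_compat_l with (r := 2 * / exp (d * R0)) in h.
    2:{ left. apply Rmult_lt_0_compat; [lra|now apply Rinv_0_lt_compat]. }
    replace (2 * / exp (d * R0) * (exp (d * R0) / 2 * J)) with J in h by (field; lra). lra. }
  assert (e2 : c2 / INR (S n) <= RInt (post a b) R0 (2 * R0)).
  { apply Rle_trans with (RInt (fun _ => c1 / Z * cauchyd (2 * R0)) R0 (2 * R0)).
    - rewrite Rint_const. unfold c2.
      replace (c1 / Z / (5 * A) / INR (S n)) with (c1 / Z * / (5 * R0)) by (unfold R0; field; repeat split; lra).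
      replace ((2 * R0 - R0) * (c1 / Z * cauchyd (2 * R0))) with (c1 / Z * (R0 * cauchyd (2 * R0))) by ring.
      apply Rmult_le_compat_l; [left; apply Rdiv_lt_0_compat; lra|].
      unfold cauchyd. apply (Rle_div_r (/ (5 * R0))); [nra|].
      rewrite Rmult_comm. apply (Rle_div_l (1 + (2 * R0) ^ 2)); nra.
    - apply Rint_le; [cts|auto|lra|]. intros t htt. unfold post. fold Z.
      replace (c1 / Z * cauchyd (2 * R0)) with (c1 * cauchyd (2 * R0) / Z) by (field; lra).
      apply Rmult_le_compat_r; [left; now apply Rinv_0_lt_compat|].
      eapply Rle_trans; [|apply hD]. apply Rmult_le_compat_l; [lra|].
      unfold cauchyd. apply Rinv_le_contravar; nra. }
  assert (e3 : RInt (fun t => post a b t + (-1) * law t) R0 (2 * R0) <= 2 * tv (pair_density a b) 0 n).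
  { assert (sm : summable (fun t => law t - post a b t)) by now apply summable_minus.
    assert (sa : summable (fun t => Rabs (law t - post a b t))).
    { apply (summable_abs (fun t => law t - post a b t) (fun t => law t + post a b t)); auto.
      - now apply summable_plus.
      - intros t. specialize (p3 t). pose proof (post_pos a b ha hb t). apply Rabs_le; lra. }
    unfold tv. rewrite <- Rmult_assoc, Rinv_r, Rmult_1_l by lra.
    eapply Rle_trans; [|apply RInt_le_Int with (a := R0) (b := 2 * R0); auto; try lra].
    - apply Rint_le; [cts|cts|lra|]. intros t _.
      pose proof (Rle_abs (- (law t - post a b t))) as hq. rewrite Rabs_Ropp in hq. change (posterior (pair_density a b) t) with (post a b t).
      fold law. lra.
    - intros t. apply Rabs_pos. }
  rewrite Rint_plus, Rint_scal in e3 by cts. specialize (hM 0 n).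
  assert (e4 : M 0 * r ^ S n <= Rabs (M 0) * rho ^ S n).
  { apply Rle_trans with (Rabs (M 0) * r ^ S n).
    - apply Rmult_le_compat_r; [apply pow_le; lra|apply Rle_abs].
    - apply Rmult_le_compat_l; [apply Rabs_pos|]. apply pow_incr; lra. }
  assert (e5 : (/ 2) ^ S n <= rho ^ S n) by (apply pow_incr; lra).
  assert (e6 : c2 / INR (S n) <= M' * rho ^ S n) by (unfold M'; lra).
  apply (Rle_div_l c2) in e6; [|lra].
  apply Rmult_lt_compat_l with (r := M') in hn; [|lra].
  replace (M' * (c2 / M')) with c2 in hn by (field; lra). lra.
Qed.

(** * Reduction to a single kernel *)

Section Transport.

Variables (p q : R -> R -> R) (y : R).

Lemma tv_shift : (forall u t, p u t = q (u - y) (t - y)) -> forall t0 n, tv p t0 n = tv q (t0 - y) n.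
Proof.
  intros h. replace p with (fun u t => q (u - y) (t - y)).
  2:{ apply functional_extensionality; intros u; apply functional_extensionality; auto. }
  clear h.
  assert (hk : forall t t', kernel (fun u t => q (u - y) (t - y)) t t' = kernel q (t - y) (t' - y)).
  { intros t t'. unfold kernel. rewrite <- (Int_shift (fun u => condU q (t - y) u * condT q u (t' - y)) y).
    apply Int_ext. intros u. unfold condU, condT.
    rewrite (Int_shift (fun u => q u (t - y)) y), (Int_shift (fun t => q (u - y) t) y). reflexivity. }
  assert (hl : forall t0 n t, lawS (fun u t => q (u - y) (t - y)) t0 n t = lawS q (t0 - y) n (t - y)).
  { intros t0. induction n as [|n IH]; intros t; simpl; [apply hk|].
    rewrite <- (Int_shift (fun s => lawS q (t0 - y) n s * kernel q s (t - y)) y).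
    apply Int_ext. intros s. now rewrite IH, hk. }
  assert (hp : forall t, posterior (fun u t => q (u - y) (t - y)) t = posterior q (t - y)).
  { intros t. unfold posterior. rewrite (Int_shift (fun u => q u (t - y)) y). f_equal.
    rewrite <- (Int_shift (fun t' => Int (fun u => q u t')) y). apply Int_ext. intros s.
    apply (Int_shift (fun u => q u (s - y)) y). }
  intros t0 n. unfold tv. f_equal.
  rewrite <- (Int_shift (fun t => Rabs (lawS q (t0 - y) n t - posterior q t)) y).
  apply Int_ext. intros t. now rewrite hl, hp.
Qed.

(** The auxiliary variable is integrated out of both the kernel and the posterior, so a change of
    variable in it alone leaves the chain untouched, including its starting point. *)
Lemma tv_reflect : (forall u t, p u t = q (y - u) t) -> forall t0 n, tv p t0 n = tv q t0 n.
Proof.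
  intros h. replace p with (fun u t => q (y - u) t).
  2:{ apply functional_extensionality; intros u; apply functional_extensionality; auto. }
  clear h.
  assert (hm : forall t, Int (fun u => q (y - u) t) = Int (fun u => q u t)).
  { intros t. apply (Int_reflect (fun u => q u t)). }
  assert (hk : kernel (fun u t => q (y - u) t) = kernel q).
  { apply functional_extensionality; intros t. apply functional_extensionality; intros t'.
    unfold kernel. rewrite <- (Int_reflect (fun u => condU q t u * condT q u t') y).
    apply Int_ext. intros u. unfold condU, condT. now rewrite hm. }
  assert (hl : forall t0 n, lawS (fun u t => q (y - u) t) t0 n = lawS q t0 n).
  { intros t0. induction n as [|n IH]; simpl; rewrite hk; [reflexivity|]. now rewrite IH. }
  intros t0 n. unfold tv. f_equal. apply Int_ext. intros t. rewrite hl. unfold posterior.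
  rewrite hm. now rewrite (Int_ext _ _ hm).
Qed.

End Transport.

Lemma tv_centred f1 s1 f2 s2 y t0 n : 0 < s1 -> fam_ok f1 ->
  tv (joint Centred f1 s1 f2 s2 y) t0 n = tv (pair_density (gdens f1 s1) (gdens f2 s2)) (t0 - y) n.
Proof.
  intros hs hf. apply tv_shift. intros u t. unfold joint, pair_density.
  rewrite (density_sym _ y u (gdens_density f1 s1 hs hf)). do 2 f_equal. ring.
Qed.

Lemma tv_noncentred f1 s1 f2 s2 y t0 n :
  tv (joint NonCentred f1 s1 f2 s2 y) t0 n = tv (joint Centred f2 s2 f1 s1 y) t0 n.
Proof.
  apply tv_reflect with y. intros u t. unfold joint.
  replace (y - (y - u)) with u by ring. replace (y - u - t) with (y - t - u) by ring. ring.
Qed.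

Lemma geom_centred f1 s1 f2 s2 y : 0 < s1 -> fam_ok f1 ->
  geom_ergodic (joint Centred f1 s1 f2 s2 y) <->
  geom_ergodic (pair_density (gdens f1 s1) (gdens f2 s2)).
Proof.
  intros hs hf. split; intros [r [hr [M h]]]; exists r; split; auto.
  - exists (fun t => M (t + y)). intros t0 n. rewrite <- h, tv_centred by auto.
    right. f_equal. ring.
  - exists (fun t => M (t - y)). intros t0 n. now rewrite tv_centred.
Qed.

Lemma unif_centred f1 s1 f2 s2 y : 0 < s1 -> fam_ok f1 ->
  unif_ergodic (pair_density (gdens f1 s1) (gdens f2 s2)) ->
  unif_ergodic (joint Centred f1 s1 f2 s2 y).
Proof.
  intros hs hf [r [hr [M h]]]; exists r; split; auto. exists M. intros t0 n.
  now rewrite tv_centred.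
Qed.

Lemma geom_noncentred f1 s1 f2 s2 y :
  geom_ergodic (joint NonCentred f1 s1 f2 s2 y) <-> geom_ergodic (joint Centred f2 s2 f1 s1 y).
Proof.
  split; intros [r [hr [M h]]]; exists r; split; auto; exists M; intros t0 n;
    specialize (h t0 n); now rewrite tv_noncentred in *.
Qed.

Lemma unif_noncentred f1 s1 f2 s2 y :
  unif_ergodic (joint Centred f2 s2 f1 s1 y) -> unif_ergodic (joint NonCentred f1 s1 f2 s2 y).
Proof.
  intros [r [hr [M h]]]; exists r; split; auto; exists M; intros t0 n.
  now rewrite tv_noncentred.
Qed.

(** * The sixteen cases *)

(** All four families have Cauchy envelopes, hence so does [marg], and Cauchy densities at |t| and
    |t| + 1 are comparable. *)
Lemma centred_cauchy_unif f1 s1 s2 y : 0 < s1 -> 0 < s2 -> fam_ok f1 ->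
  unif_ergodic (joint Centred f1 s1 FC s2 y).
Proof.
  intros h1 h2 hf. apply unif_centred; auto.
  assert (ha := gdens_density f1 s1 h1 hf). assert (hb := gdens_density FC s2 h2 I).
  apply uniform_criterion; auto. destruct (marg_upper _ _ ha hb) as [C hC].
  destruct (gdens_cauchy_bounds s2 h2) as [c [C' [hc [hC' hbd]]]].
  exists (Rabs C * 4 / c). intros t. eapply Rle_trans; [apply hC|].
  destruct (hbd (Rabs t + 1)) as [hlow _]. pose proof (cauchyd_succ t). pose proof (cauchy_pos t).
  pose proof (Rle_abs C). pose proof (Rabs_pos C).
  apply Rle_trans with (Rabs C * 4 / c * (c * cauchyd (Rabs t + 1))).
  - replace (Rabs C * 4 / c * (c * cauchyd (Rabs t + 1))) with (Rabs C * (4 * cauchyd (Rabs t + 1)))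
      by (field; lra).
    apply Rle_trans with (Rabs C * cauchyd t); [apply Rmult_le_compat_r; lra|].
    now apply Rmult_le_compat_l.
  - apply Rmult_le_compat_l; auto. apply Rdiv_le_0_compat; lra.
Qed.

(** exp(-|u - t|/s2) <= exp(-|t|/s2) exp(|u|/s2), and the last factor is integrable against g1
    because its rate exceeds 1/s2. For two exponentials this is where the strict inequality of
    scales enters. The factor exp(1/s2) turns |t| into |t| + 1. *)
Lemma centred_exponential_unif f1 s1 s2 y c : 0 < s1 -> 0 < s2 -> fam_ok f1 ->
  exp_tail (gdens f1 s1) c -> / s2 < c -> unif_ergodic (joint Centred f1 s1 FE s2 y).
Proof.
  intros h1 h2 hf ht hc. apply unif_centred; auto.
  assert (ha := gdens_density f1 s1 h1 hf). assert (hb := gdens_density FE s2 h2 I).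
  apply uniform_criterion; auto.
  assert (hs := exp_weight_summable _ c (/ s2) ha ht hc).
  exists (exp (/ s2) * Int (fun u => gdens f1 s1 u * exp (/ s2 * Rabs u))). intros t.
  replace (exp (/ s2) * Int (fun u => gdens f1 s1 u * exp (/ s2 * Rabs u)) * gdens FE s2 (Rabs t + 1))
    with (exp (- (Rabs t / s2)) * Int (fun u => gdens f1 s1 u * exp (/ s2 * Rabs u))).
  2:{ simpl gdens. pose proof (Rabs_pos t). rewrite (Rabs_pos_eq (Rabs t + 1)) by lra.
      replace (- (Rabs t / s2)) with (/ s2 + - ((Rabs t + 1) / s2)) by (field; lra).
      rewrite exp_plus. ring. }
  unfold marg. rewrite <- Int_scal by auto.
  apply Int_le; [now apply joint_summable|now apply summable_scal|]. intros u.
  rewrite <- Rmult_assoc, (Rmult_comm _ (gdens f1 s1 u)), Rmult_assoc.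
  apply Rmult_le_compat_l; [left; apply gdens_pos|]. simpl gdens. rewrite <- exp_plus.
  apply exp_le. assert (h : Rabs t <= Rabs u + Rabs (u - t)).
  { replace t with (u + - (u - t)) at 1 by ring. eapply Rle_trans; [apply Rabs_triang|].
    rewrite Rabs_Ropp. lra. }
  assert (0 < / s2) by now apply Rinv_0_lt_compat. unfold Rdiv. nra.
Qed.

Lemma centred_light_geom f1 s1 f2 s2 y : 0 < s1 -> 0 < s2 -> fam_ok f1 -> fam_ok f2 ->
  light f1 -> light f2 -> geom_ergodic (joint Centred f1 s1 f2 s2 y).
Proof.
  intros h1 h2 hf1 hf2 l1 l2. apply geom_centred; auto.
  destruct (steep_light f1 s1 h1 hf1 l1) as [c1 [hc1 st1]].
  destruct (steep_light f2 s2 h2 hf2 l2) as [c2 [hc2 st2]].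
  apply light_geometric with c1 c2; auto using gdens_density; apply gdens_exp_tail; auto; lra.
Qed.

Lemma centred_cauchy_not_geom s1 f2 s2 y : 0 < s1 -> 0 < s2 -> fam_ok f2 -> light f2 ->
  ~ geom_ergodic (joint Centred FC s1 f2 s2 y).
Proof.
  intros h1 h2 hf l. rewrite geom_centred; simpl; auto.
  destruct (steep_light f2 s2 h2 hf l) as [c [hc st]].
  destruct (gdens_cauchy_bounds s1 h1) as [k [K [hk [_ hbd]]]].
  apply heavy_not_geometric with c; auto.
  - now apply gdens_density.
  - now apply gdens_density.
  - exists k; split; auto. apply hbd.
  - apply gdens_exp_tail; auto; lra.
Qed.

Lemma centred_lighter_unif f1 s1 s2 y : 0 < s1 -> 0 < s2 -> fam_ok f1 -> lighter f1 ->
  unif_ergodic (joint Centred f1 s1 FE s2 y).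
Proof.
  intros h1 h2 hf l. assert (0 < / s2) by now apply Rinv_0_lt_compat.
  apply centred_exponential_unif with (/ s2 + 1); auto; [|lra].
  apply gdens_exp_tail; auto; [lra|now apply steep_lighter].
Qed.

Lemma centred_exponentials_unif s1 s2 y : 0 < s1 -> 0 < s2 -> s2 > s1 ->
  unif_ergodic (joint Centred FE s1 FE s2 y).
Proof.
  intros h1 h2 h. apply centred_exponential_unif with (/ s1); simpl; auto.
  - apply gdens_exp_tail; simpl; auto; [left; now apply Rinv_0_lt_compat|now apply steep_exponential].
  - apply Rinv_lt_contravar; auto. now apply Rmult_lt_0_compat.
Qed.

Lemma light_families f : isE f \/ isG f \/ isL f -> light f.
Proof. intros [-> | [-> | [b ->]]]; discriminate. Qed.

Lemma lighter_families f : isG f \/ isL f -> lighter f.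
Proof. intros [-> | [b ->]]; split; discriminate. Qed.

Lemma lighter_light f : lighter f -> light f.
Proof. intros [h _]; exact h. Qed.

Theorem mainTheorem7 (f1 f2 : fam) (s1 s2 y : R) :
  0 < s1 -> 0 < s2 -> fam_ok f1 -> fam_ok f2 ->
  (* centred parametrisation P0 = (X, Theta) *)
  ( (isC f2 -> unif_ergodic (joint Centred f1 s1 f2 s2 y)) /\
    (isE f2 ->
       (isC f1 -> ~ geom_ergodic (joint Centred f1 s1 f2 s2 y)) /\
       (isE f1 -> geom_ergodic (joint Centred f1 s1 f2 s2 y) /\
                  (s2 > s1 -> unif_ergodic (joint Centred f1 s1 f2 s2 y))) /\
       (isG f1 \/ isL f1 -> unif_ergodic (joint Centred f1 s1 f2 s2 y))) /\
    (isG f2 \/ isL f2 ->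
       (isC f1 -> ~ geom_ergodic (joint Centred f1 s1 f2 s2 y)) /\
       (isE f1 \/ isG f1 \/ isL f1 -> geom_ergodic (joint Centred f1 s1 f2 s2 y))) ) /\
  (* non-centred parametrisation P1 = (Xtilde, Theta) *)
  ( (isC f2 ->
       (isC f1 -> unif_ergodic (joint NonCentred f1 s1 f2 s2 y)) /\
       (isE f1 \/ isG f1 \/ isL f1 -> ~ geom_ergodic (joint NonCentred f1 s1 f2 s2 y))) /\
    (isE f2 ->
       (isC f1 -> unif_ergodic (joint NonCentred f1 s1 f2 s2 y)) /\
       (isE f1 -> geom_ergodic (joint NonCentred f1 s1 f2 s2 y) /\
                  (s1 > s2 -> unif_ergodic (joint NonCentred f1 s1 f2 s2 y))) /\
       (isG f1 \/ isL f1 -> geom_ergodic (joint NonCentred f1 s1 f2 s2 y))) /\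
    (isG f2 \/ isL f2 ->
       (isC f1 \/ isE f1 -> unif_ergodic (joint NonCentred f1 s1 f2 s2 y)) /\
       (isG f1 \/ isL f1 -> geom_ergodic (joint NonCentred f1 s1 f2 s2 y))) ).
Proof.
  intros h1 h2 o1 o2.
  assert (hE : light FE) by discriminate.
  split; (split; [|split]).
  - intros ->. now apply centred_cauchy_unif.
  - intros ->. split; [|split].
    + intros ->. now apply centred_cauchy_not_geom.
    + intros ->. split; [now apply centred_light_geom|now apply centred_exponentials_unif].
    + intros h. now apply centred_lighter_unif; auto using lighter_families.
  - intros h. apply lighter_families, lighter_light in h. split.
    + intros ->. now apply centred_cauchy_not_geom.
    + intros h'. apply light_families in h'. now apply centred_light_geom.
  - intros ->. split.
    + intros ->. now apply unif_noncentred, centred_cauchy_unif.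
    + intros h. apply light_families in h. rewrite geom_noncentred. now apply centred_cauchy_not_geom.
  - intros ->. split; [|split].
    + intros ->. now apply unif_noncentred, centred_cauchy_unif.
    + intros ->. split; [now apply geom_noncentred, centred_light_geom|].
      intros h. now apply unif_noncentred, centred_exponentials_unif.
    + intros h. apply lighter_families, lighter_light in h.
      now apply geom_noncentred, centred_light_geom.
  - intros h. apply lighter_families in h. assert (h' := lighter_light _ h). split.
    + intros [-> | ->]; apply unif_noncentred.
      * now apply centred_cauchy_unif.
      * now apply centred_lighter_unif.
    + intros g. apply lighter_families, lighter_light in g.
      now apply geom_noncentred, centred_light_geom.
Qed.
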